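(* Let $\mathcal M$ be an o-minimalistic structure. Then every definable subset $X\subseteq M^2$ has a quasi-cell decomposition.
   Context: Let $L$ be a first-order language containing a binary relation symbol $<$; all $L$-structures are assumed to be dense linear orders without endpoints, with the order topology (and product topology on $M^2$). Definable means definable with parameters. An $L$-structure is o-minimal if every definable subset of its universe is a finite union of points and open intervals. An $L$-structure is o-minimalistic if it satisfies every $L$-sentence that holds in every o-minimal $L$-structure. Open intervals are non-empty and have endpoints in $M\cup\{\pm\infty\}$. Cells in $M^2$: a $0$-cell is a point; a $1$-cell is either the graph of a definable continuous map $I\to M$ with $I\subseteq M$ an open interval (horizontal), or a set $\{x\}\times I$ with $I$ an open interval (vertical); a $2$-cell is a set $\{(x,y): x\in I,\ f(x)<y<g(x)\}$ with $I$ an open interval and $f<g$ definable continuous maps $I\to M$, where one or both of the inequalities on $y$ may be omitted. Quasi-cells in $M^2$: let $V\subseteq M$ be a non-empty open convex subset (not necessarily definable). A map $h\colon V\to M$ is called locally definable if its restriction to every open interval contained in $V$ is definable. A (horizontal) $1$-quasi-cell is the graph of a continuous, locally definable map $V\to M$ with $V\subseteq M$ a non-empty open convex subset (not necessarily definable). A $2$-quasi-cell is a set $\{(x,y): x\in V,\ f(x)<y<g(x)\}$ with $V\subseteq M$ a non-empty open convex subset (not necessarily definable) and $f<g$ continuous, locally definable maps $V\to M$, where one or both of the inequalities on $y$ may be omitted. Points and vertical $1$-cells are also counted as ($0$-, respectively $1$-)quasi-cells. Dimension of an arbitrary non-empty subset $B\subseteq M^2$: $2$ if it has non-empty interior, $0$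 if it is discrete, $1$ otherwise; the empty set has dimension $-\infty$. A quasi-cell decomposition of a definable set $X\subseteq M^2$ is a (possibly infinite) partition $X=\bigsqcup_{i\in I}B_i$ into quasi-cells $B_i$ such that, if $X^{(e)}$ denotes the union of all $e$-dimensional $B_i$ in the partition, then $X^{(e)}$ is definable and has dimension at most $e$, for $e=0,1,2$. *)

(* Defs.v *)
From mathcomp Require Import all_boot all_order all_algebra.
From mathcomp Require Import all_classical topology.

Set Implicit Arguments.
Unset Strict Implicit.
Unset Printing Implicit Defensive.

Import Order.TTheory.
Local Open Scope classical_set_scope.
Local Open Scope order_scope.

(* Symbols are indexed by their arity; constants are 0-ary functions. *)
Record language := Language {
  fsym : nat -> Type;
  rsym : nat -> Type;
  lt_sym : rsym 2 }.

Inductive term (L : language) (V : Type) : Type :=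
| Var of V
| App n of fsym L n & ('I_n -> term L V).

(* The free variables of [phi : formula L V] lie in V; in [All phi], the bound
   variable is [None] and the free variables x become [Some x]. *)
Inductive formula (L : language) (V : Type) : Type :=
| Eq of term L V & term L V
| Rel n of rsym L n & ('I_n -> term L V)
| Falsum
| Imp of formula L V & formula L V
| All of formula L (option V).

Definition sentence (L : language) := formula L void.

Record structure (L : language) (d : Order.disp_t) := Structure {
  carrier :> orderTopologicalType d;
  finterp : forall n, fsym L n -> ('I_n -> carrier) -> carrier;
  rinterp : forall n, rsym L n -> ('I_n -> carrier) -> Prop;
  lt_symP : forall v : 'I_2 -> carrier,
    rinterp (lt_sym L) v <-> v ord0 < v ord_max;
  carrier_nonempty : inhabited carrier;
  carrier_dense : forall x y : carrier, x < y -> exists z, x < z < y;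
  carrier_nomin : forall x : carrier, exists y, y < x;
  carrier_nomax : forall x : carrier, exists y, x < y }.

Section Semantics.
Context (L : language) (d : Order.disp_t) (M : structure L d).

Fixpoint eval V (e : V -> M) (t : term L V) : M :=
  match t with
  | Var x => e x
  | App _ f ts => finterp f (fun i => eval e (ts i))
  end.

Definition extend V (e : V -> M) (a : M) (x : option V) : M :=
  if x is Some y then e y else a.

Fixpoint sat V (e : V -> M) (phi : formula L V) : Prop :=
  match phi with
  | Eq t u => eval e t = eval e u
  | Rel _ r ts => rinterp r (fun i => eval e (ts i))
  | Falsum => False
  | Imp phi psi => sat e phi -> sat e psi
  | All phi => forall a, sat (extend e a) phi
  end.

Definition models (phi : sentence L) : Prop := sat (of_void M) phi.

(* The [inr] variables are interpreted by the parameters c. *)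
Definition definable n (X : set ('I_n -> M)) : Prop :=
  exists k (phi : formula L ('I_n + 'I_k)) (c : 'I_k -> M),
    X = [set x | sat (fun v => match v with inl i => x i | inr j => c j end)
                     phi].

Definition definable1 (X : set M) : Prop :=
  definable [set v : 'I_1 -> M | X (v ord0)].

Definition definable2 (X : set (M * M)) : Prop :=
  definable [set v : 'I_2 -> M | X (v ord0, v ord_max)].

Definition open_interval (I : set M) : Prop :=
  I !=set0 /\ exists2 i : interval M, itv_open_ends i & I = [set` i].

Definition o_minimal : Prop :=
  forall X : set M, definable1 X ->
    exists F : set (set M),
      [/\ finite_set F,
          forall A, F A -> (exists x, A = [set x]) \/ open_interval A
        & X = \bigcup_(A in F) A].

End Semantics.

Definition o_minimalistic L d (M : structure L d) : Prop :=
  forall phi : sentence L,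
    (forall d' (N : structure L d'), o_minimal N -> models N phi) ->
    models M phi.

Section QuasiCells.
Context (L : language) (d : Order.disp_t) (M : structure L d).

Definition order_convex (V : set M) : Prop :=
  forall x y z, V x -> V z -> x <= y <= z -> V y.

Definition quasi_base (V : set M) : Prop :=
  [/\ V !=set0, open V & order_convex V].

(* Maps V -> M are represented by total maps M -> M, of which only the values
   on V matter. *)
Definition graph_on (V : set M) (f : M -> M) : set (M * M) :=
  [set p | V p.1 /\ p.2 = f p.1].

Definition locally_definable (V : set M) (f : M -> M) : Prop :=
  forall I, open_interval I -> I `<=` V -> definable2 (graph_on I f).

Definition quasi_map (V : set M) (f : M -> M) : Prop :=
  {within V, continuous f} /\ locally_definable V f.

Definition quasi_cell0 (B : set (M * M)) : Prop := exists p, B = [set p].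

Definition vertical_cell1 (B : set (M * M)) : Prop :=
  exists (x : M) (I : set M), open_interval I /\ B = [set x] `*` I.

Definition horizontal_quasi_cell1 (B : set (M * M)) : Prop :=
  exists (V : set M) (f : M -> M),
    [/\ quasi_base V, quasi_map V f & B = graph_on V f].

(* [None] stands for an omitted inequality. *)
Definition quasi_cell2 (B : set (M * M)) : Prop :=
  exists (V : set M) (lo hi : option (M -> M)),
    [/\ quasi_base V,
        forall f, lo = Some f -> quasi_map V f,
        forall g, hi = Some g -> quasi_map V g,
        forall f g, lo = Some f -> hi = Some g -> forall x, V x -> f x < g x
      & B = [set p | [/\ V p.1,
                         if lo is Some f then f p.1 < p.2 else true
                       & if hi is Some g then p.2 < g p.1 else true]]].

Definition quasi_cell (B : set (M * M)) : Prop :=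
  [\/ quasi_cell0 B, vertical_cell1 B, horizontal_quasi_cell1 B
    | quasi_cell2 B].

(* [None] is the dimension -oo of the empty set. *)
Definition set_dim (B : set (M * M)) : option nat :=
  if `[< B = set0 >] then None
  else if `[< B° !=set0 >] then Some 2
  else if `[< B `<=` isolated B >] then Some 0
  else Some 1.

Definition dim_at_most (B : set (M * M)) (e : nat) : Prop :=
  if set_dim B is Some k then (k <= e)%N else True.

Definition stratum (P : set (set (M * M))) (e : nat) : set (M * M) :=
  \bigcup_(B in [set B | P B /\ set_dim B = Some e]) B.

Definition quasi_cell_decomposition (X : set (M * M))
    (P : set (set (M * M))) : Prop :=
  [/\ partition P id X,
      forall B, P B -> quasi_cell B
    & forall e, (e <= 2)%N ->
        definable2 (stratum P e) /\ dim_at_most (stratum P e) e].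

End QuasiCells.

(* Main.v *)
Require Import Defs.
From mathcomp Require Import all_boot all_order all_algebra.
From mathcomp Require Import all_classical topology.

Set Implicit Arguments.
Unset Strict Implicit.
Unset Printing Implicit Defensive.

Import Order.TTheory.
Local Open Scope classical_set_scope.
Local Open Scope order_scope.

(** Three properties of o-minimal structures are used, each a scheme with one
    sentence for each formula: a bounded definable set of points has a least
    upper bound; a definable set is constant on a one-sided neighbourhood of
    each point and near both ends of the line; a definable function is
    continuous on some subinterval of each interval. The third is a weak form
    of the monotonicity theorem ([cont_near]). An o-minimalistic structure
    inherits the three schemes ([o_minimalistic_dctc],
    [o_minimalistic_gen_cont]), and from there on they are all that is used.

    Let Y be the set of the points (x, y) with y in the boundary of the fibre
    of X over x. In the o-minimal case Y is, over all but finitely many x, a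
    finite union of graphs of continuous functions. Numbers of branches cannot
    be expressed by a formula, so this is replaced by local conditions: x is
    good when X is constant near each point over x outside Y, when Y is a
    graph near each of its points over x, and when over some interval around x
    each point of Y has a window, that is a horizontal strip in which Y is a
    graph over the whole interval. The bad points form a closed discrete set
    ([good_dense], [bad_isolated]): on an interval of bad points, the lowest
    height at which normality fails and the next boundary points above and
    below it would be continuous functions of x on a subinterval, and this
    makes the lowest failure normal.

    Over a bad point the cells are points and vertical intervals. Over an
    interval K of good points, Y is a disjoint union of branches, each
    determined by one value ([sel_uniq]). Following a branch may take
    infinitely many windows, and this is why it need not be definable on the
    whole of K and why the bases of quasi-cells are only convex. If the base is
    a class of points that are linked by windows, the branches are definable on
    the closed intervals inside it. The open intervals that share an end with K
    remain. If some branch is not definable near that end, the base is cut so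
    that no piece reaches the end; as pieces are open, this takes gaps of the
    order, and a locally finite family of them ([end_cuts]).

    The gaps come from the branches ([nogap_trivial]). Let F be a branch, and
    let y0 be its value at x0. If F is, say, above y0 near the end and not
    definable there, then the branch just below F is not definable either, for
    F is the next boundary value above it; and it is still above y0 near the
    end, for otherwise F would be the least boundary value above y0. This gives
    an infinite descending sequence of branches. At x0 they are at most y0, so
    they cross the height y0, and their last crossings form an increasing
    sequence of points. Without gaps it would converge to a good point, near
    which only one branch can meet the height y0.

    The cells are the classes of [same_cell]; their dimension is read off from
    whether x is good and whether (x, y) is in Y, so the strata are definable. *)

(** * Renaming of variables and finite support of formulas *)

Fixpoint term_map (L : language) V V' (f : V -> V') (t : term L V) : term L V' :=
  match t with
  | Var x => Var L (f x)
  | App _ s ts => App s (fun i => term_map f (ts i))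
  end.

Fixpoint formula_map (L : language) V V' (f : V -> V') (phi : formula L V) :
    formula L V' :=
  match phi with
  | Eq t u => Eq (term_map f t) (term_map f u)
  | Rel _ r ts => Rel r (fun i => term_map f (ts i))
  | Falsum => Falsum L V'
  | Imp p q => Imp (formula_map f p) (formula_map f q)
  | All p => All (formula_map (omap f) p)
  end.

Lemma eval_map L d (M : structure L d) V V' (f : V -> V') (e : V' -> M)
    (t : term L V) : Defs.eval e (term_map f t) = Defs.eval (e \o f) t.
Proof. by elim: t => //= n s ts IH; congr finterp; apply: funext. Qed.

Lemma sat_map L d (M : structure L d) V V' (f : V -> V') (e : V' -> M)
    (phi : formula L V) : sat e (formula_map f phi) <-> sat (e \o f) phi.
Proof.
elim: phi V' f e => {V} [V t u|V n r ts|V|V p IHp q IHq|V p IHp] V' f e /=.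
- by rewrite !eval_map.
- suff -> : (fun i => Defs.eval e (term_map f (ts i))) =
            (fun i => Defs.eval (e \o f) (ts i)) by [].
  by apply: funext => i; rewrite eval_map.
- by [].
- by split=> H /IHp /H /IHq.
- split=> H a; move: (H a) => {}H.
  + have -> : extend (e \o f) a = extend e a \o omap f by apply: funext => -[].
    exact/IHp.
  + apply/IHp; suff <- : extend (e \o f) a = extend e a \o omap f by [].
    by apply: funext => -[].
Qed.

Lemma term_support L U (t : term L U) :
  exists (F : finType) (c : F -> U) (t' : term L F), t = term_map c t'.
Proof.
elim: t => [x|n s ts IH].
  by exists unit, (fun=> x), (Var L tt).
pose F i := projT1 (cid (IH i)).
pose c i : F i -> U := projT1 (cid (projT2 (cid (IH i)))).
pose u i : term L (F i) := projT1 (cid (projT2 (cid (projT2 (cid (IH i)))))).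
have uP i : ts i = term_map (@c i) (u i).
  exact: projT2 (cid (projT2 (cid (projT2 (cid (IH i)))))).
exists {i : 'I_n & F i}, (fun p => c (tag p) (tagged p)).
exists (App s (fun i => term_map (fun x => existT _ i x) (u i))).
rewrite /=.
congr App; apply: funext => i; rewrite uP; move: (u i); elim=> //= k s' us IH'.
by congr App; apply: funext.
Qed.

Lemma term_map_comp L V V' V'' (f : V -> V') (g : V' -> V'') (t : term L V) :
  term_map g (term_map f t) = term_map (g \o f) t.
Proof. by elim: t => //= n s ts IH; congr App; apply: funext. Qed.

Lemma formula_map_comp L V V' V'' (f : V -> V') (g : V' -> V'')
    (phi : formula L V) :
  formula_map g (formula_map f phi) = formula_map (g \o f) phi.
Proof.
elim: phi V' V'' f g => {V} [V t u|V n r ts|V|V p IHp q IHq|V p IHp] V' V'' f g //=.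
- by rewrite !term_map_comp.
- by congr Rel; apply: funext => i; rewrite term_map_comp.
- by rewrite IHp IHq.
- by rewrite IHp; congr (All (formula_map _ p)); apply: funext => -[].
Qed.

(** The variables of a formula may range over the points of a structure, as
    parameters; this reduces them to a finite list. *)
Lemma formula_support L U (u0 : U) (phi : formula L U) :
  exists (F : finType) (c : F -> U) (psi : formula L F), phi = formula_map c psi.
Proof.
elim: phi u0 => {U} [U t u|U n r ts|U|U p IHp q IHq|U p IHp] u0.
- have [F [c [t' ->]]] := term_support t.
  have [G [e [u' ->]]] := term_support u.
  exists (F + G)%type, (fun v => match v with inl i => c i | inr i => e i end).
  by exists (Eq (term_map inl t') (term_map inr u')); rewrite /= !term_map_comp.
- pose F i := projT1 (cid (term_support (ts i))).
  pose c i : F i -> U := projT1 (cid (projT2 (cid (term_support (ts i))))).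
  have uP i : exists u, ts i = term_map (@c i) u.
    exact: projT2 (cid (projT2 (cid (term_support (ts i))))).
  exists {i : 'I_n & F i}, (fun p => c (tag p) (tagged p)).
  exists (Rel r (fun i => term_map (fun x => existT _ i x) (projT1 (cid (uP i))))).
  rewrite /=; congr Rel; apply: funext => i; rewrite term_map_comp.
  exact: projT2 (cid (uP i)).
- by exists void, (of_void U), (Falsum L void).
- have [F [c [p' ->]]] := IHp u0; have [G [e [q' ->]]] := IHq u0.
  exists (F + G)%type, (fun v => match v with inl i => c i | inr i => e i end).
  exists (Imp (formula_map inl p') (formula_map inr q')).
  by rewrite /= !formula_map_comp.
- have [F [c [p' ->]]] := IHp None.
  (* The variable bound by the quantifier leaves the support: [u0] is a value
     for it that does not matter. *)
  exists F, (fun i => if c i is Some u then u else u0).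
  exists (All (formula_map (fun i => if c i is Some _ then Some i else None) p')).
  rewrite /= formula_map_comp; congr (All (formula_map _ p')).
  by apply: funext => i /=; case E: (c i) => [u|] //=; rewrite E.
Qed.

(** * Definability in a family of structures *)

Section Definability.
Context (L : language) (I : Type) (dd : I -> Order.disp_t).
Context (st : forall i, structure L (dd i)).
Context (W : Type) (cst : forall i, W -> st i).

Definition env V i (e : V -> st i) (v : V + W) : st i :=
  match v with inl a => e a | inr w => cst i w end.

(** One formula for a whole family of structures. A single structure, all of
    whose points are parameters, gives the definable sets; the family of all
    structures with k marked points gives the properties that a sentence can
    express. *)
Definition Def V (P : forall i, (V -> st i) -> Prop) : Prop :=
  exists phi : formula L (V + W), forall i e, sat (env e) phi <-> P i e.

Lemma Def_ext V (P Q : forall i, (V -> st i) -> Prop) :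
  (forall i e, P i e <-> Q i e) -> Def P -> Def Q.
Proof. by move=> PQ [phi H]; exists phi => i e; rewrite H. Qed.

Lemma Def_false V : Def (fun i (e : V -> st i) => False).
Proof. by exists (Falsum _ _). Qed.

Lemma Def_imp V (P Q : forall i, (V -> st i) -> Prop) :
  Def P -> Def Q -> Def (fun i e => P i e -> Q i e).
Proof. by move=> [p Hp] [q Hq]; exists (Imp p q) => i e /=; rewrite Hp Hq. Qed.

Lemma Def_not V (P : forall i, (V -> st i) -> Prop) :
  Def P -> Def (fun i e => ~ P i e).
Proof. by move=> H; apply: Def_imp => //; exact: Def_false. Qed.

Lemma Def_true V : Def (fun i (e : V -> st i) => True).
Proof. by apply: Def_ext (Def_not (Def_false V)) => i e; split=> // _ []. Qed.

Lemma Def_and V (P Q : forall i, (V -> st i) -> Prop) :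
  Def P -> Def Q -> Def (fun i e => P i e /\ Q i e).
Proof.
move=> dP dQ; apply: Def_ext (Def_not (Def_imp dP (Def_not dQ))) => i e.
split=> [H|[p q] /(_ p)]; last exact.
by split; apply: contrapT => n; apply: H.
Qed.

Lemma Def_or V (P Q : forall i, (V -> st i) -> Prop) :
  Def P -> Def Q -> Def (fun i e => P i e \/ Q i e).
Proof.
move=> dP dQ; apply: Def_ext (Def_imp (Def_not dP) dQ) => i e.
split=> [H|[p|q]] //; have [|n] := pselect (P i e); [by left|right; exact: H].
Qed.

Lemma Def_iff V (P Q : forall i, (V -> st i) -> Prop) :
  Def P -> Def Q -> Def (fun i e => P i e <-> Q i e).
Proof. by move=> dP dQ; apply: Def_and; apply: Def_imp. Qed.

Definition none_var V (v : option V + W) : option (V + W) :=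
  match v with
  | inl (Some a) => Some (inl a) | inl None => None | inr w => Some (inr w)
  end.

Lemma Def_all V (P : forall i, (V -> st i) -> st i -> Prop) :
  Def (fun i (e : option V -> st i) => P i (fun v => e (Some v)) (e None)) ->
  Def (fun i e => forall a, P i e a).
Proof.
move=> [p Hp]; exists (All (formula_map (@none_var V) p)) => i e /=.
have E a : extend (env e) a \o @none_var V = env (extend e a).
  by apply: funext => -[[v|]|w].
split=> H a; have := H a; rewrite sat_map E; first by move/Hp.
by move=> ?; apply/Hp.
Qed.

Lemma Def_ex V (P : forall i, (V -> st i) -> st i -> Prop) :
  Def (fun i (e : option V -> st i) => P i (fun v => e (Some v)) (e None)) ->
  Def (fun i e => exists a, P i e a).
Proof.
move=> dP; apply: Def_ext (Def_not (@Def_all V (fun i e a => ~ P i e a) (Def_not dP))).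
move=> i e.
split.
  by move=> H; apply: contrapT => n; apply: H => a Pa; apply: n; exists a.
by case=> a Pa /(_ a); apply.
Qed.

Lemma Def_ren V V' (f : V -> V' + W) (P : forall i, (V -> st i) -> Prop) :
  Def P -> Def (fun i (e : V' -> st i) => P i (fun v => env e (f v))).
Proof.
move=> [p Hp].
exists (formula_map (fun v => match v with inl a => f a | inr w => inr w end) p).
move=> i e; rewrite sat_map -Hp.
suff -> : env e \o (fun v => match v with inl a => f a | inr w => inr w end) =
          env (fun v => env e (f v)) by [].
by apply: funext => -[].
Qed.

Lemma Def_eq_vars V (a b : V + W) :
  Def (fun i (e : V -> st i) => env e a = env e b).
Proof. by exists (Eq (Var L a) (Var L b)). Qed.

Lemma Def_lt_vars V (a b : V + W) :
  Def (fun i (e : V -> st i) => env e a < env e b).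
Proof.
exists (Rel (lt_sym L) (fun j : 'I_2 => Var L (if j == ord0 then a else b))).
by move=> i e /=; rewrite lt_symP.
Qed.

(** A term is given by its graph, the value being the variable [None]. *)
Definition DTerm V (t : forall i, (V -> st i) -> st i) : Prop :=
  Def (fun i (e : option V -> st i) => e None = t i (fun v => e (Some v))).

Lemma DTerm_var V (v : V) : DTerm (fun i e => e v).
Proof. exact: (@Def_eq_vars (option V) (inl None) (inl (Some v))). Qed.

Lemma DTerm_cst V (w : W) : DTerm (fun i (e : V -> st i) => cst i w).
Proof. exact: (@Def_eq_vars (option V) (inl None) (inr w)). Qed.

Definition D1 (S : forall i, st i -> Prop) : Prop :=
  Def (fun i (e : unit -> st i) => S i (e tt)).

Definition D2 (R : forall i, st i -> st i -> Prop) : Prop :=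
  Def (fun i (e : bool -> st i) => R i (e true) (e false)).

Lemma D1_app V S (t : forall i, (V -> st i) -> st i) :
  D1 S -> DTerm t -> Def (fun i e => S i (t i e)).
Proof.
move=> dS dt.
apply: (Def_ext (P := fun i e => exists a, a = t i e /\ S i a)).
  by move=> i e; split=> [[a [->]]|?] //; exists (t i e).
apply: Def_ex; apply: Def_and => //.
exact: (Def_ren (fun v : unit => inl None) dS).
Qed.

Lemma D2_app V R (t u : forall i, (V -> st i) -> st i) :
  D2 R -> DTerm t -> DTerm u -> Def (fun i e => R i (t i e) (u i e)).
Proof.
move=> dR dt du.
apply: (Def_ext (P := fun i e => exists a, a = t i e /\
                               exists b, b = u i e /\ R i a b)).
  move=> i e; split=> [[a [-> [b [-> //]]]]|?] //.
  by exists (t i e); split=> //; exists (u i e).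
apply: Def_ex; apply: Def_and => //.
apply: Def_ex; apply: Def_and; last first.
  exact: (@Def_ren _ (option (option V)) (fun b : bool =>
    if b then inl (Some None) else inl None) _ dR).
exact: (@Def_ren _ (option (option V)) (fun v : option V =>
  if v is Some a then inl (Some (Some a)) else inl None) _ du).
Qed.

Definition DFun (h : forall i, st i -> st i) : Prop :=
  D2 (fun i x y => y = h i x).

Lemma DTerm_app V h (t : forall i, (V -> st i) -> st i) :
  DFun h -> DTerm t -> DTerm (fun i e => h i (t i e)).
Proof.
move=> dh dt; apply: (@D2_app (option V) (fun i x y => y = h i x)) => //.
  exact: (@Def_ren _ (option (option V)) (fun v : option V =>
    if v is Some a then inl (Some (Some a)) else inl None) _ dt).
exact: DTerm_var.
Qed.

Lemma D2_eq : D2 (fun i => @eq (st i)).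
Proof. exact: (@Def_eq_vars bool (inl true) (inl false)). Qed.

Lemma D2_lt : D2 (fun i (x y : st i) => x < y).
Proof. exact: (@Def_lt_vars bool (inl true) (inl false)). Qed.

End Definability.

(** * Definability in one structure *)

(** [s] selects the order or the reverse one, so that arguments on one side of a
    point, or of a graph, also apply to the other side. *)
Definition olt d (T : porderType d) (s : bool) (x y : T) : Prop :=
  if s then x < y else y < x.

Definition ole d (T : porderType d) (s : bool) (x y : T) : Prop := ~ olt s y x.

Definition oitv d (T : porderType d) s (a b x : T) : Prop :=
  olt s a x /\ olt s x b.

Section OneStructure.
Context (L : language) (d : Order.disp_t) (M : structure L d).

Definition defP V (P : (V -> M) -> Prop) : Prop :=
  @Def L unit (fun=> d) (fun=> M) M (fun _ x => x) V (fun _ e => P e).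
Definition defT V (t : (V -> M) -> M) : Prop :=
  defP (fun e : option V -> M => e None = t (fun v => e (Some v))).
Definition def1 (S : M -> Prop) : Prop := defP (fun e : unit -> M => S (e tt)).
Definition def2 (R : M -> M -> Prop) : Prop :=
  defP (fun e : bool -> M => R (e true) (e false)).
Definition defF (h : M -> M) : Prop := def2 (fun x y => y = h x).

Section Closure.
Context (V : Type).
Implicit Types P Q : (V -> M) -> Prop.

Lemma defP_ext P Q : (forall e, P e <-> Q e) -> defP P -> defP Q.
Proof. by move=> PQ; apply: Def_ext. Qed.
Lemma defP_true : defP (fun _ : V -> M => True). Proof. exact: Def_true. Qed.
Lemma defP_false : defP (fun _ : V -> M => False). Proof. exact: Def_false. Qed.
Lemma defP_imp P Q : defP P -> defP Q -> defP (fun e => P e -> Q e).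
Proof. exact: Def_imp. Qed.
Lemma defP_not P : defP P -> defP (fun e => ~ P e). Proof. exact: Def_not. Qed.
Lemma defP_and P Q : defP P -> defP Q -> defP (fun e => P e /\ Q e).
Proof. exact: Def_and. Qed.
Lemma defP_or P Q : defP P -> defP Q -> defP (fun e => P e \/ Q e).
Proof. exact: Def_or. Qed.
Lemma defP_iff P Q : defP P -> defP Q -> defP (fun e => P e <-> Q e).
Proof. exact: Def_iff. Qed.
Lemma defP_all (P : (V -> M) -> M -> Prop) :
  defP (fun e : option V -> M => P (fun v => e (Some v)) (e None)) ->
  defP (fun e => forall a, P e a).
Proof. exact: (@Def_all _ _ _ _ _ _ _ (fun=> P)). Qed.
Lemma defP_ex (P : (V -> M) -> M -> Prop) :
  defP (fun e : option V -> M => P (fun v => e (Some v)) (e None)) ->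
  defP (fun e => exists a, P e a).
Proof. exact: (@Def_ex _ _ _ _ _ _ _ (fun=> P)). Qed.
Lemma defT_var (v : V) : defT (fun e => e v). Proof. exact: DTerm_var. Qed.
Lemma defT_cst (c : M) : defT (fun _ : V -> M => c).
Proof. exact: (@DTerm_cst L unit (fun=> d) (fun=> M) M (fun _ x => x) V c). Qed.
Lemma defP_app1 S (t : (V -> M) -> M) :
  def1 S -> defT t -> defP (fun e => S (t e)).
Proof. exact: (@D1_app _ unit _ (fun=> M) M (fun _ x => x) V (fun=> S) (fun=> t)). Qed.
Lemma defP_app2 R (t u : (V -> M) -> M) :
  def2 R -> defT t -> defT u -> defP (fun e => R (t e) (u e)).
Proof. 
exact: (@D2_app _ unit _ (fun=> M) M (fun _ x => x) V (fun=> R) (fun=> t) (fun=> u)). Qed.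
Lemma defT_app h (t : (V -> M) -> M) :
  defF h -> defT t -> defT (fun e => h (t e)).
Proof. exact: (@DTerm_app _ unit _ (fun=> M) M (fun _ x => x) V (fun=> h) (fun=> t)). Qed.
End Closure.

Lemma def2_eq : def2 (@eq M). Proof. exact: (@D2_eq L unit (fun=> d) (fun=> M) M (fun _ x => x)). Qed.
Lemma def2_lt : def2 (fun x y : M => x < y).
Proof. exact: (@D2_lt L unit (fun=> d) (fun=> M) M (fun _ x => x)). Qed.
Lemma def2_olt s : def2 (@olt d M s).
Proof.
case: s; first exact: def2_lt.
exact: (defP_app2 def2_lt (defT_var false) (defT_var true)).
Qed.
Lemma def2_ole s : def2 (@ole d M s).
Proof.
exact: defP_not (defP_app2 (def2_olt s) (defT_var false) (defT_var true)).
Qed.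

Lemma defP_param V (P : (V -> M) -> Prop) : defP P ->
  exists k (psi : formula L (V + 'I_k)) (c : 'I_k -> M), forall e,
    P e <-> sat (fun v => match v with inl a => e a | inr j => c j end) psi.
Proof.
case=> phi phiP; have [m0] := carrier_nonempty M.
have [F [f [psi E]]] := formula_support (inr m0 : V + M) phi.
exists #|F|.
exists (formula_map (fun i : F =>
  match f i with inl a => inl a | inr _ => inr (enum_rank i) end) psi).
exists (fun j => match f (enum_val j) with inl _ => m0 | inr m => m end) => e.
rewrite -(phiP tt) E !sat_map; set e1 := _ \o f; set e2 := _ \o _.
suff -> : e1 = e2 by [].
apply: funext => i; rewrite /e1 /e2 /= /env.
by case E' : (f i) => [a|m] //; rewrite enum_rankK E'.
Qed.

End OneStructure.

Create HintDb definable.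
#[export] Hint Resolve def2_eq def2_lt def2_olt def2_ole : definable.

Ltac dfn_term :=
  cbv beta;
  first
  [ exact: defT_cst
  | lazymatch goal with
    | |- defT (fun e => e ?v) => exact: (@defT_var _ _ _ _ v)
    | |- defT (fun e => ?h (@?t e)) =>
      apply: (@defT_app _ _ _ _ h t); [solve [eauto 2 with definable] | dfn_term]
    end ].

Ltac dfn :=
  cbv beta delta [oitv];
  lazymatch goal with
  | |- def1 _ => rewrite /def1; dfn
  | |- def2 _ => rewrite /def2; dfn
  | |- defF _ => rewrite /defF; dfn
  | |- defP (fun e => True) => exact: defP_true
  | |- defP (fun e => False) => exact: defP_false
  | |- defP (fun e => @?P e /\ @?Q e) => apply: (@defP_and _ _ _ _ P Q); dfn
  | |- defP (fun e => @?P e \/ @?Q e) => apply: (@defP_or _ _ _ _ P Q); dfn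
  | |- defP (fun e => @?P e <-> @?Q e) => apply: (@defP_iff _ _ _ _ P Q); dfn
  | |- defP (fun e => ~ @?P e) => apply: (@defP_not _ _ _ _ P); dfn
  | |- defP (fun e => exists a, @?P e a) => apply: (@defP_ex _ _ _ _ P); dfn
  | |- defP (fun e => is_true (@?t e < @?u e)) =>
      apply: (@defP_app2 _ _ _ _ (fun x y => is_true (x < y)) t u);
        [exact: def2_lt | dfn_term | dfn_term]
  | |- defP (fun e => ?R (@?t e) (@?u e)) =>
      apply: (@defP_app2 _ _ _ _ R t u);
        [solve [eauto 2 with definable] | dfn_term | dfn_term]
  | |- defP (fun e => ?S (@?t e)) =>
      apply: (@defP_app1 _ _ _ _ S t); [solve [eauto 2 with definable] | dfn_term]
  | |- defP (fun e => @?P e -> @?Q e) => apply: (@defP_imp _ _ _ _ P Q); dfn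
  | |- defP (fun e => forall a, @?P e a) => apply: (@defP_all _ _ _ _ P); dfn
  end.

(** * Reasoning in oriented orders *)

Section OrientedOrder.
Context (d : Order.disp_t) (T : orderType d).
Implicit Types (s : bool) (x y z : T).

Lemma olt_irr s x : ~ olt s x x.
Proof. by case: s; rewrite /olt ltxx. Qed.

Lemma olt_trans s x y z : olt s x y -> olt s y z -> olt s x z.
Proof.
by case: s; rewrite /olt => H1 H2; [exact: lt_trans H2|exact: lt_trans H1].
Qed.

Lemma olt_cases s x y : [\/ olt s x y, x = y | olt s y x].
Proof.
case: s; rewrite /olt; case: (ltgtP x y);
  by [constructor 1|constructor 2|constructor 3].
Qed.

Lemma ole_refl s x : ole s x x. Proof. exact: olt_irr. Qed.

Lemma oltW s x y : olt s x y -> ole s x y.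
Proof. by move=> H1 H2; apply: (olt_irr (olt_trans H1 H2)). Qed.

Lemma ole_trans s x y z : ole s x y -> ole s y z -> ole s x z.
Proof.
move=> xy yz zx; have [xy'|E|//] := olt_cases s x y.
  exact: yz (olt_trans zx xy').
by apply: yz; rewrite -E.
Qed.

Lemma ole_contra s x y : olt s x y -> ole s y x -> False.
Proof. by move=> H; apply. Qed.

Lemma ole_anti s x y : ole s x y -> ole s y x -> x = y.
Proof. by move=> xy yx; have [|//|] := olt_cases s x y. Qed.

Lemma nole s x y : ~ ole s x y -> olt s y x.
Proof. exact: contrapT. Qed.

Lemma olt_neg s x y : olt (~~ s) x y = olt s y x.
Proof. by case: s. Qed.

Lemma olt_false x y : olt false x y = olt true y x. Proof. by []. Qed.

Lemma ole_neg s x y : ole (~~ s) x y = ole s y x.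
Proof. by rewrite /ole olt_neg. Qed.

End OrientedOrder.

(** Order goals are decided by reflection: the hypotheses are the edges of a
    graph on the terms they mention, and they are inconsistent as soon as some
    cycle contains a strict edge. *)
Inductive order_edge := ELt of nat & nat | ELe of nat & nat | EEq of nat & nat.

Definition edge_holds d (T : porderType d) s (v : nat -> T) e : Prop :=
  match e with
  | ELt i j => olt s (v i) (v j)
  | ELe i j => ole s (v i) (v j)
  | EEq i j => v i = v j
  end.

Definition edges_imply d (T : porderType d) s (v : nat -> T) es (G : Prop) :=
  foldr (fun e P => edge_holds s v e -> P) G es.

Fixpoint is_reached (i : nat) (r : seq nat) : bool :=
  if r is j :: r' then if eqn i j then true else is_reached i r' else false.

Definition arc i j (r : seq nat) : seq nat :=
  if is_reached i r then if is_reached j r then r else j :: r else r.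

Definition follow_edges (es : seq order_edge) (r : seq nat) : seq nat :=
  foldl (fun r e => match e with
    | ELt i j => arc i j r | ELe i j => arc i j r
    | EEq i j => arc j i (arc i j r) end) r es.

Fixpoint reaches (es : seq order_edge) (fuel i : nat) (r : seq nat) : bool :=
  if is_reached i r then true else
  if fuel is n.+1 then
    let r' := follow_edges es r in
    if eqn (size r') (size r) then false else reaches es n i r'
  else false.

Fixpoint strict_cycle (es fs : seq order_edge) : bool :=
  match fs with
  | ELt i j :: fs' =>
      if reaches es 20 i [:: j] then true
      else strict_cycle es fs'
  | _ :: fs' => strict_cycle es fs'
  | [::] => false
  end.

Section Reflection.
Context (d : Order.disp_t) (T : orderType d) (s : bool) (v : nat -> T).

Fixpoint all_hold (es : seq order_edge) : Prop :=
  if es is e :: es' then edge_holds s v e /\ all_hold es' else True.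

Let from j r := forall i, is_reached i r -> ole s (v j) (v i).

Lemma from_cons j i r : from j r -> ole s (v j) (v i) -> from j (i :: r).
Proof.
move=> Hr ji k /=; case: eqnP => [->//|_]; exact: Hr.
Qed.

Lemma from_arc j i k r : from j r -> ole s (v i) (v k) -> from j (arc i k r).
Proof.
rewrite /arc => Hr ik; case: ifP => // ri; case: ifP => // _.
by apply: from_cons => //; apply: ole_trans ik; apply: Hr.
Qed.

Lemma from_follow j es r : all_hold es -> from j r -> from j (follow_edges es r).
Proof.
elim: es r => //= e es IH r [He Hes] Hr; apply: IH => //.
case: e He => i k /= He; first by apply: from_arc => //; exact: oltW.
  exact: from_arc.
by apply: from_arc; [apply: from_arc => //|]; rewrite He; exact: ole_refl.
Qed.

Lemma strict_cycle_sound es fs : all_hold es -> all_hold fs ->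
  strict_cycle es fs -> False.
Proof.
move=> Hes; elim: fs => //= -[i j|i j|i j] fs IH [Hf Hfs]; try exact: IH.
case: ifP => [R _|_]; last exact: IH.
apply: (ole_contra Hf).
suff H n r : from j r -> reaches es n i r -> ole s (v j) (v i).
  by apply: (H 20 [:: j] _ R); apply: from_cons => [i'|] //; exact: ole_refl.
elim: n r => [|n IHn] r Hr /=; case: ifP => [/Hr//|_] //.
by case: ifP => // _; apply: IHn; exact: from_follow.
Qed.

Lemma order_contradiction es : strict_cycle es (rev es) -> edges_imply s v es False.
Proof.
move=> C; suff H fs : (all_hold fs -> False) -> edges_imply s v fs False.
  apply: H => Hes; apply: strict_cycle_sound C => //.
  elim: (es) Hes => //= e es' IH [He Hes']; rewrite rev_cons -cats1.
  by elim: (rev es') (IH Hes') => //= f fs IHf [Hf /IHf].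
elim: fs => [|f fs IH] H /=; first exact: H.
by move=> Hf; apply: IH => Hfs; exact: H.
Qed.

End Reflection.

Ltac oinsert x l :=
  lazymatch l with
  | context [@cons _ x _] => l
  | _ => constr:(x :: l)
  end.

Ltac oatoms G l :=
  lazymatch G with
  | olt _ ?x ?y -> ?G' => let l1 := oinsert x l in let l2 := oinsert y l1 in oatoms G' l2
  | ole _ ?x ?y -> ?G' => let l1 := oinsert x l in let l2 := oinsert y l1 in oatoms G' l2
  | ?x = ?y -> ?G' => let l1 := oinsert x l in let l2 := oinsert y l1 in oatoms G' l2
  | False => l
  end.

Ltac oindex x l :=
  lazymatch l with
  | x :: _ => constr:(0%nat)
  | _ :: ?l' => let n := oindex x l' in constr:(S n)
  end.

Ltac oreify G l :=
  lazymatch G with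
  | olt _ ?x ?y -> ?G' => let i := oindex x l in let j := oindex y l in
      let es := oreify G' l in constr:(ELt i j :: es)
  | ole _ ?x ?y -> ?G' => let i := oindex x l in let j := oindex y l in
      let es := oreify G' l in constr:(ELe i j :: es)
  | ?x = ?y -> ?G' => let i := oindex x l in let j := oindex y l in
      let es := oreify G' l in constr:(EEq i j :: es)
  | False => constr:(@nil order_edge)
  end.

Ltac ocycle_in s A :=
  repeat match goal with
  | H : @eq ?B _ _ |- _ => unify A B; revert H
  end;
  repeat match goal with
  | H : ole s _ _ |- _ => revert H
  | H : olt s _ _ |- _ => revert H
  end;
  lazymatch goal with |- ?G =>
    let l := oatoms G (@nil A) in
    let es := oreify G l in
    lazymatch l with ?x0 :: _ =>
      refine (@order_contradiction _ _ s (fun n => nth x0 l n) es _);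
      vm_compute; reflexivity
    end
  end.

(* Each orientation occurring in the context is tried once. *)
Ltac ocycle :=
  lazymatch goal with
  | H : @olt _ _ ?s ?x _ |- False =>
    let A := type of x in
    first [ solve [ocycle_in s A]
          | repeat match goal with
            | H' : olt s _ _ |- _ => clear H'
            | H' : ole s _ _ |- _ => clear H'
            end; ocycle ]
  end.

Ltac ocycle_at s :=
  lazymatch goal with
  | H : @olt _ _ s ?x _ |- False => let A := type of x in first [solve [ocycle_in s A] | ocycle]
  | _ => ocycle
  end.

Ltac onorm :=
  repeat match goal with
  | H : _ /\ _ |- _ => destruct H
  | H : oitv _ _ _ _ |- _ => destruct H
  | H : ~ olt ?s ?x ?y |- _ => change (ole s y x) in H
  | H : ~ ole ?s ?x ?y |- _ => apply nole in H
  | H : olt (~~ _) _ _ |- _ => rewrite olt_neg in H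
  | H : ole (~~ _) _ _ |- _ => rewrite ole_neg in H
  | |- context [olt (~~ _) _ _] => rewrite olt_neg
  | H : olt false _ _ |- _ => rewrite olt_false in H
  | H : ole false ?x ?y |- _ => change (ole true y x) in H
  | |- context [olt false _ _] => rewrite olt_false
  | |- context [ole false ?x ?y] => change (ole false x y) with (ole true y x)
  | |- context [ole (~~ _) _ _] => rewrite ole_neg
  end.

Ltac ord :=
  intros; onorm;
  lazymatch goal with
  | |- _ /\ _ => split; ord
  | |- oitv _ _ _ _ => split; ord
  | |- olt ?s ?x ?y =>
      apply: contrapT; change (ole s y x -> False); intro; ocycle_at s
  | |- ole ?s ?x ?y => intro; ocycle_at s
  | |- ~ _ => intro; onorm; ocycle
  | |- _ <> _ => intro; onorm; ocycle
  | |- False => ocycle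
  | |- is_true _ => exfalso; ocycle
  | |- ?x = ?y :> _ =>
    match goal with
    | _ : context [olt ?s] |- _ => apply: (@ole_anti _ _ s); intro; ocycle_at s
    | _ : context [ole ?s] |- _ => apply: (@ole_anti _ _ s); intro; ocycle_at s
    end
  | |- _ => exfalso; ocycle
  end.

(** * The three schemes and their transfer *)

Section Schemas.
Context (d : Order.disp_t) (T : orderType d).

(** Definable completeness, for a single set. *)
Definition has_lub s (S : T -> Prop) : Prop :=
  (exists x, S x) -> (exists b, forall x, S x -> ole s x b) ->
  exists l, (forall x, S x -> ole s x l) /\
            forall b, (forall x, S x -> ole s x b) -> ole s l b.

(** Type completeness, for a single set: the types of one-sided neighbourhoods
    of a point, and of the ends of the line, decide it. *)
Definition const_germs s (S : T -> Prop) : Prop :=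
  forall a, exists b, olt s a b /\
    ((forall x, oitv s a b x -> S x) \/ (forall x, oitv s a b x -> ~ S x)).
Definition const_end s (S : T -> Prop) : Prop :=
  exists b, (forall x, olt s b x -> S x) \/ (forall x, olt s b x -> ~ S x).

Definition cont_at (h : T -> T) x : Prop :=
  forall u v, oitv true u v (h x) -> exists p q, oitv true p q x /\
    forall z, oitv true p q z -> oitv true u v (h z).

(** The function is given by its graph, since a formula defines a relation; it
    being a function is part of what the sentence says. *)
Definition gen_cont (R : T -> T -> Prop) : Prop :=
  (forall x, exists y, R x y /\ forall y', R x y' -> y' = y) ->
  forall a b, olt true a b -> exists a' b',
    (ole true a a' /\ olt true a' b' /\ ole true b' b) /\
    forall x y, oitv true a' b' x -> R x y ->
      forall u v, oitv true u v y -> exists p q, oitv true p q x /\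
      forall z w, oitv true p q z -> R z w -> oitv true u v w.

End Schemas.

(** The name abbreviates definable completeness and type completeness. *)
Record dctc L d (M : structure L d) : Prop := Dctc {
  dctc_lub : forall s S, def1 (M := M) S -> has_lub s S;
  dctc_germ : forall s S, def1 (M := M) S -> const_germs s S;
  dctc_end : forall s S, def1 (M := M) S -> const_end s S }.

Section Transfer.
Context (L : language).

Lemma close_formula k (phi : formula L 'I_k) : exists psi : sentence L,
  forall d (N : structure L d), models N psi <-> forall c : 'I_k -> N, sat c phi.
Proof.
elim: k phi => [|k IH] phi.
  have f : 'I_0 -> void by case.
  exists (formula_map f phi) => d N; rewrite /models sat_map.
  have E (c c' : 'I_0 -> N) : c = c' by apply: funext => -[].
  by split=> [H c|]; [rewrite (E c (of_void N \o f))|exact].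
have [psi H] := IH (All (formula_map (unlift ord0) phi)).
exists psi => d N; rewrite H; split=> Hc c.
  have /sat_map := Hc (fun i => c (lift ord0 i)) (c ord0).
  set e := _ \o _; suff -> : e = c by [].
  by apply: funext => i; rewrite /e /=; case: unliftP => [j|] ->.
by move=> a; apply/sat_map.
Qed.

Definition param_index k := {d : Order.disp_t & {N : structure L d & 'I_k -> N}}.

Let idd k (i : param_index k) : Order.disp_t := projT1 i.
Let ist k (i : param_index k) : structure L (idd i) := projT1 (projT2 i).
Let icst k (i : param_index k) : 'I_k -> ist i := projT2 (projT2 i).

(** The hypothesis on [Q] says that it is expressed by a formula that depends
    only on the one defining the predicate. Parameters of the predicate become
    free variables; the sentence that is transferred quantifies over them. *)
Lemma transfer (V : Type) (Q : forall d (N : structure L d), ((V -> N) -> Prop) -> Prop) :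
  (forall I (dd : I -> Order.disp_t) (st : forall i, structure L (dd i)) W
     (cst : forall i, W -> st i) (P : forall i, (V -> st i) -> Prop),
     Def cst P -> Def cst (fun i (_ : void -> st i) => Q _ _ (P i))) ->
  (forall d (N : structure L d), o_minimal N -> forall P, defP P -> Q _ N P) ->
  forall d (M : structure L d), o_minimalistic M ->
  forall P, defP P -> Q _ M P.
Proof.
move=> QD QO d M hM P /defP_param[k [psi [c Pc]]].
have [|phi phiP] := QD _ _ (@ist k) _ (@icst k)
   (fun i e => sat (fun v => match v with inl a => e a | inr j => @icst k i j end) psi).
  by exists psi => i e.
have [chi chiP] := close_formula
  (formula_map (fun v : void + 'I_k => match v with inl a => of_void _ a | inr j => j end) phi).
pose pix d' (N : structure L d') c' : param_index k := existT _ d' (existT _ N c').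
pose Pc' d' (N : structure L d') c' (e : V -> N) :=
  sat (fun v => match v with inl a => e a | inr j => c' j end) psi.
have envE d' (N : structure L d') (c' : 'I_k -> N) :
    env (@icst k) (i := pix d' N c') (of_void N) =
    c' \o (fun v : void + 'I_k => match v with inl a => of_void _ a | inr j => j end).
  by apply: funext => -[[]|j].
have : models M chi.
  apply: hM => d' N oN; apply/chiP => c'; rewrite sat_map -envE.
  apply/(phiP (pix d' N c')); apply: (QO d' N oN (Pc' d' N c')).
  pose f (v : V + 'I_k) : V + N :=
    match v with inl a => inl a | inr j => inr (c' j) end.
  exists (formula_map f psi) => -[] e; rewrite sat_map.
  by set e1 := _ \o f; suff -> : e1 = fun v =>
    match v with inl a => e a | inr j => c' j end; [|apply: funext => -[]].
move=> /chiP/(_ c); rewrite sat_map -envE => H.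
suff -> : P = Pc' d M c by exact: (phiP (pix d M c) _).1 H.
by apply: funext => e; apply: propext.
Qed.
End Transfer.
Arguments dctc_lub {L d M} _ s {S} _.
Arguments dctc_germ {L d M} _ s {S} _.
Arguments dctc_end {L d M} _ s {S} _.

(** * Completeness of o-minimal structures *)

Section Structures.
Context (L : language) (d : Order.disp_t) (M : structure L d).

Lemma olt_dense s (x y : M) : olt s x y -> exists z, oitv s x y z.
Proof.
case: s; rewrite /oitv /olt => /carrier_dense[z /andP[H1 H2]]; by exists z.
Qed.

Lemma olt_above s (x : M) : exists y, olt s x y.
Proof. by case: s; [exact: carrier_nomax|exact: carrier_nomin]. Qed.

Lemma olt_below s (x : M) : exists y, olt s y x.
Proof. by have := olt_above (~~ s) x; rewrite /olt; case: s. Qed.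

Lemma omax s (x y : M) : exists z, [/\ ole s x z, ole s y z & z = x \/ z = y].
Proof.
have [H|->|H] := olt_cases s x y; [exists y|exists y|exists x]; split; auto;
  by [apply: oltW|apply: ole_refl].
Qed.

Lemma omin s (x y : M) : exists z, [/\ ole s z x, ole s z y & z = x \/ z = y].
Proof. by have [z []] := omax (~~ s) x y; rewrite !ole_neg; exists z. Qed.

End Structures.

Section OMinimal.
Context (L : language) (d : Order.disp_t) (N : structure L d).
Hypothesis oN : o_minimal N.

Lemma def1_definable1 (S : N -> Prop) : def1 S -> definable1 [set x | S x].
Proof.
move=> dS; have [k [psi [c H]]] : exists k (psi : formula L ('I_1 + 'I_k)) c,
    forall e : 'I_1 -> N, S (e ord0) <->
    sat (fun v => match v with inl a => e a | inr j => c j end) psi.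
  by apply: defP_param; dfn.
exists k, psi, c; apply/seteqP; split=> v /=; by move/H.
Qed.

Lemma open_interval_bounds s (A : set N) : open_interval A ->
  exists l u : option N, forall x, A x <->
    (if l is Some a then olt s a x else True) /\
    (if u is Some b then olt s x b else True).
Proof.
case=> _ [[a b] ab ->].
have H : exists l u : option N, forall x, (x \in Interval a b) <->
    (if l is Some a then olt true a x else True) /\
    (if u is Some b then olt true x b else True).
  move: ab; case: a => [[] a|[]]; case: b => [[] b|[]] //= _.
  - exists (Some a), (Some b) => x; rewrite in_itv /=.
    by split=> [/andP|[H1 H2]] //; apply/andP.
  - by exists (Some a), None => x; rewrite in_itv /= andbT; split=> // -[].
  - by exists None, (Some b) => x; rewrite in_itv /=; split=> // -[].
  - by exists None, None => x; rewrite in_itv /=; split.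
case: s; first exact: H.
case: H => l [u lu]; exists u, l => x; rewrite /= lu.
by split=> -[]; case: l {lu} => [l|]; case: u => [u|].
Qed.

Lemma definable_union (S : N -> Prop) : def1 S ->
  exists F : seq (set N), (forall A, A \in F ->
      (exists x, A = [set x]) \/ open_interval A) /\
    S = (fun x => exists2 A, A \in F & A x).
Proof.
move=> /def1_definable1/oN[F [/finite_seqP[G ->] FP SE]]; by exists G.
Qed.

(** Finite unions of points and intervals are checked piece by piece. *)
Lemma union_ind (Q : (N -> Prop) -> Prop) :
  Q (fun=> False) -> (forall x, Q (fun y => y = x)) ->
  (forall A : set N, open_interval A -> Q A) ->
  (forall A B : N -> Prop, Q A -> Q B -> Q (fun x => A x \/ B x)) ->
  forall S, def1 S -> Q S.
Proof.
move=> Q0 Q1 Qi QU S /definable_union[F [FP ->]].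
elim: F FP => [|A F IH] FP.
  suff -> : (fun x : N => exists2 A : set N, A \in [::] & A x) = fun=> False by [].
  by apply: funext => x; apply: propext; split=> // -[].
suff -> : (fun x : N => exists2 B : set N, B \in A :: F & B x) =
    fun x => A x \/ exists2 B, B \in F & B x.
  apply: QU; last by apply: IH => B BF; apply: FP; rewrite inE BF orbT.
  by have [|[x ->]|] := FP A; [rewrite inE eqxx|exact: Q1|exact: Qi].
apply: funext => x; apply: propext; split=> [[B]|[Ax|[B BF Bx]]].
- by rewrite inE => /predU1P[->|BF] Bx; [left|right; exists B].
- by exists A => //; rewrite inE eqxx.
- by exists B => //; rewrite inE BF orbT.
Qed.

Lemma o_minimal_lub s S : def1 (M := N) S -> has_lub s S.
Proof.
move: S; apply: union_ind.
- by case.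
- by move=> x _ _; exists x; split=> [y ->|b]; [exact: ole_refl|apply].
- move=> A Ai; have [l [u lu]] := open_interval_bounds s Ai.
  move=> [x /lu[lx ux]] [b Ab]; case: u lu ux => [u|] lu ux; last first.
    have [y [xy by_ _]] := omax s x b; have [z yz] := olt_above s y.
    have /Ab : A z by apply/lu; split=> //; case: l lx {lu} => // l lx; ord.
    by move=> ?; exfalso; ord.
  exists u; split=> [y /lu[_ yu]|c Ac]; first by ord.
  move=> cu; have [y [xy cy yE]] := omax s x c.
  have [z yz] : exists z, oitv s y u z by apply: olt_dense; case: yE => ->.
  have /Ac : A z by apply/lu; case: l lx {lu} => // *; split => //; ord.
  by move=> ?; ord.
- move=> A B lA lB neAB [b ABb].
  have [neA|nA] := pselect (exists x, A x); last first.
    have [| |l [l1 l2]] := lB; [|by exists b => x Bx; apply: ABb; right|].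
    + by case: neAB => x [Ax|Bx]; [case: nA; exists x|exists x].
    + exists l; split=> [x [Ax|]|c Hc]; [by case: nA; exists x|exact: l1|].
      by apply: l2 => x Bx; apply: Hc; right.
  have [neB|nB] := pselect (exists x, B x); last first.
    have [|l [l1 l2]] := lA neA; first by exists b => x Ax; apply: ABb; left.
    exists l; split=> [x [|Bx]|c Hc]; [exact: l1|by case: nB; exists x|].
    by apply: l2 => x Ax; apply: Hc; left.
  have [|l [l1 l2]] := lA neA; first by exists b => x Ax; apply: ABb; left.
  have [|m [m1 m2]] := lB neB; first by exists b => x Bx; apply: ABb; right.
  have [z [lz mz zE]] := omax s l m; exists z; split.
    by move=> x [/l1|/m1] H; ord.
  by move=> c Hc; case: zE => ->; [apply: l2|apply: m2] => x Ax; apply: Hc; auto.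
Qed.

Lemma const_germsU s (A B : N -> Prop) : const_germs s A -> const_germs s B ->
  const_germs s (fun x => A x \/ B x).
Proof.
move=> gA gB a; have [b [ab Ab]] := gA a; have [c [ac Bc]] := gB a.
have [z [zb zc zE]] := omin s b c; exists z; split.
  by case: zE => ->.
case: Ab => [Ab|Ab]; first by left=> x ?; left; apply: Ab; ord.
case: Bc => [Bc|Bc]; first by left=> x ?; right; apply: Bc; ord.
by right=> x ? [|]; [apply: Ab|apply: Bc]; ord.
Qed.

Lemma const_germs_lt s t (b : N) : const_germs s (fun x => olt t x b).
Proof.
move=> a; have [<-|nts] := eqVneq s t.
  have [ab|ba] := pselect (olt s a b).
    by exists b; split=> //; left=> x []. 
  have [c ac] := olt_above s a; exists c; split=> //; right=> x ?; ord.
have -> : t = ~~ s by move: nts; case: s; case: t.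
rewrite /olt; have [ab|ba] := pselect (olt s a b).
  by exists b; split=> //; right=> x ?; rewrite -/(olt (~~ s) x b); ord.
have [c ac] := olt_above s a; exists c; split=> //; left=> x ?.
by rewrite -/(olt (~~ s) x b); ord.
Qed.

Lemma const_germsN s (A : N -> Prop) : const_germs s A ->
  const_germs s (fun x => ~ A x).
Proof.
move=> gA a; have [b [ab Ab]] := gA a; exists b; split=> //.
by case: Ab => H; [right=> x /H Ax nA; exact: nA|left].
Qed.

Lemma const_germs_ext s (A B : N -> Prop) : (forall x, A x <-> B x) ->
  const_germs s A -> const_germs s B.
Proof.
by move=> AB; suff -> : A = B by []; apply: funext => x; apply: propext.
Qed.

Lemma const_germsT s : const_germs s (fun _ : N => True).
Proof. by move=> a; have [b ab] := olt_above s a; exists b; split=> //; left. Qed.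

Lemma const_germsI s (A B : N -> Prop) : const_germs s A -> const_germs s B ->
  const_germs s (fun x => A x /\ B x).
Proof.
move=> /const_germsN gA /const_germsN gB.
apply: const_germs_ext (const_germsN (const_germsU gA gB)) => x.
split=> [H|[Ax Bx] []//]; split; apply: contrapT; tauto.
Qed.

Lemma o_minimal_germ s S : def1 (M := N) S -> const_germs s S.
Proof.
move: S; apply: union_ind.
- by apply: const_germs_ext (const_germsN (const_germsT s)) => x; tauto.
- move=> x; apply: (const_germs_ext (A := fun y => ~ (olt true y x \/ olt false y x))).
    move=> y; split=> [H|->]; last by move=> [|] H; exact: (olt_irr H).
    by have [lt|//|lt] := olt_cases true y x; case: H; [left|right].
  by apply: const_germsN; apply: const_germsU; apply: const_germs_lt.
- move=> A /(open_interval_bounds true)[l [u lu]].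
  apply: (const_germs_ext (fun x => iff_sym (lu x))).
  apply: const_germsI.
    case: l {lu} => [a|]; last exact: const_germsT.
    exact: (@const_germs_lt s false).
  by case: u {lu} => [a|]; [exact: const_germs_lt|exact: const_germsT].
- exact: const_germsU.
Qed.

Lemma o_minimal_end s S : def1 (M := N) S -> const_end s S.
Proof.
move: S; apply: union_ind.
- by have [x] := carrier_nonempty N; exists x; right=> y _.
- by move=> x; exists x; right=> y + E; rewrite E; exact: olt_irr.
- move=> A /(open_interval_bounds s)[l [[u|] lu]].
    by exists u; right=> x ? /lu[_ ?]; ord.
  case: l lu => [l|] lu; first by exists l; left=> x ?; apply/lu.
  by have [x] := carrier_nonempty N; exists x; left=> y _; apply/lu.
- move=> A B [a Aa] [b Bb]; have [c [ac bc _]] := omax s a b; exists c.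
  case: Aa => Aa; first by left=> x ?; left; apply: Aa; ord.
  case: Bb => Bb; first by left=> x ?; right; apply: Bb; ord.
  by right=> x ? []; [apply: Aa|apply: Bb]; ord.
Qed.

Lemma o_minimal_dctc : dctc N.
Proof. by split; [exact: o_minimal_lub|exact: o_minimal_germ|exact: o_minimal_end]. Qed.

Lemma itv_infinite s (a b : N) : olt s a b -> ~ finite_set (oitv s a b).
Proof.
move=> ab /finite_seqP[F FE].
suff [a' [b' [H1 H2 H3 H4]]] : exists a' b', [/\ ole s a a', olt s a' b', ole s b' b &
    forall x, x \in F -> ~ oitv s a' b' x].
  have [z zab] := olt_dense H2; apply: (H4 z) => //.
  by have : oitv s a b z by [ord]; rewrite FE.
elim: F {FE} => [|c F [a' [b' [H1 H2 H3 H4]]]].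
  by exists a, b; split=> //; exact: ole_refl.
have [z zab] := olt_dense H2.
have [H|E] := pselect (olt s z c).
  exists a', z; split; try ord; move=> x; rewrite inE => /predU1P[->|/H4 n] ?.
    by ord.
  by apply: n; ord.
exists z, b'; split; try ord; move=> x; rewrite inE => /predU1P[->|/H4 n] ?.
  by ord.
by apply: n; ord.
Qed.

Lemma o_minimal_finite S : def1 (M := N) S -> finite_set S \/
  exists a b, olt true a b /\ forall x, oitv true a b x -> S x.
Proof.
move: S; apply: union_ind.
- by left; exact: finite_set0.
- by move=> x; left; exact: finite_set1.
- move=> A /[dup] -[[x Ax] _] /(open_interval_bounds true)[l [u lu]]; right.
  have [lx xu] := (lu x).1 Ax.
  have [a [ax la]] : exists a, olt true a x /\ (if l is Some l then ole true l a else True).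
    case: l lx {lu} => [l|] lx; first by exists l; split=> //; exact: ole_refl.
    by have [a ?] := olt_below true x; exists a.
  exists a, x; split=> // y yax; apply/lu.
  by case: l {lu} lx la => [l|] lx la; case: u xu => [u|] xu; split=> //; ord.
- move=> A B [fA|[a [b [ab H]]]]; last by right; exists a, b; split=> // x /H; left.
  move=> [fB|[a [b [ab H]]]]; last by right; exists a, b; split=> // x /H; right.
  by left; rewrite -/(setU A B) finite_setU.
Qed.

End OMinimal.

(** * Consequences of definable and type completeness *)

Section Completeness.
Context (L : language) (d : Order.disp_t) (M : structure L d).
Hypothesis HM : dctc M.

Lemma germ_left s (S : M -> Prop) : def1 S -> forall b, exists e, olt s e b /\
  ((forall x, oitv s e b x -> S x) \/ (forall x, oitv s e b x -> ~ S x)).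
Proof.
move=> dS b; have [e [be He]] := dctc_germ HM (~~ s) dS b.
exists e; split; first by ord.
by case: He => He; [left|right] => x ?; apply: He; ord.
Qed.

(** Type completeness at the [s]-first end of the interval. It lets one of
    finitely many definable alternatives hold on a whole interval. *)
Lemma shrink s (S : M -> Prop) a b : def1 S -> olt s a b ->
  exists a' b', (ole s a a' /\ olt s a' b' /\ ole s b' b) /\
  ((forall x, oitv s a' b' x -> S x) \/ (forall x, oitv s a' b' x -> ~ S x)).
Proof.
move=> dS /olt_dense[c ab]; have [e [ce He]] := dctc_germ HM s dS c.
have [z [ze zb zE]] := omin s e b; exists c, z; split.
  by case: zE => zE; subst z; ord.
by case: He => He; [left|right] => x ?; apply: He; ord.
Qed.

(** Real induction. *)
Lemma dc_ind s (S : M -> Prop) x y : def1 S ->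
  (forall c, ole s x c -> olt s c y ->
     (forall w, olt s x w -> ole s w c -> S w) ->
     exists c', olt s c c' /\ forall w, oitv s c c' w -> S w) ->
  (forall c, olt s x c -> ole s c y -> (forall w, oitv s x c w -> S w) -> S c) ->
  forall w, olt s x w -> ole s w y -> S w.
Proof.
move=> dS step lim w0 xw0 w0y.
pose A t := (ole s x t /\ ole s t y) /\ forall w, olt s x w -> ole s w t -> S w.
have dA : def1 A by rewrite /A; dfn.
have [| |l [l1 l2]] := dctc_lub HM s dA.
- by exists x; split=> [|w ? ?]; [ord|exfalso; ord].
- by exists y => t [[]].
have ly : ole s l y by apply: l2 => t [[]].
have xl : ole s x l by apply: l1; split=> [|w ? ?]; [ord|exfalso; ord].
have Sl w : oitv s x l w -> S w.
  move=> xwl; have [H|] := pselect (forall t, A t -> ole s t w); first by have := l2 _ H; ord.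
  move=> /existsNP[t /not_implyP[[_ At] wt]]; apply: At; ord.
have Al : A l.
  split=> [|w xw wl]; first by split.
  have [wl'|E|] := olt_cases s w l; [by apply: Sl; ord| |by ord].
  by rewrite E; apply: lim => //; ord.
have [ly'|E|] := olt_cases s l y; [|by apply: Al.2; ord|by ord].
have [c' [lc' Hc']] := step l xl ly' Al.2.
have [z [zc zy zE]] := omin s c' y.
have [t lt] : exists t, oitv s l z t by apply: olt_dense; case: zE => ->.
have /l1 : A t; last by ord.
split=> [|w xw wt]; first by ord.
have [wl|E|wl] := olt_cases s w l; first by apply: Al.2; ord.
  by apply: Al.2; ord.
by apply: Hc'; ord.
Qed.

Lemma interval_connected s (S : M -> Prop) x y : def1 S -> ole s x y ->
  (forall z, ole s x z -> ole s z y -> exists p q, oitv s p q z /\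
      forall w, oitv s p q w -> (S w <-> S z)) ->
  S x -> S y.
Proof.
move=> dS xy loc Sx; have [xy'|<-//|] := olt_cases s x y; last by ord.
apply: (dc_ind (s := s) (x := x) (y := y) dS) => //; last by ord.
- move=> c xc cy Sc; have [p [q [pq H]]] := loc c xc (oltW cy).
  exists q; split=> [|w ?]; first by ord.
  apply/H; first by ord.
  by have [xc'|<-//|] := olt_cases s x c; [apply: Sc; ord|ord].
- move=> c xc cy Sc; have [p [q [pq H]]] := loc c (oltW xc) cy.
  have [z [zp zx zE]] := omax s p x.
  have [w zw] : exists w, oitv s z c w by apply: olt_dense; case: zE => ->; ord.
  by apply/(H w); [ord|apply: Sc; ord].
Qed.

(** If the infimum were not attained, it would be a limit of points of [S], and
    by type completeness [S] would contain an interval. *)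
Lemma least_exists s (S : M -> Prop) : def1 S -> (exists x, S x) ->
  (exists b, forall x, S x -> ole s b x) ->
  (forall a b, olt s a b -> exists x, oitv s a b x /\ ~ S x) ->
  exists m, S m /\ forall x, S x -> ole s m x.
Proof.
move=> dS neS [b Sb] noint.
have [//| |l [l1 l2]] := dctc_lub HM (~~ s) dS; first by exists b => x /Sb ?; ord.
exists l; split; last by move=> x /l1; ord.
have [c [lc]] := dctc_germ HM s dS l => -[Sc|Sc].
  by have [x [xlc]] := noint _ _ lc; case; apply: Sc.
apply: contrapT => nSl.
suff : ole (~~ s) l c by ord.
apply: l2 => x Sx; rewrite ole_neg => xc; have := l1 x Sx; rewrite ole_neg => lx.
by have [xl|E|xl] := olt_cases s x l; [ord|subst x|apply: (Sc x) => //; ord].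
Qed.

(** Functions are extended by the identity outside [K], to keep them total. *)
Lemma graph_fun (K : M -> Prop) (R : M -> M -> Prop) : def1 K -> def2 R ->
  (forall x, K x -> exists y, R x y /\ forall y', R x y' -> y' = y) ->
  exists h, defF h /\ forall x, K x -> R x (h x).
Proof.
move=> dK dR HR.
have /choice[h hP] : forall x, exists y, (K x /\ R x y) \/ (~ K x /\ y = x).
  move=> x.
  have [Kx|nKx] := pselect (K x); last by exists x; right.
  by have [y [Rxy _]] := HR x Kx; exists y; left.
exists h; split; last by move=> x Kx; case: (hP x) => -[].
have : def2 (fun x y => (K x /\ R x y) \/ (~ K x /\ y = x)) by dfn.
apply: defP_ext => e; move: (e true) (e false) => x y.
split=> [|->]; last exact: hP.
case=> -[Kx H]; case: (hP x) => -[Kx' H'] //.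
- have [z [Rxz U]] := HR x Kx; by rewrite (U _ H) (U _ H').
- by rewrite H H'.
Qed.

End Completeness.

(** * Monotonicity in o-minimal structures *)

Section Monotonicity.
Context (L : language) (d : Order.disp_t) (N : structure L d).
Hypothesis oN : o_minimal N.
Let HN := o_minimal_dctc oN.
Context (h : N -> N).
Hypothesis dh : defF h.

Definition side s t x : Prop :=
  exists x1, olt s x x1 /\ forall z, oitv s x x1 z -> olt t (h x) (h z).

Lemma def1_side s t : def1 (side s t). Proof. by rewrite /side; dfn. Qed.

Definition inj_on s a b : Prop :=
  forall x y, oitv s a b x -> oitv s a b y -> h x = h y -> x = y.

Lemma inj_cases s a b t x y : inj_on s a b -> oitv s a b x -> oitv s a b y ->
  x <> y -> olt t (h x) (h y) \/ olt t (h y) (h x).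
Proof.
move=> inj xab yab xy.
by have [|/(inj _ _ xab yab)|] := olt_cases t (h x) (h y); [left| |right].
Qed.

Lemma side_cases a b s x : inj_on true a b -> oitv true a b x ->
  side s true x \/ side s false x.
Proof.
move=> inj xab.
have [b' [bb' Hb']] : exists b', olt s x b' /\ forall z, oitv s x b' z -> oitv true a b z.
  by case: s; [exists b|exists a]; split=> [|z ?]; ord.
have dS : def1 (fun z => olt true (h x) (h z)) by dfn.
have [c [xc Hc]] := dctc_germ HN s dS x.
have [e [ec eb eE]] := omin s c b'.
have xe : olt s x e by case: eE => ->.
case: Hc => Hc; [left|right]; exists e; split=> // z ?; first by apply: Hc; ord.
have [| |zx|//] := inj_cases true inj xab (y := z).
- by apply: Hb'; ord.
- by ord.
- by case: (Hc z) => //; ord.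
Qed.

Lemma side_mono a b t :
  (forall x, oitv true a b x -> side true t x /\ side false (~~ t) x) ->
  forall x y, oitv true a b x -> oitv true a b y -> olt true x y ->
    olt t (h x) (h y).
Proof.
move=> H x y xab yab xy.
have dS : def1 (fun w => olt t (h x) (h w)) by dfn.
apply: (dc_ind HN (s := true) (x := x) (y := y) dS) => //; last by ord.
- move=> c xc cy Sc; have [|[c' [cc' Hc']] _] := H c; first by ord.
  exists c'; split=> // w /Hc' cw.
  have [E|xc'] := pselect (x = c); first by rewrite E.
  have [xc2|//|?] := olt_cases true x c; last by ord.
  by have := Sc c xc2 (@ole_refl _ _ _ c); ord.
- move=> c xc cy Sc; have [|_ [c' [cc' Hc']]] := H c; first by ord.
  have [z [zc zx zE]] := omax true c' x.
  have [w zw] : exists w, oitv true z c w by apply: olt_dense; case: zE => ->; ord.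
  have : olt (~~ t) (h c) (h w) by apply: Hc'; ord.
  by have : olt t (h x) (h w) by [apply: Sc; ord]; ord.
Qed.

Definition drop s t x : Prop := exists v,
  (exists x1, olt s x x1 /\ forall z, oitv s x x1 z -> olt t (h z) v) /\
  (exists x0, olt s x0 x /\ forall z, oitv s x0 x z -> olt t v (h z)).

(** A function cannot have a strict local minimum everywhere. No point of a
    final segment is below all that follow it, since the points just before such
    a point would be larger as well as smaller; so, for each [c] in the segment,
    the values end up below [h c]. At the first point from which on they do, the
    values are above [h c] just before it and below just after it. Such drops
    are cofinal, hence fill a final segment. The same holds in the opposite
    direction, and a point cannot be a drop in both. *)
Lemma drop_near s t a b : olt s a b -> inj_on s a b ->
  (forall x s', oitv s a b x -> side s' t x) ->
  exists a', oitv s a b a' /\ forall x, oitv s a' b x -> drop s t x.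
Proof.
move=> ab inj ext.
pose B x := oitv s a b x /\ forall y, oitv s x b y -> olt t (h x) (h y).
have dB : def1 B by rewrite /B; dfn.
have [e [eb nB]] : exists e, oitv s a b e /\ forall x, oitv s e b x -> ~ B x.
  have [c cab] := olt_dense ab.
  have [e0 [e0b He0]] := germ_left HN s dB b.
  have [e [ee0 ec eE]] := omax s e0 c; have eb : olt s e b by case: eE => ->; ord.
  exists e; split; first by ord.
  case: He0 => He0 x xe; last by apply: He0; ord.
  have [|x1 [x1x Hx1]] := ext x (~~ s); first by ord.
  have [z0 [z0e z0x z0E]] := omax s e x1.
  have [z z0z] : exists z, oitv s z0 x z by apply: olt_dense; case: z0E => ->; ord.
  have : olt t (h x) (h z) by apply: Hx1; ord.
  have [|_ /(_ x)] := He0 z; first by ord.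
  by move=> /(_ ltac:(ord)) ? ?; ord.
have below c : oitv s e b c -> exists e1, (ole s c e1 /\ olt s e1 b) /\
    forall z, oitv s e1 b z -> olt t (h z) (h c).
  move=> ceb; have dS : def1 (fun z => olt t (h z) (h c)) by dfn.
  have [e2 [e2b He2]] := germ_left HN s dS b.
  have [e3 [e32 e3c e3E]] := omax s e2 c.
  have e3b : olt s e3 b by case: e3E => ->; ord.
  case: He2 => He2.
    by exists e3; split=> [|z ?]; [ord|apply: He2; ord].
  exfalso.
  pose A e1 := (ole s c e1 /\ olt s e1 b) /\
    forall z, oitv s e1 b z -> olt t (h c) (h z).
  have dA : def1 A by rewrite /A; dfn.
  have Ae3 : A e3.
    split=> [|z ?]; first by ord.
    have [| | |//|H] := inj_cases t inj (x := c) (y := z); try by ord.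
    by case: (He2 z) => //; ord.
  have [||e0 [e01 e02]] := dctc_lub HN (~~ s) dA.
  - by exists e3.
  - by exists c => z [[]]; rewrite ole_neg.
  have ce0 : ole (~~ s) e0 c by apply: e02 => z [[]]; rewrite ole_neg.
  have e0e3 := e01 _ Ae3.
  have He0 z : oitv s e0 b z -> olt t (h c) (h z).
    move=> ze0; have [H|] := pselect (forall e1, A e1 -> ole (~~ s) e1 z).
      by have := e02 _ H; ord.
    by move=> /existsNP[e1 /not_implyP[[_ Ae1] e1z]]; apply: Ae1; ord.
  have ce0' : olt s c e0.
    have [//|E|] := olt_cases s c e0; last by ord.
    by case: (nB c ceb); split=> [|y ?]; [ord|apply: He0; ord].
  have [| | |cE|e0c] := inj_cases t inj (x := c) (y := e0); try by ord.
  - have [|x1 [x1e Hx1]] := ext e0 (~~ s); first by ord.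
    have [m [mx mc mE]] := omax s x1 c.
    have me0 : olt s m e0 by case: mE => ->; ord.
    have /e01 : A m; last by ord.
    split=> [|z mz]; first by ord.
    have [ze|->//|ze] := olt_cases s z e0; last by apply: He0; ord.
    by have : olt t (h e0) (h z) by [apply: Hx1; ord]; ord.
  - case: (nB e0); first by ord.
    by split=> [|y ?]; [ord|have := He0 y ltac:(ord); ord].
have cofinal c : oitv s e b c -> exists x, oitv s c b x /\ drop s t x.
  move=> ceb; have [e1 He1] := below c ceb.
  pose A e1 := (ole s c e1 /\ olt s e1 b) /\
    forall z, oitv s e1 b z -> olt t (h z) (h c).
  have dA : def1 A by rewrite /A; dfn.
  have [||x [x1 x2]] := dctc_lub HN (~~ s) dA.
  - by exists e1.
  - by exists c => z [[]]; rewrite ole_neg.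
  have cx : ole (~~ s) x c by apply: x2 => z [[]]; rewrite ole_neg.
  have xe1 := x1 _ He1; have [[_ e1b] _] := He1.
  have Hx z : oitv s x b z -> olt t (h z) (h c).
    move=> zx; have [H|] := pselect (forall e1, A e1 -> ole (~~ s) e1 z).
      by have := x2 _ H; ord.
    by move=> /existsNP[e2 /not_implyP[[_ Ae2] e2z]]; apply: Ae2; ord.
  have cx' : olt s c x.
    have [//|E|] := olt_cases s c x; last by ord.
    have [|c1 [cc1 Hc1]] := ext c s; first by ord.
    have [m [mc mb mE]] := omin s c1 b.
    have [z cz] : exists z, oitv s c m z by apply: olt_dense; case: mE => ->; ord.
    have : olt t (h c) (h z) by apply: Hc1; ord.
    by have : olt t (h z) (h c) by [apply: Hx; ord]; ord.
  exists x; split; first by ord.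
  have dS : def1 (fun z => olt t (h c) (h z)) by dfn.
  have [e3 [e3x He3]] := germ_left HN s dS x.
  exists (h c); split; first by exists b; split=> [|z ?]; [ord|exact: Hx].
  exists e3; split=> //.
  case: He3 => He3 //; exfalso.
  have [m [me mc mE]] := omax s e3 c.
  have mx : olt s m x by case: mE => ->; ord.
  have Hm z : oitv s m x z -> olt t (h z) (h c).
    move=> zm; have [| | |//|H] := inj_cases t inj (x := z) (y := c); try by ord.
    by case: (He3 z) => //; ord.
  have [| | |xc|cx2] := inj_cases t inj (x := x) (y := c); try by ord.
  - have /x1 : A m; last by ord.
    split=> [|z mz]; first by ord.
    by have [?|->//|?] := olt_cases s z x; [apply: Hm; ord|apply: Hx; ord].
  - have [|y [xy Hy]] := ext x s; first by ord.
    have [n [ny nb nE]] := omin s y b.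
    have [z xz] : exists z, oitv s x n z by apply: olt_dense; case: nE => ->; ord.
    have : olt t (h x) (h z) by apply: Hy; ord.
    by have : olt t (h z) (h c) by [apply: Hx; ord]; ord.
have dD : def1 (drop s t) by rewrite /drop; dfn.
have [e4 [e4b He4]] := germ_left HN s dD b.
have [m [me me4 mE]] := omax s e e4.
have mb : olt s m b by case: mE => ->; ord.
case: He4 => He4.
  by exists m; split=> [|x ?]; [ord|apply: He4; ord].
have [c mc] := olt_dense mb.
have [|x [xc Dx]] := cofinal c; first by ord.
by case: (He4 x) => //; ord.
Qed.

End Monotonicity.

(** * Generic continuity *)

Section GenericContinuity.
Context (L : language) (d : Order.disp_t) (N : structure L d).
Hypothesis oN : o_minimal N.
Let HN := o_minimal_dctc oN.
Context (h : N -> N).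
Hypothesis dh : defF h.

Lemma o_minimal_finite_or t S : def1 (M := N) S -> finite_set S \/
  exists a b, olt t a b /\ forall x, oitv t a b x -> S x.
Proof.
move=> /(o_minimal_finite oN)[|[a [b [ab H]]]]; [by left|right].
case: t; [by exists a, b|exists b, a; split; first by ord].
by move=> x ?; apply: H; ord.
Qed.

Definition image_on s a b y : Prop := exists x, oitv s a b x /\ h x = y.

Lemma image_infinite s a b : olt s a b ->
  (forall y, finite_set [set x | oitv s a b x /\ h x = y]) ->
  ~ finite_set (image_on s a b).
Proof.
move=> ab fib fin; apply: (itv_infinite ab).
apply: (sub_finite_set _ (bigcup_finite fin (fun y _ => fib y))) => x xab.
by exists (h x); first exists x.
Qed.

Lemma def1_image s a b : def1 (image_on s a b).
Proof. by rewrite /image_on; dfn. Qed.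

Definition cont_on s a b : Prop := forall x, oitv s a b x -> cont_at h x.

(** The image is infinite, so it contains an interval, and the function cannot
    jump where its values run through that interval. *)
Lemma mono_cont t a b : olt true a b ->
  (forall x y, oitv true a b x -> oitv true a b y -> olt true x y ->
     olt t (h x) (h y)) ->
  exists a' b', (ole true a a' /\ olt true a' b' /\ ole true b' b) /\
    cont_on true a' b'.
Proof.
move=> ab mono.
have monoV x y : oitv true a b x -> oitv true a b y -> olt t (h x) (h y) ->
    olt true x y.
  move=> xab yab xy; have [//|E|yx] := olt_cases true x y; first by subst y; ord.
  by have := mono _ _ yab xab yx; ord.
have [fin|[u [v [uv Huv]]]] := o_minimal_finite_or t (def1_image true a b).
  case: (image_infinite ab _ fin) => y.
  have [[x0 [x0ab E0]]|no] := pselect (exists x, oitv true a b x /\ h x = y).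
    apply: (sub_finite_set _ (finite_set1 x0)) => x [xab E]; subst y.
    have [H|//|H] := olt_cases true x x0; last by have := mono _ _ x0ab xab H; ord.
    by have := mono _ _ xab x0ab H; ord.
  by apply: (sub_finite_set _ (finite_set0 _)) => x H; apply: no; exists x.
have [y1 y1uv] := olt_dense uv.
have [|y2 y12] := @olt_dense _ _ _ t y1 v; first by ord.
have [|x1 [x1ab E1]] := Huv y1; first by ord.
have [|x2 [x2ab E2]] := Huv y2; first by ord.
subst y1 y2.
have x12 : olt true x1 x2 by apply: monoV => //; ord.
exists x1, x2; split; first by ord.
move=> x xab u0 v0 H0.
have [u1 [v1 [H1 H2]]] : exists u1 v1, oitv t u1 v1 (h x) /\
    forall y, oitv t u1 v1 y -> oitv true u0 v0 y.
  by case: (t); [exists u0, v0|exists v0, u0]; split=> [|y ?]; ord.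
have hx : oitv t (h x1) (h x2) (h x) by split; apply: mono; ord.
have [m [mu m1 mE]] := omax t u1 (h x1).
have [n [nv n2 nE]] := omin t v1 (h x2).
have [|w1 Hw1] := @olt_dense _ _ _ t m (h x); first by case: mE => ->; ord.
have [|w2 Hw2] := @olt_dense _ _ _ t (h x) n; first by case: nE => ->; ord.
have [|p [pab Ep]] := Huv w1; first by ord.
have [|q [qab Eq]] := Huv w2; first by ord.
subst w1 w2.
have px : olt true p x by apply: monoV => //; ord.
have xq : olt true x q by apply: monoV => //; ord.
exists p, q; split=> [|z zpq]; first by ord.
have pz : olt t (h p) (h z) by apply: mono; ord.
have zq : olt t (h z) (h q) by apply: mono; ord.
by apply: H2; ord.
Qed.

(** If the fibres are finite, the points that are least in their fibre form an
    infinite definable set, on which [h] is injective. *)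
Lemma const_or_inj a b : olt true a b -> exists a' b',
  (ole true a a' /\ olt true a' b' /\ ole true b' b) /\
  ((forall x y, oitv true a' b' x -> oitv true a' b' y -> h x = h y) \/
   inj_on h true a' b').
Proof.
move=> ab; pose S y x := oitv true a b x /\ h x = y.
have dS y : def1 (S y) by rewrite /S; dfn.
have sub (a0 b0 : N) : olt true a0 b0 ->
    (forall x, oitv true a0 b0 x -> oitv true a b x) ->
    exists a' b', (ole true a a' /\ olt true a' b' /\ ole true b' b) /\
      forall x, oitv true a' b' x -> oitv true a0 b0 x.
  move=> ab0 H; have [a' Ha'] := olt_dense ab0.
  have [|b' Hb'] := @olt_dense _ _ _ true a' b0; first by ord.
  have := H a'; have := H b'; exists a', b'; split=> [|x ?]; last by ord.
  by have := H a' ltac:(ord); have := H b' ltac:(ord); ord.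
have [[y nfin]|fin] := pselect (exists y, ~ finite_set (S y)).
  have [//|[a0 [b0 [ab0 H0]]]] := o_minimal_finite_or true (dS y).
  have [|a' [b' [H1 H2]]] := sub a0 b0 ab0; first by move=> x /H0[].
  exists a', b'; split=> //; left=> x z /H2/H0[_ ->] /H2/H0[_ ->].
  by [].
have finS y : finite_set (S y) by apply: contrapT => n; apply: fin; exists y.
have [fi|[u [v [uv Huv]]]] := o_minimal_finite_or true (def1_image true a b).
  by case: (image_infinite ab finS fi).
pose T x := oitv true u v (h x) /\ oitv true a b x /\
  forall x', oitv true a b x' -> h x' = h x -> ole true x x'.
have dT : def1 T by rewrite /T; dfn.
have [fT|[a0 [b0 [ab0 H0]]]] := o_minimal_finite_or true dT.
  case: (itv_infinite uv); apply: (sub_finite_set _ (finite_image h fT)) => y yuv.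
  have [|||m [Sm Hm]] := least_exists HN (s := true) (dS y).
  - by have [x [xab E]] := Huv y yuv; exists x.
  - by exists a => x [] ?; ord.
  - move=> p q pq; apply: contrapT => n.
    apply: (itv_infinite pq); apply: sub_finite_set (finS y) => x xpq.
    by apply: contrapT => nS; apply: n; exists x.
  have [mab Em] := Sm; exists m => //; split; first by rewrite Em.
  by split=> // x' x'ab Ex'; apply: Hm; split=> //; rewrite Ex'.
have [|a' [b' [H1 H2]]] := sub a0 b0 ab0; first by move=> x /H0[_ []].
exists a', b'; split=> //; right=> x y /H2/H0[_ [xab Hx]] /H2/H0[_ [yab Hy]] E.
by have := Hx y yab (esym E); have := Hy x xab E; ord.
Qed.

(** Where [h] is injective and the comparison of [h x] with the values just
    before and just after [x] does not depend on [x], either [h] is monotone or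
    each point is a strict local extremum. *)
Lemma cont_near a b : olt true a b ->
  exists a' b', (ole true a a' /\ olt true a' b' /\ ole true b' b) /\
    cont_on true a' b'.
Proof.
move=> ab; have [a1 [b1 [ab1 [cst|inj]]]] := const_or_inj ab.
  exists a1, b1; split=> // x xab u v hx; exists a1, b1; split=> // z zab.
  by rewrite (cst z x).
have [|a2 [b2 [ab2 rt]]] := shrink HN (s := true) (def1_side dh true true) (a := a1) (b := b1).
  by ord.
have [|a3 [b3 [ab3 lt]]] := shrink HN (s := true) (def1_side dh false true) (a := a2) (b := b2).
  by ord.
have inj3 : inj_on h true a3 b3 by move=> x y ? ?; apply: inj; ord.
have [tr Htr] : exists tr, forall x, oitv true a3 b3 x -> side h true tr x.
  case: rt => rt; first by exists true => x ?; apply: rt; ord.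
  exists false => x ?; have [|H|//] := side_cases oN dh true inj3 (x := x); first by ord.
  by case: (rt x) => //; ord.
have [tl Htl] : exists tl, forall x, oitv true a3 b3 x -> side h false tl x.
  case: lt => lt; first by exists true => x ?; apply: lt; ord.
  exists false => x ?; have [|H|//] := side_cases oN dh false inj3 (x := x); first by ord.
  by case: (lt x) => //; ord.
have [E|ntl] := eqVneq tl tr; last first.
  have E : tl = ~~ tr by move: ntl; case: (tl); case: (tr).
  have [||a' [b' [H1 H2]]] := mono_cont (t := tr) (a := a3) (b := b3); first by ord.
    by apply: (side_mono oN dh) => x ?; split; [exact: Htr|rewrite -E; exact: Htl].
  by exists a', b'; split=> //; ord.
subst tl; exfalso.
have ext x s' : oitv true a3 b3 x -> side h s' tr x.
  by case: s'; [exact: Htr|exact: Htl].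
have [|a4 [a4b D4]] := drop_near oN dh (s := true) (t := tr) (a := a3) (b := b3) _ inj3 ext.
  by ord.
have [| | |b5 [b5a D5]] := drop_near oN dh (s := false) (t := tr) (a := b3) (b := a4).
- by ord.
- by move=> x y ? ?; apply: inj3; ord.
- by move=> x s' ?; apply: ext; ord.
have [x xab] : exists x, oitv true a4 b5 x by apply: olt_dense; ord.
have [|v [[x1 [xx1 R1]] [x0 [x0x L1]]]] := D4 x; first by ord.
have [|v' [[y1 [xy1 R2]] [y0 [y0x L2]]]] := D5 x; first by ord.
have [m [m1 m2 mE]] := omin true x1 y0.
have [n [n1 n2 nE]] := omax true x0 y1.
have [z xz] : exists z, oitv true x m z by apply: olt_dense; case: mE => ->; ord.
have [w xw] : exists w, oitv true n x w by apply: olt_dense; case: nE => ->; ord.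
have : olt tr (h z) v by apply: R1; ord.
have : olt tr v (h w) by apply: L1; ord.
have : olt tr (h w) v' by apply: R2; ord.
have : olt tr v' (h z) by apply: L2; ord.
by ord.
Qed.

End GenericContinuity.

Lemma o_minimal_gen_cont L d (N : structure L d) : o_minimal N ->
  forall R, def2 (M := N) R -> gen_cont R.
Proof.
move=> oN R dR HR a b ab.
have [|h [dh hR]] := graph_fun (M := N) (K := fun=> True) (R := R) _ dR (fun x _ => HR x).
  exact: defP_true.
have RE x y : R x y -> y = h x.
  by move=> Rxy; have [z [_ U]] := HR x; rewrite (U _ Rxy) (U _ (hR x I)).
have [a' [b' [H1 H2]]] := cont_near oN dh ab.
exists a', b'; split=> // x y xab /RE -> u v /(H2 x xab)[p [q [xpq Hpq]]].
by exists p, q; split=> // z w /Hpq H /RE ->.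
Qed.

(** * The schemes hold in o-minimalistic structures *)

Lemma D2_olt L I (dd : I -> Order.disp_t) (st : forall i, structure L (dd i)) W
    (cst : forall i, W -> st i) s : D2 cst (fun i => @olt _ (st i) s).
Proof.
have lt := D2_lt cst.
by case: s; [exact: lt|exact: (D2_app lt (DTerm_var cst false) (DTerm_var cst true))].
Qed.

Ltac dfn_uniform :=
  cbv beta delta [oitv ole];
  lazymatch goal with
  | |- Def _ (fun i e => @?P i e /\ @?Q i e) =>
      apply: (@Def_and _ _ _ _ _ _ _ P Q); dfn_uniform
  | |- Def _ (fun i e => @?P i e \/ @?Q i e) =>
      apply: (@Def_or _ _ _ _ _ _ _ P Q); dfn_uniform
  | |- Def _ (fun i e => ~ @?P i e) =>
      apply: (@Def_not _ _ _ _ _ _ _ P); dfn_uniform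
  | |- Def _ (fun i e => exists a, @?P i e a) =>
      apply: (@Def_ex _ _ _ _ _ _ _ P); dfn_uniform
  | |- Def _ (fun i e => olt ?s (@?t i e) (@?u i e)) =>
      apply: (@D2_app _ _ _ _ _ _ _ _ t u (D2_olt _ s)); exact: DTerm_var
  | |- Def _ (fun i e => @?t i e = @?u i e) =>
      apply: (@D2_app _ _ _ _ _ _ _ _ t u (D2_eq _)); exact: DTerm_var
  | H : D1 _ ?S |- Def _ (fun i e => ?S i (@?t i e)) =>
      apply: (@D1_app _ _ _ _ _ _ _ _ t H); exact: DTerm_var
  | H : D2 _ ?R |- Def _ (fun i e => ?R i (@?t i e) (@?u i e)) =>
      apply: (@D2_app _ _ _ _ _ _ _ _ t u H); exact: DTerm_var
  | |- Def _ (fun i e => @?P i e -> @?Q i e) =>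
      apply: (@Def_imp _ _ _ _ _ _ _ P Q); dfn_uniform
  | |- Def _ (fun i e => forall a, @?P i e a) =>
      apply: (@Def_all _ _ _ _ _ _ _ P); dfn_uniform
  end.

Section TransferSchemas.
Context (L : language).

Lemma transfer1 (Q : forall d (N : structure L d), (N -> Prop) -> Prop) :
  (forall I (dd : I -> Order.disp_t) (st : forall i, structure L (dd i)) W
     (cst : forall i, W -> st i) (S : forall i, st i -> Prop),
     D1 cst S -> Def cst (fun i (_ : void -> st i) => Q _ _ (S i))) ->
  (forall d (N : structure L d), o_minimal N -> forall S, def1 S -> Q _ N S) ->
  forall d (M : structure L d), o_minimalistic M ->
  forall S, def1 S -> Q _ M S.
Proof.
move=> QD QO d M hM S dS.
apply: (@transfer L unit (fun d N P => Q d N (fun x => P (fun=> x))) _ _ d M hM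
  (fun e => S (e tt))) => //.
- move=> I dd st W cst P dP; apply: QD; apply: Def_ext dP => i e.
  by rewrite (_ : (fun=> e tt) = e) //; apply: funext => -[].
- move=> d' N oN P dP; apply: QO => //; apply: defP_ext dP => e.
  by rewrite (_ : (fun=> e tt) = e) //; apply: funext => -[].
Qed.

Lemma transfer2 (Q : forall d (N : structure L d), (N -> N -> Prop) -> Prop) :
  (forall I (dd : I -> Order.disp_t) (st : forall i, structure L (dd i)) W
     (cst : forall i, W -> st i) (R : forall i, st i -> st i -> Prop),
     D2 cst R -> Def cst (fun i (_ : void -> st i) => Q _ _ (R i))) ->
  (forall d (N : structure L d), o_minimal N -> forall R, def2 R -> Q _ N R) ->
  forall d (M : structure L d), o_minimalistic M ->
  forall R, def2 R -> Q _ M R.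
Proof.
move=> QD QO d M hM R dR.
pose pr d (N : structure L d) (x y : N) b := if b then x else y.
apply: (@transfer L bool (fun d N P => Q d N (fun x y => P (pr d N x y))) _ _ d M
  hM (fun e => R (e true) (e false))) => //.
- move=> I dd st W cst P dP; apply: QD; apply: Def_ext dP => i e.
  by rewrite (_ : pr _ _ _ _ = e) //; apply: funext => -[].
- move=> d' N oN P dP; apply: QO => //; apply: defP_ext dP => e.
  by rewrite (_ : pr _ _ _ _ = e) //; apply: funext => -[].
Qed.

Lemma o_minimalistic_dctc d (M : structure L d) : o_minimalistic M -> dctc M.
Proof.
move=> hM; split=> s S.
- apply: (@transfer1 (fun d N => @has_lub d N s)) => //.
    by move=> *; rewrite /has_lub; dfn_uniform.
  by move=> d1 N /o_minimal_dctc HN S1 dS1; exact: (dctc_lub HN s dS1).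
- apply: (@transfer1 (fun d N => @const_germs d N s)) => //.
    by move=> *; rewrite /const_germs; dfn_uniform.
  by move=> d1 N /o_minimal_dctc HN S1 dS1; exact: (dctc_germ HN s dS1).
- apply: (@transfer1 (fun d N => @const_end d N s)) => //.
    by move=> *; rewrite /const_end; dfn_uniform.
  by move=> d1 N /o_minimal_dctc HN S1 dS1; exact: (dctc_end HN s dS1).
Qed.

Lemma o_minimalistic_gen_cont d (M : structure L d) : o_minimalistic M ->
  forall R, def2 (M := M) R -> gen_cont R.
Proof.
move=> hM R; apply: (@transfer2 (fun d N => @gen_cont d N)) => //.
  by move=> *; rewrite /gen_cont; dfn_uniform.
by move=> d' N; exact: o_minimal_gen_cont.
Qed.

End TransferSchemas.

(** * Boundaries of fibres and good points *)

Section Fibers.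
Context (L : language) (d : Order.disp_t) (M : structure L d).
Hypothesis HM : dctc M.
Context (X : M -> M -> Prop).
Hypothesis dX : def2 X.

(** The boundary in the order topology, defined with intervals so that it is
    visibly definable. *)
Definition bd x y : Prop := ~ exists u v, oitv true u v y /\
  ((forall t, oitv true u v t -> X x t) \/ (forall t, oitv true u v t -> ~ X x t)).

Lemma def2_bd : def2 bd. Proof. by rewrite /bd; dfn. Qed.
Let dY := def2_bd.

Lemma oitv_true s (a b : M) : exists a' b',
  forall x, oitv true a' b' x <-> oitv s a b x.
Proof. by case: s; [exists a, b|exists b, a] => x; split=> ?; ord. Qed.

Lemma not_bd s x u v y : oitv s u v y ->
  (forall t, oitv s u v t -> X x t) \/ (forall t, oitv s u v t -> ~ X x t) ->
  ~ bd x y.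
Proof.
move=> yuv H; apply; have [u' [v' E]] := oitv_true s u v.
exists u', v'; split; first exact/E.
by case: H => H; [left|right] => t /E; exact: H.
Qed.

Lemma bd_noint s x a b : olt s a b -> exists y, oitv s a b y /\ ~ bd x y.
Proof.
move=> ab; have dXx : def1 (X x) by dfn.
have [a' [b' [ab' H]]] := shrink HM dXx ab.
have [|y Hy] := @olt_dense _ _ _ s a' b'; first by ord.
by exists y; split; [ord|apply: (not_bd Hy H)].
Qed.

Lemma bd_const s x u v : (forall t, oitv s u v t -> ~ bd x t) ->
  forall t t', oitv s u v t -> oitv s u v t' -> (X x t <-> X x t').
Proof.
move=> nY; have dXx : def1 (X x) by dfn.
have H t t' : oitv s u v t -> oitv s u v t' -> X x t -> X x t'.
  move=> tuv tuv'.
  wlog tt' : s u v nY tuv tuv' / ole s t t'.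
    move=> W; have [|n] := pselect (ole s t t'); first exact: (W s u v).
    apply: (W (~~ s) v u); try by ord.
    by move=> z ?; apply: nY; ord.
  apply: (interval_connected HM (s := s) dXx) => // z tz zt'.
  have /contrapT[p [q [zpq Hpq]]] := nY z ltac:(ord).
  have [p' [q' E]] : exists p' q', forall w, oitv s p' q' w <-> oitv true p q w.
    by case: (s); [exists p, q|exists q, p] => w; split=> ?; ord.
  exists p', q'; split=> [|w /E wpq]; first exact/E.
  by case: Hpq => H; split=> // Xw; have := H _ zpq; have := H _ wpq.
by move=> t t' ? ?; split; apply: H.
Qed.

Lemma bd_isolated x y : exists u v, oitv true u v y /\
  forall t, oitv true u v t -> bd x t -> t = y.
Proof.
have dYx : def1 (bd x) by dfn.
have H s : exists v, olt s y v /\ forall t, oitv s y v t -> ~ bd x t.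
  have [v [yv [Hv|Hv]]] := dctc_germ HM s dYx y; last by exists v.
  by have [t [tyv nt]] := bd_noint x yv; case: nt; apply: Hv.
have [v [yv Hv]] := H true; have [u [yu Hu]] := H false.
exists u, v; split=> [|t tuv Yt]; first by ord.
have [ty|//|yt] := olt_cases true t y; first by case: (Hu t) => //; ord.
by case: (Hv t) => //; ord.
Qed.

Lemma bd_next s x y : (exists y', olt s y y' /\ bd x y') ->
  exists m, (bd x m /\ olt s y m) /\
    forall w, bd x w -> olt s y w -> ole s m w.
Proof.
move=> [y' yy'].
have dS : def1 (fun w => bd x w /\ olt s y w) by dfn.
have [|||m [Sm Hm]] := least_exists HM (s := s) dS.
- by exists y'; case: yy'.
- by exists y => w; ord.
- by move=> a b /(bd_noint x)[w [wab nY]]; exists w; split=> // -[].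
by exists m; split=> // w Yw yw; apply: Hm.
Qed.

(** A window: the part of the boundary in the strip is a graph over [(p, q)].
    Windows at all points over one interval are the substitute for a finite
    number of branches. *)
Definition win p q u v : Prop := forall x, oitv true p q x ->
  exists y, (oitv true u v y /\ bd x y) /\
    forall y', oitv true u v y' -> bd x y' -> y' = y.
Definition windowed p q y : Prop := exists u v, oitv true u v y /\ win p q u v.
Definition uniform p q : Prop :=
  forall x, oitv true p q x -> forall y, bd x y -> windowed p q y.

(* Normality describes [X] near a point, with boxes that may be taken
   arbitrarily small where it makes a difference. *)
Definition normal_off x y : Prop := exists p q u v,
  oitv true p q x /\ oitv true u v y /\
  ((forall x' t, oitv true p q x' -> oitv true u v t -> X x' t) \/
   (forall x' t, oitv true p q x' -> oitv true u v t -> ~ X x' t)).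
Definition normal_on x y : Prop := forall u0 v0, oitv true u0 v0 y ->
  exists p q u v, (oitv true p q x /\ oitv true u v y) /\
    (ole true u0 u /\ ole true v v0) /\ win p q u v /\
    forall x' t, oitv true p q x' -> oitv true u v t -> bd x' t ->
      (X x' t <-> X x y).
Definition normal x y : Prop :=
  (~ bd x y -> normal_off x y) /\ (bd x y -> normal_on x y).
Definition good x : Prop :=
  (forall y, normal x y) /\ exists p q, oitv true p q x /\ uniform p q.

Lemma def2_normal : def2 normal.
Proof. by rewrite /normal /normal_off /normal_on /win; dfn. Qed.

Lemma def1_good : def1 good.
Proof.
have := def2_normal; rewrite /good /uniform /windowed /win => dn; dfn.
Qed.

Lemma win_sub p q u v p' q' : win p q u v -> ole true p p' -> ole true q' q ->
  win p' q' u v.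
Proof. by move=> W ? ? x ?; apply: W; ord. Qed.

Lemma windowed_sub p q y p' q' : windowed p q y -> ole true p p' ->
  ole true q' q -> windowed p' q' y.
Proof.
by move=> [u [v [yuv W]]] ? ?; exists u, v; split=> //; apply: win_sub W _ _.
Qed.

Lemma uniform_sub p q p' q' : uniform p q -> ole true p p' -> ole true q' q ->
  uniform p' q'.
Proof.
move=> U ? ? x ? y Yxy; apply: (@windowed_sub p q) => //.
by apply: U Yxy; ord.
Qed.

Lemma itv_meet s (a b p q x : M) : oitv s a b x -> oitv s p q x -> exists a' b',
  oitv s a' b' x /\ (ole s a a' /\ ole s b' b) /\ (ole s p a' /\ ole s b' q).
Proof.
move=> xab xpq; have [a' [? ? aE]] := omax s a p; have [b' [? ? bE]] := omin s b q.
exists a', b'; split; last by ord.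
by case: aE => ->; case: bE => ->; ord.
Qed.

Lemma cont_at_oitv t (h : M -> M) x u v : cont_at h x -> oitv t u v (h x) ->
  exists p q, oitv true p q x /\ forall z, oitv true p q z -> oitv t u v (h z).
Proof.
move=> hx huv; have [u' [v' E]] := oitv_true t u v.
have [|p [q [xpq Hpq]]] := hx u' v'; first exact/E.
by exists p, q; split=> // z /Hpq /E.
Qed.

Hypothesis HC : forall R, def2 (M := M) R -> gen_cont R.

Lemma cont_sub (h : M -> M) a b : defF h -> olt true a b -> exists a' b',
  (ole true a a' /\ olt true a' b' /\ ole true b' b) /\
  forall x, oitv true a' b' x -> cont_at h x.
Proof.
move=> dh ab; have [|a' [b' [H1 H2]]] := @HC (fun x y => y = h x) dh _ a b ab.
  by move=> x; exists (h x).
exists a', b'; split=> // x xab u v huv.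
have [p [q [xpq Hpq]]] := H2 x (h x) xab erefl u v huv.
by exists p, q; split=> // z zpq; apply: (Hpq z).
Qed.

(** The least boundary point is a continuous function of [x] on a subinterval,
    which keeps it away from the end of the line. *)
Lemma end_bound t a b : olt true a b -> exists a' b' r,
  (ole true a a' /\ olt true a' b' /\ ole true b' b) /\
  (forall x y, oitv true a' b' x -> ole t y r -> ~ bd x y) /\
  ((forall x y, oitv true a' b' x -> ole t y r -> X x y) \/
   (forall x y, oitv true a' b' x -> ole t y r -> ~ X x y)).
Proof.
move=> ab.
pose R x z := (bd x z /\ forall w, olt t w z -> ~ bd x w) \/
              ((forall w, ~ bd x w) /\ z = x).
have dR : def2 R by rewrite /R; dfn.
have [||h [dh hR]] := graph_fun (M := M) (K := fun=> True) (R := R) _ dR.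
- exact: defP_true.
- move=> x _; have [[y Yy]|nY] := pselect (exists y, bd x y); last first.
    have nY' w : ~ bd x w by move=> ?; apply: nY; exists w.
    by exists x; split=> [|y' [[/nY']|[]]] //; right.
  have dYx : def1 (bd x) by dfn.
  have dXx : def1 (X x) by dfn.
  have [|||m [Ym Hm]] := least_exists HM (s := t) dYx.
  + by exists y.
  + have [c Hc] := dctc_end HM (~~ t) dXx; exists c => w Yw wc.
    have [e ew] := olt_below t w.
    case: (not_bd (s := t) (x := x) (u := e) (v := c) (y := w)) => //.
    by case: Hc => Hc; [left|right] => z ?; apply: Hc; ord.
  + exact: bd_noint.
  exists m; split; first by left; split=> // w wm Yw; have := Hm w Yw; ord.
  move=> z [[Yz Hz]|[/(_ m)//]].
  have [zm|//|mz] := olt_cases t z m; first by have := Hm z Yz; ord.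
  by case: (Hz m mz).
have [a1 [b1 [ab1 C1]]] := cont_sub dh ab.
have [|x0 x0ab] := @olt_dense _ _ _ true a1 b1; first by ord.
have [r1 r1h] := olt_below t (h x0); have [r2 r2h] := olt_above t (h x0).
have [//|p [q [xpq Hpq]]] := cont_at_oitv (t := t) (u := r1) (v := r2) (C1 x0 x0ab).
have [a2 [b2 [x0ab2 [ab2 pq2]]]] := itv_meet x0ab xpq.
have [r rr1] := olt_below t r1.
have nY x y : oitv true a2 b2 x -> ole t y r1 -> ~ bd x y.
  move=> xab yr; have : oitv t r1 r2 (h x) by apply: Hpq; ord.
  move=> [rh _]; case: (hR x I) => [[_ H]|[H _]]; last exact: H.
  by apply: H; ord.
have dS : def1 (fun x => X x r) by dfn.
have [|a3 [b3 [ab3 H3]]] := shrink HM (s := true) dS (a := a2) (b := b2); first by ord.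
have XE x y : oitv true a2 b2 x -> ole t y r -> (X x y <-> X x r).
  move=> xab yr; have [e ey] := olt_below t y.
  apply: (bd_const (s := t) (x := x) (u := e) (v := r1)); try by ord.
  by move=> w ?; apply: nY; ord.
exists a3, b3, r; split; first by ord.
split; first by move=> x y ? ?; apply: nY; ord.
by case: H3 => H3; [left|right] => x y ? yr; have := H3 x ltac:(ord);
  have := XE x y ltac:(ord) yr; tauto.
Qed.

(** The value [e] stands for a missing neighbour, so that the function is
    total; it is chosen beyond [h x]. *)
Lemma neighbor t (h : M -> M) e : defF h -> exists n, defF n /\ forall x,
  (olt t (h x) e -> olt t (h x) (n x)) /\
  forall w, oitv t (h x) (n x) w -> ~ bd x w.
Proof.
move=> dh.
pose R x z := ((bd x z /\ olt t (h x) z) /\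
                forall w, bd x w -> olt t (h x) w -> ole t z w) \/
              ((forall w, bd x w -> ~ olt t (h x) w) /\ z = e).
have dR : def2 R by rewrite /R; dfn.
have [||n [dn nR]] := graph_fun (M := M) (K := fun=> True) (R := R) _ dR.
- exact: defP_true.
- move=> x _; have [H|nY] := pselect (exists y', olt t (h x) y' /\ bd x y').
    have [m [Hm1 Hm2]] := bd_next H.
    exists m; split=> [|z [[[Yz hz] Hz]|[Hz _]]]; first by left.
      by have := Hz m Hm1.1 Hm1.2; have := Hm2 z Yz hz; ord.
    by case: (Hz m Hm1.1 Hm1.2).
  have nY' w : bd x w -> ~ olt t (h x) w by move=> ? ?; apply: nY; exists w.
  by exists e; split=> [|z [[[/nY' n ?]]|[]]] //; right.
exists n; split=> // x; case: (nR x I) => [[[Yn hn] Hn]|[Hn ->]]; split=> //.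
  by move=> w wn Yw; have := Hn w Yw; case: wn => hw wn /(_ hw); ord.
by move=> w [hw _] /Hn; apply.
Qed.

Lemma shrink_const (S : M -> Prop) a b : def1 S -> olt true a b ->
  exists a' b', (ole true a a' /\ olt true a' b' /\ ole true b' b) /\
  forall x x', oitv true a' b' x -> oitv true a' b' x' -> (S x <-> S x').
Proof.
move=> dS ab; have [a' [b' [H1 H2]]] := shrink HM dS ab; exists a', b'.
split=> // x x' xab xab'.
by case: H2 => H; have := H x xab; have := H x' xab'; tauto.
Qed.

(** The lowest failure of normality [h], and the boundary points [lo] and [hi]
    next to it, are continuous on a subinterval. Around the graph of [h], the
    band between [lo] and [hi] contains no boundary points except possibly those
    on [h], and membership in [X] depends only on the position with respect to
    [h]; so all points near [h] are normal. *)
Lemma abnormal_curve_absurd a b r s : olt true a b ->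
  (forall x y, oitv true a b x -> ~ normal x y -> ole true r y /\ ole true y s) ->
  (forall x, oitv true a b x -> exists y, ~ normal x y) -> False.
Proof.
move=> ab bnd ex; have dn := def2_normal.
pose R x z := (forall y, ~ normal x y -> ole true z y) /\
  forall w, (forall y, ~ normal x y -> ole true w y) -> ole true w z.
have dR : def2 R by rewrite /R; dfn.
have [||h [dh hR]] := graph_fun (M := M) (K := oitv true a b) (R := R) _ dR.
- by dfn.
- move=> x xab; have dS : def1 (fun y => ~ normal x y) by dfn.
  have [||z [z1 z2]] := dctc_lub HM false dS.
  + exact: ex.
  + by exists r => y /(bnd x y xab)[? _]; ord.
  exists z; split=> [|z' [z1' z2']].
    split=> [y /z1|w Hw]; first by ord.
    by have : ole false z w; [apply: z2 => y /Hw; ord|ord].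
  have : ole false z z' by apply: z2 => y /z1'; ord.
  have : ole true z z' by apply: z2' => y /z1; ord.
  by ord.
have [e0 e0r] := olt_below true r; have [e1 e1s] := olt_above true s.
have hrs x : oitv true a b x -> olt true e0 (h x) /\ olt true (h x) e1.
  move=> xab; have [H1 H2] := hR x xab.
  have : ole true r (h x) by apply: H2 => y /(bnd x y xab)[].
  by have [y /[dup]/H1 ? /(bnd x y xab)] := ex x xab; ord.
have [lo [dlo Hlo]] := neighbor false e0 dh.
have [hi [dhi Hhi]] := neighbor true e1 dh.
have [a1 [b1 [ab1 C1]]] := cont_sub dh ab.
have [|a2 [b2 [ab2 C2]]] := @cont_sub lo a1 b1 dlo; first by ord.
have [|a3 [b3 [ab3 C3]]] := @cont_sub hi a2 b2 dhi; first by ord.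
have dS1 : def1 (fun x => forall w, oitv true (lo x) (h x) w -> X x w) by dfn.
have dS2 : def1 (fun x => forall w, oitv true (h x) (hi x) w -> X x w) by dfn.
have dS3 : def1 (fun x => X x (h x)) by dfn.
have dS4 : def1 (fun x => bd x (h x)) by dfn.
have [|a4 [b4 [ab4 K1]]] := @shrink_const _ a3 b3 dS1; first by ord.
have [|a5 [b5 [ab5 K2]]] := @shrink_const _ a4 b4 dS2; first by ord.
have [|a6 [b6 [ab6 K3]]] := @shrink_const _ a5 b5 dS3; first by ord.
have [|a7 [b7 [ab7 K4]]] := @shrink_const _ a6 b6 dS4; first by ord.
have ab37 : ole true a3 a7 /\ ole true b7 b3 by ord.
have ab07 : ole true a a7 /\ ole true b7 b by ord.
have [|x0 x0ab] := @olt_dense _ _ _ true a7 b7; first by ord.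
have lohi x : oitv true a7 b7 x -> olt true (lo x) (h x) /\ olt true (h x) (hi x).
  move=> xab; have [] := hrs x; first by ord.
  by have [H1 _] := Hlo x; have [H2 _] := Hhi x; move=> /H1 ? /H2 ?; ord.
have nYlo x w : oitv true (lo x) (h x) w -> ~ bd x w.
  by move=> ?; apply: (Hlo x).2; ord.
have nYhi x w : oitv true (h x) (hi x) w -> ~ bd x w := (Hhi x).2 w.
have [l0 h0] := lohi x0 x0ab.
have [u uh] := olt_dense l0; have [v vh] := olt_dense h0.
have [m ml] := olt_below true (lo x0); have [n nh] := olt_above true (hi x0).
have [||p1 [q1 [xpq1 P1]]] := @cont_at_oitv true h x0 u v; [by apply: C1; ord|by ord|].
have [||p2 [q2 [xpq2 P2]]] := @cont_at_oitv true lo x0 m u; [by apply: C2; ord|by ord|].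
have [||p3 [q3 [xpq3 P3]]] := @cont_at_oitv true hi x0 v n; [by apply: C3; ord|by ord|].
have [p4 [q4 [xpq4 pq4]]] := itv_meet x0ab xpq1.
have [p5 [q5 [xpq5 pq5]]] := itv_meet xpq4 xpq2.
have [p [q [xpq pq]]] := itv_meet xpq5 xpq3.
have box x : oitv true p q x -> [/\ oitv true a7 b7 x, oitv true u v (h x),
    olt true (lo x) u & olt true v (hi x)].
  move=> ?; split; [by ord|by apply: P1; ord| |].
  - by have [] := P2 x ltac:(ord).
  - by have [] := P3 x ltac:(ord).
(* Points above, on and below the graph of [h]. *)
have nor y : oitv true u v y -> normal x0 y.
  move=> yuv; have [hy|E|yh] := olt_cases true (h x0) y.
  - split; last by move=> Y0; case: (nYhi x0 y) => //; ord.
    move=> _; have [w hw] := olt_dense hy.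
    have [||p' [q' [xpq' P']]] := @cont_at_oitv true h x0 u w; [by apply: C1; ord|by ord|].
    have [p6 [q6 [xpq6 pq6]]] := itv_meet xpq xpq'.
    have below x t : oitv true p6 q6 x -> oitv true w v t -> oitv true (h x) (hi x) t.
      by move=> ? ?; have [] := box x ltac:(ord); have := P' x ltac:(ord); ord.
    exists p6, q6, w, v; split; first by []; split; first by ord.
    have [H|H] := pselect (forall w, oitv true (h x0) (hi x0) w -> X x0 w); [left|right].
      move=> x t xpq7 twv; have [xab _ _ _] := box x ltac:(ord).
      by apply: ((K2 x x0 ltac:(ord) ltac:(ord)).2 H); apply: below.
    move=> x t xpq7 twv Xt; apply: H.
    have [xab _ _ _] := box x ltac:(ord).
    apply: (K2 x x0 ltac:(ord) ltac:(ord)).1 => t' t'h.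
    by apply/(bd_const (s := true) (nYhi x) t'h (below x t xpq7 twv)).
  - subst y; split=> Y0.
      exists p, q, u, v; split; first by []; split; first by [].
      have nY x t : oitv true p q x -> oitv true (lo x) (hi x) t -> ~ bd x t.
        move=> ? ?; have [xab _ _ _] := box x ltac:(ord).
        have [?|->|?] := olt_cases true t (h x); first by apply: nYlo; ord.
          by move=> Yx; apply: Y0; apply/(K4 x x0) => //; ord.
        by apply: nYhi; ord.
      have XE x t : oitv true p q x -> oitv true u v t -> (X x t <-> X x0 (h x0)).
        move=> ? ?; have [xab xh xl xh'] := box x ltac:(ord).
        have E1 : X x t <-> X x (h x).
          apply: (bd_const (s := true) (u := lo x) (v := hi x)); try by ord.
          by move=> z ?; apply: nY; ord.
        have E2 := K3 x x0 ltac:(ord) ltac:(ord); tauto.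
      have [H|H] := pselect (X x0 (h x0)); [left|right] => x t ? ?.
        by apply/XE.
      by move=> /XE; auto.
    move=> u0 v0 huv0.
    have [u1 [v1 [huv1 uv1]]] := itv_meet huv0 yuv.
    have [||p' [q' [xpq' P']]] := @cont_at_oitv true h x0 u1 v1; [by apply: C1; ord|by ord|].
    have [p6 [q6 [xpq6 pq6]]] := itv_meet xpq xpq'.
    have uniq x t : oitv true p6 q6 x -> oitv true u1 v1 t -> bd x t -> t = h x.
      move=> ? ? Yt; have [xab xh xl xh'] := box x ltac:(ord).
      have [?|//|?] := olt_cases true t (h x); first by case: (nYlo x t) => //; ord.
      by case: (nYhi x t) => //; ord.
    exists p6, q6, u1, v1; split; first by []; split; first by ord.
    split=> [x xpq7|x t xpq7 tuv Yt].
      exists (h x); split; last by move=> t ? ?; exact: uniq.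
      have [xab _ _ _] := box x ltac:(ord).
      split; first by apply: P'; ord.
      by apply/(K4 x x0 ltac:(ord) ltac:(ord)).
    have [xab _ _ _] := box x ltac:(ord).
    by rewrite (uniq x t) //; apply: K3; ord.
  - split; last by move=> Y0; case: (nYlo x0 y) => //; ord.
    move=> _; have [w hw] := olt_dense yh.
    have [||p' [q' [xpq' P']]] := @cont_at_oitv true h x0 w v; [by apply: C1; ord|by ord|].
    have [p6 [q6 [xpq6 pq6]]] := itv_meet xpq xpq'.
    have above x t : oitv true p6 q6 x -> oitv true u w t -> oitv true (lo x) (h x) t.
      by move=> ? ?; have [] := box x ltac:(ord); have := P' x ltac:(ord); ord.
    exists p6, q6, u, w; split; first by []; split; first by ord.
    have [H|H] := pselect (forall w, oitv true (lo x0) (h x0) w -> X x0 w); [left|right].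
      move=> x t xpq7 twv; have [xab _ _ _] := box x ltac:(ord).
      by apply: ((K1 x x0 ltac:(ord) ltac:(ord)).2 H); apply: above.
    move=> x t xpq7 twv Xt; apply: H.
    have [xab _ _ _] := box x ltac:(ord).
    apply: (K1 x x0 ltac:(ord) ltac:(ord)).1 => t' t'h.
    by apply/(bd_const (s := true) (nYlo x) t'h (above x t xpq7 twv)).
have [H1 H2] := hR x0 ltac:(ord).
have : ole true v (h x0); last by ord.
apply: H2 => y nny vy; apply: (nny); apply: nor.
by have := H1 y nny; ord.
Qed.

End Fibers.

(** * Density of the good points *)

Section GoodPoints.
Context (L : language) (d : Order.disp_t) (M : structure L d).
Hypothesis HM : dctc M.
Hypothesis HC : forall R, def2 (M := M) R -> gen_cont R.
Context (X : M -> M -> Prop).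
Hypothesis dX : def2 X.
Let dY := def2_bd dX.
Let dn := def2_normal dX.

Lemma normal_end t a b r x y : oitv true a b x -> olt t y r ->
  (forall x y, oitv true a b x -> ole t y r -> ~ bd X x y) ->
  (forall x y, oitv true a b x -> ole t y r -> X x y) \/
  (forall x y, oitv true a b x -> ole t y r -> ~ X x y) -> normal X x y.
Proof.
move=> xab yr nY H; split; last by move=> /(nY x y xab); case; ord.
move=> _; have [e ey] := olt_below t y.
have [u [v E]] := oitv_true t e r.
exists a, b, u, v; split=> //; split; first by apply/E; ord.
by case: H => H; [left|right] => x' w ? /E ?; apply: H => //; ord.
Qed.

Lemma normal_box x y : normal X x y -> exists p q u v,
  (oitv true p q x /\ oitv true u v y) /\
  ((forall x' t, oitv true p q x' -> oitv true u v t -> ~ bd X x' t) \/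
   win X p q u v).
Proof.
move=> [noff non]; have [Yy|nY] := pselect (bd X x y).
  have [u0 u0y] := olt_below true y; have [v0 v0y] := olt_above true y.
  have [|p [q [u [v [xy [_ [W _]]]]]]] := non Yy u0 v0; first by ord.
  by exists p, q, u, v; split=> //; right.
have [p [q [u [v [xpq [yuv H]]]]]] := noff nY.
exists p, q, u, v; split=> //; left=> x' t xpq' tuv.
apply: (not_bd tuv).
by case: H => H; [left|right] => z ?; apply: H.
Qed.

(** Windows are collected while climbing from a height below the boundary to one
    above it: at a normal height, one interval around [x] serves for a little
    more. *)
Lemma uniform_near a b r s x : oitv true a b x ->
  (forall x y, oitv true a b x -> bd X x y -> oitv true r s y) ->
  (forall y, normal X x y) -> exists p q, oitv true p q x /\ uniform X p q.
Proof.
move=> xab bnd nor.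
pose Wd t := exists p q, oitv true p q x /\ (ole true a p /\ ole true q b) /\
  forall z, oitv true p q z -> forall y, bd X z y -> ole true y t ->
    windowed X p q y.
have dW : def1 Wd by rewrite /Wd /windowed /win; dfn.
have [rs|sr] := pselect (ole true r s); last first.
  exists a, b; split=> // z zab y Yy.
  by have := bnd z y zab Yy; ord.
have [p [q [xpq [pq H]]]] : Wd s.
  apply: (interval_connected HM (s := true) dW rs) => [z rz zs|]; last first.
    exists a, b; split=> //; split=> [|z zab y Yy yr]; first by ord.
    by have := bnd z y zab Yy; ord.
  have [p' [q' [u' [v' [[xpq' zuv'] box]]]]] := normal_box (nor z).
  exists u', v'; split=> //.
  suff H w w' : oitv true u' v' w -> oitv true u' v' w' -> Wd w -> Wd w'.
    by move=> w ?; split; apply: H.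
  move=> wuv wuv' [p [q [xpq [pq Hpq]]]].
  have [p1 [q1 [xpq1 [pq1 pq1']]]] := itv_meet xpq xpq'.
  exists p1, q1; split=> //; split=> [|x1 xpq2 y Yy yw']; first by ord.
  have [yw|wy] := pselect (ole true y w).
    by apply: (@windowed_sub _ _ _ _ p q); [apply: (Hpq x1) => //; ord|ord|ord].
  case: box => [nY|W]; first by case: (nY x1 y) => //; ord.
  exists u', v'; split; first by ord.
  by apply: win_sub W _ _; ord.
exists p, q; split=> // z zpq y Yy; apply: (H z) => //.
by have := bnd z y ltac:(ord) Yy; ord.
Qed.

Lemma good_dense a b : olt true a b -> exists x, oitv true a b x /\ good X x.
Proof.
move=> ab; apply: contrapT => nogood.
have [a1 [b1 [r [ab1 [nYr Xr]]]]] := end_bound HM dX HC true ab.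
have [|a2 [b2 [s [ab2 [nYs Xs]]]]] := end_bound HM dX HC false (a := a1) (b := b1).
  by ord.
have norr x y : oitv true a2 b2 x -> olt true y r -> normal X x y.
  by move=> ? yr; apply: (@normal_end true a1 b1 r) => //; ord.
have nors x y : oitv true a2 b2 x -> olt true s y -> normal X x y.
  by move=> ? yr; apply: (@normal_end false a2 b2 s) => //; ord.
have dS : def1 (fun x => forall y, normal X x y) by dfn.
have [|a3 [b3 [ab3 [H|H]]]] := shrink HM dS (s := true) (a := a2) (b := b2).
- by ord.
- have [x xab] : exists x, oitv true a3 b3 x by apply: olt_dense; ord.
  apply: nogood; exists x; split; first by ord.
  split; first exact: H.
  apply: (@uniform_near a2 b2 r s); [by ord| |exact: H].
  move=> z y zab Yy; split.
    by apply: contrapT => n; apply: (nYr z y) Yy; ord.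
  by apply: contrapT => n; apply: (nYs z y) Yy; ord.
- apply: (@abnormal_curve_absurd _ _ _ HM X dX HC a3 b3 r s); first by ord.
    move=> x y xab nn; split=> n; apply: nn; [apply: norr|apply: nors]; ord.
  by move=> x xab; have /existsNP := H x xab.
Qed.

(** By type completeness, a definable set that contains no interval is closed
    and discrete. *)
Lemma bad_isolated x : exists p q, oitv true p q x /\
  forall z, oitv true p q z -> z <> x -> good X z.
Proof.
have dg : def1 (good X) := def1_good dX.
have H s : exists v, olt s x v /\ forall t, oitv s x v t -> good X t.
  have [v [xv [Hv|Hv]]] := dctc_germ HM s dg x; first by exists v.
  have [p [q E]] := oitv_true s x v.
  have [w xw] := olt_dense xv.
  have [|t [/E tpq gt]] := @good_dense p q; last by case: (Hv t).
  by have [] := (E w).2 xw => *; ord.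
have [v [xv Hv]] := H true; have [u [ux Hu]] := H false.
exists u, v; split=> [|z zuv zx]; first by ord.
by have [?|//|?] := olt_cases true z x; [apply: Hu; ord|apply: Hv; ord].
Qed.

End GoodPoints.

(** * Definable branches of the boundary *)

Section Selections.
Context (L : language) (d : Order.disp_t) (M : structure L d).
Hypothesis HM : dctc M.
Context (X : M -> M -> Prop).
Hypothesis dX : def2 X.
Local Notation Y := (bd X).

Definition nbh (x : M) (P : M -> Prop) : Prop :=
  exists p q, oitv true p q x /\ forall z, oitv true p q z -> P z.

Lemma nbh_oitv s x P : nbh x P <->
  exists p q, oitv s p q x /\ forall z, oitv s p q z -> P z.
Proof.
by case: s; split=> // -[p [q [xpq H]]]; exists q, p; split=> [|z ?];
  [ord|apply: H; ord|ord|apply: H; ord].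
Qed.

Lemma nbhI x P Q : nbh x P -> nbh x Q -> nbh x (fun z => P z /\ Q z).
Proof.
move=> [p [q [xpq HP]]] [p' [q' [xpq' HQ]]].
have [p1 [q1 [xpq1 [? ?]]]] := itv_meet xpq xpq'.
by exists p1, q1; split=> // z ?; split; [apply: HP|apply: HQ]; ord.
Qed.

Lemma nbhS x (P Q : M -> Prop) : nbh x P -> (forall z, P z -> Q z) -> nbh x Q.
Proof. by move=> [p [q [xpq H]]] PQ; exists p, q; split=> // z /H/PQ. Qed.

Lemma nbh_self x P : nbh x P -> P x.
Proof. by move=> [p [q [xpq]]]; apply. Qed.

Lemma nbh_above s x y : olt s x y -> nbh x (fun z => olt s z y).
Proof.
move=> xy; have [p px] := olt_below s x.
by apply/(nbh_oitv s); exists p, y; split=> [|z ?]; ord.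
Qed.

Lemma cont_nbh t (h : M -> M) x u v : cont_at h x -> oitv t u v (h x) ->
  nbh x (fun z => oitv t u v (h z)).
Proof. by move=> hx /(cont_at_oitv hx). Qed.

Lemma cont_nbh_lt t (h : M -> M) x v : cont_at h x -> olt t (h x) v ->
  nbh x (fun z => olt t (h z) v).
Proof.
move=> hx hv; have [u uh] := olt_below t (h x).
have [|p [q [xpq H]]] := cont_at_oitv (t := t) (u := u) (v := v) hx; first by ord.
by exists p, q; split=> // z /H [].
Qed.

Lemma cont_nbh_gt t (h : M -> M) x v : cont_at h x -> olt t v (h x) ->
  nbh x (fun z => olt t v (h z)).
Proof.
move=> hx hv; have := @cont_nbh_lt (~~ t) h x v hx.
by rewrite olt_neg => /(_ hv) H; apply: nbhS H _ => z; rewrite olt_neg.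
Qed.

Lemma cont_lt t (h1 h2 : M -> M) x : cont_at h1 x -> cont_at h2 x ->
  olt t (h1 x) (h2 x) -> nbh x (fun z => olt t (h1 z) (h2 z)).
Proof.
move=> c1 c2 /olt_dense[m [hm mh]].
apply: nbhS (nbhI (cont_nbh_lt c1 hm) (cont_nbh_gt c2 mh)) _ => z; ord.
Qed.

Lemma cont_ext (h1 h2 : M -> M) x : cont_at h1 x -> nbh x (fun z => h1 z = h2 z) ->
  cont_at h2 x.
Proof.
move=> c1 E u v; rewrite -(nbh_self E) => /(cont_nbh c1) N.
by apply: nbhS (nbhI E N) _ => z [->].
Qed.

Lemma cont_cst (c : M) x : cont_at (fun=> c) x.
Proof.
move=> u v cuv; have [p px] := olt_below true x; have [q xq] := olt_above true x.
by exists p, q; split=> [|z _]; ord.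
Qed.

Definition convex (K : M -> Prop) : Prop :=
  forall s x y z, K x -> K z -> ole s x y -> ole s y z -> K y.

Record good_domain (K : M -> Prop) : Prop := GoodDomain {
  gd_def : def1 K;
  gd_convex : convex K;
  gd_open : forall x, K x -> nbh x K;
  gd_good : forall x, K x -> good X x }.

Definition sel (K : M -> Prop) (h : M -> M) : Prop :=
  forall x, K x -> Y x (h x) /\ cont_at h x.

(** The projection of the boundary to [K] is a trivial bundle, definably branch
    by branch. *)
Definition trivial_over (K : M -> Prop) : Prop := forall z y, K z -> Y z y ->
  exists h, [/\ defF h, sel K h & h z = y].

Lemma sel_sub (K K' : M -> Prop) h : sel K h -> (forall x, K' x -> K x) -> sel K' h.
Proof. by move=> S sub x /sub /S. Qed.

Lemma trivial_sub K K' : trivial_over K -> (forall x, K' x -> K x) ->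
  trivial_over K'.
Proof.
move=> T sub z y /sub Kz /(T z y Kz)[h [dh Sh hz]].
by exists h; split=> //; apply: sel_sub sub.
Qed.

Lemma gdI K K' : good_domain K -> good_domain K' ->
  good_domain (fun x => K x /\ K' x).
Proof.
move=> [dK cK oK gK] [dK' cK' oK' gK']; split.
- by dfn.
- move=> s x y z [? ?] [? ?] ? ?.
  by split; [apply: (cK s x y z)|apply: (cK' s x y z)].
- by move=> x [/oK ? /oK' ?]; apply: nbhI.
- by move=> x [/gK].
Qed.

Lemma gdU K K' z : good_domain K -> good_domain K' -> K z -> K' z ->
  good_domain (fun x => K x \/ K' x).
Proof.
move=> [dK cK oK gK] [dK' cK' oK' gK'] Kz Kz'; split.
- by dfn.
- have H s (A B : M -> Prop) (cA : convex A) (cB : convex B) (Az : A z) (Bz : B z) x y w :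
      A x -> B w -> ole s x y -> ole s y w -> A y \/ B y.
    move=> Ax Bw xy yw; have [yz|zy] := pselect (ole s y z); [left|right].
      by apply: (cA s x y z).
    by apply: (cB s z y w) => //; ord.
  move=> s x y w [Kx|Kx] [Kw|Kw] xy yw.
  + by left; apply: (cK s x y w).
  + exact: (H s K K' cK cK' Kz Kz' x y w).
  + by have [] := H s K' K cK' cK Kz' Kz x y w; [| | | |right|left].
  + by right; apply: (cK' s x y w).
- by move=> x [/oK|/oK'] H; apply: nbhS H _; auto.
- by move=> x [/gK|/gK'].
Qed.

Lemma gd_itv s p q : (forall x, oitv s p q x -> good X x) ->
  good_domain (oitv s p q).
Proof.
move=> H; split=> //; first by dfn.
- move=> o x y z xpq zpq xy yz.
  have [E|E] : o = s \/ o = ~~ s by case: (o); case: (s); auto.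
    by subst o; ord.
  by subst o; ord.
- by move=> x xpq; apply/(nbh_oitv s); exists p, q.
Qed.

Lemma gd_tail s K x : good_domain K -> good_domain (fun z => K z /\ olt s x z).
Proof.
move=> [dK cK oK gK]; split.
- by dfn.
- move=> o w y z [Kw xw] [Kz xz] wy yz; split; first exact: (cK o w y z).
  have [E|E] : o = s \/ o = ~~ s by case: (o); case: (s); auto.
    by subst o; ord.
  by subst o; ord.
- move=> w [/oK Kw xw]; apply: nbhI => //.
  have := @nbh_above (~~ s) w x; rewrite olt_neg => /(_ xw) H.
  by apply: nbhS H _ => z; rewrite olt_neg.
- by move=> w [/gK].
Qed.

Lemma gd_conn K (S : M -> Prop) z x : good_domain K -> def1 S -> K z -> K x ->
  (forall w, K w -> nbh w (fun w' => S w' <-> S w)) -> S z -> S x.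
Proof.
move=> [dK cK oK gK] dS Kz Kx loc Sz.
have H s : ole s z x -> S x.
  move=> zx; apply: (interval_connected HM (s := s) dS zx) => // w zw wx.
  by apply/(nbh_oitv s)/loc; apply: (cK s z w x).
have [zx|<-//|xz] := olt_cases true z x; first by apply: (H true); ord.
by apply: (H false); ord.
Qed.

(** The intermediate value theorem. *)
Lemma never_eq_lt K t (h1 h2 : M -> M) z x : good_domain K -> defF h1 -> defF h2 ->
  (forall x, K x -> cont_at h1 x) -> (forall x, K x -> cont_at h2 x) ->
  (forall x, K x -> h1 x <> h2 x) -> K z -> K x ->
  olt t (h1 z) (h2 z) -> olt t (h1 x) (h2 x).
Proof.
move=> gK d1 d2 c1 c2 ne Kz Kx.
have dS : def1 (fun w => olt t (h1 w) (h2 w)) by dfn.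
apply: (gd_conn gK dS Kz Kx) => w Kw.
have [lt|/(ne w Kw)//|gt] := olt_cases t (h1 w) (h2 w).
  by apply: nbhS (cont_lt (c1 w Kw) (c2 w Kw) lt) _.
apply: nbhS (cont_lt (c2 w Kw) (c1 w Kw) gt) _ => w' ?; split; ord.
Qed.

(** Near a good point, the boundary is the graph of a function, so two
    selections that meet coincide there. *)
Lemma sel_uniq K h1 h2 z x : good_domain K -> defF h1 -> defF h2 ->
  sel K h1 -> sel K h2 -> K z -> h1 z = h2 z -> K x -> h1 x = h2 x.
Proof.
move=> gK d1 d2 S1 S2 Kz E Kx.
have dS : def1 (fun w => h1 w = h2 w) by dfn.
apply: (gd_conn gK dS Kz Kx) E => w Kw.
have [Y1 c1] := S1 w Kw; have [Y2 c2] := S2 w Kw.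
have [lt|E|gt] := olt_cases true (h1 w) (h2 w); last 1 first.
- apply: nbhS (cont_lt c2 c1 gt) _ => w' ?; split; ord.
- apply: nbhS (cont_lt c1 c2 lt) _ => w' ?; split; ord.
have [u0 u0h] := olt_below true (h1 w); have [v0 v0h] := olt_above true (h1 w).
have [|p [q [u [v [[wpq huv] [_ [W _]]]]]]] := ((gd_good gK Kw).1 (h1 w)).2 Y1 u0 v0.
  by ord.
have N1 := cont_nbh c1 huv.
have N2 : nbh w (fun z => oitv true u v (h2 z)).
  by apply: cont_nbh => //; rewrite -E.
have N3 : nbh w K := gd_open gK Kw.
have N4 : nbh w (oitv true p q) by exists p, q.
apply: nbhS (nbhI (nbhI N1 N2) (nbhI N3 N4)) _ => w' [[? ?] [Kw' wpq']].
split=> // _; have [y [_ U]] := W w' wpq'.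
have [Y1' _] := S1 w' Kw'; have [Y2' _] := S2 w' Kw'.
have -> : h1 w' = y by exact: U.
by apply: esym; exact: U.
Qed.

Lemma sel_lt K t h1 h2 z x : good_domain K -> defF h1 -> defF h2 ->
  sel K h1 -> sel K h2 -> K z -> K x -> olt t (h1 z) (h2 z) -> olt t (h1 x) (h2 x).
Proof.
move=> gK d1 d2 S1 S2 Kz Kx lt.
apply: (never_eq_lt (t := t) gK d1 d2 _ _ _ Kz Kx) => // w Kw.
- by case: (S1 w Kw).
- by case: (S2 w Kw).
- by move=> E; have := sel_uniq gK d1 d2 S1 S2 Kw E Kz; ord.
Qed.

Lemma sel_glue K K' h h' z : good_domain K -> good_domain K' -> defF h ->
  defF h' -> sel K h -> sel K' h' -> K z -> K' z -> h z = h' z ->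
  exists g, [/\ defF g, sel (fun x => K x \/ K' x) g,
    forall x, K x -> g x = h x & forall x, K' x -> g x = h' x].
Proof.
move=> gK gK' dh dh' Sh Sh' Kz Kz' E.
have agree x : K x -> K' x -> h x = h' x.
  move=> Kx Kx'; apply: (sel_uniq (gdI gK gK') dh dh' _ _ _ E) => //.
    by apply: sel_sub Sh _ => ? [].
  by apply: sel_sub Sh' _ => ? [].
have dK := gd_def gK.
pose R x y := (K x /\ y = h x) \/ (~ K x /\ y = h' x).
have dR : def2 R by rewrite /R; dfn.
have [||g [dg gR]] := graph_fun (M := M) (K := fun=> True) (R := R) _ dR.
- exact: defP_true.
- move=> x _; have [Kx|nK] := pselect (K x).
    by exists (h x); split=> [|y [[]|[]]] //; left.
  by exists (h' x); split=> [|y [[]|[]]] //; right.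
have gh x : K x -> g x = h x by case: (gR x I) => -[].
have gh' x : K' x -> g x = h' x.
  by move=> Kx'; case: (gR x I) => -[// Kx ->]; exact: agree.
exists g; split=> // x [Kx|Kx].
  have [? ch] := Sh x Kx; rewrite gh //; split=> //.
  by apply: cont_ext ch _; apply: nbhS (gd_open gK Kx) _ => w /gh.
have [? ch] := Sh' x Kx; rewrite gh' //; split=> //.
by apply: cont_ext ch _; apply: nbhS (gd_open gK' Kx) _ => w /gh'.
Qed.

Lemma trivialU K K' z : good_domain K -> good_domain K' -> trivial_over K ->
  trivial_over K' -> K z -> K' z -> trivial_over (fun x => K x \/ K' x).
Proof.
move=> gK gK' TK TK' Kz Kz' w y [Kw|Kw] Yw.
  have [h [dh Sh hw]] := TK w y Kw Yw.
  have [h' [dh' Sh' hz]] := TK' z (h z) Kz' (Sh z Kz).1.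
  have [//|g [dg Sg gh gh']] := sel_glue gK gK' dh dh' Sh Sh' Kz Kz'.
  by exists g; split=> //; rewrite gh.
have [h' [dh' Sh' hw]] := TK' w y Kw Yw.
have [h [dh Sh hz]] := TK z (h' z) Kz (Sh' z Kz').1.
have [//|g [dg Sg gh gh']] := sel_glue gK gK' dh dh' Sh Sh' Kz Kz'.
by exists g; split=> //; rewrite gh'.
Qed.

(** Normality provides smaller windows, and this gives continuity. *)
Lemma win_sel p q u v : good_domain (oitv true p q) -> win X p q u v ->
  exists h, [/\ defF h, sel (oitv true p q) h &
    forall x, oitv true p q x -> oitv true u v (h x)].
Proof.
move=> gpq W; have dY := def2_bd dX.
pose R x y := oitv true u v y /\ Y x y.
have dR : def2 R by rewrite /R; dfn.
have [| |h [dh hR]] := graph_fun (M := M) (K := oitv true p q) (R := R) _ dR.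
- by dfn.
- move=> x /W[y [yuv U]]; exists y; split=> // y' [? ?]; exact: U.
exists h; split=> // [x xpq|x /hR[]//].
have [hx Yx] := hR x xpq; split=> // u0 v0 hx0.
have [|p' [q' [u' [v' [[xpq' hx'] [uv0 [W' _]]]]]]] := ((gd_good gpq xpq).1 (h x)).2 Yx u0 v0.
  by [].
have [u1 [v1 [huv1 [uv1 uv1']]]] := itv_meet hx hx0.
have [|p1 [q1 [u2 [v2 [[xpq1 hx2] [uv2 [W2 _]]]]]]] := ((gd_good gpq xpq).1 (h x)).2 Yx u1 v1.
  by [].
have [p3 [q3 [xpq3 pq3]]] := itv_meet xpq xpq1.
exists p3, q3; split=> // w wpq.
have [y [[yuv Yw] _]] := W2 w ltac:(ord).
have [y' [_ U]] := W w ltac:(ord).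
have [hw Yhw] := hR w ltac:(ord).
have -> : h w = y.
  have -> : h w = y' by exact: U.
  by apply: esym; apply: U => //; ord.
by ord.
Qed.

Lemma uniform_trivial p q : good_domain (oitv true p q) -> uniform X p q ->
  trivial_over (oitv true p q).
Proof.
move=> gpq U z y zpq Yz; have [u [v [yuv W]]] := U z zpq y Yz.
have [h [dh Sh hu]] := win_sel gpq W; exists h; split=> //.
have [y' [_ Uy]] := W z zpq; have [Yh _] := Sh z zpq.
have -> : h z = y' by apply: Uy => //; exact: hu.
by apply: esym; exact: Uy.
Qed.

End Selections.

(** * Points linked by windows *)

Section Domain.
Context (L : language) (d : Order.disp_t) (M : structure L d).
Hypothesis HM : dctc M.
Context (X : M -> M -> Prop).
Hypothesis dX : def2 X.
Local Notation Y := (bd X).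
Context (K : M -> Prop).
Hypothesis gK : good_domain X K.

Definition linked x x' : Prop := exists U, [/\ good_domain X U,
  forall z, U z -> K z, U x, U x' & trivial_over X U].

Lemma linked_sym x x' : linked x x' -> linked x' x.
Proof. by move=> [U [? ? ? ? ?]]; exists U. Qed.

Lemma linked_trans x y z : linked x y -> linked y z -> linked x z.
Proof.
move=> [U [gU UK Ux Uy TU]] [V [gV VK Vy Vz TV]].
exists (fun w => U w \/ V w); split; auto.
- exact: (gdU gU gV Uy Vy).
- by move=> w [/UK|/VK].
- exact: (trivialU HM gU gV TU TV Uy Vy).
Qed.

Lemma linked_between s x y z : linked x z -> ole s x y -> ole s y z -> linked x y.
Proof.
move=> [U [gU UK Ux Uz TU]] xy yz; exists U; split=> //.
exact: (gd_convex gU Ux Uz xy yz).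
Qed.

Lemma linked_in p q x x' : uniform X p q -> (forall z, oitv true p q z -> K z) ->
  oitv true p q x -> oitv true p q x' -> linked x x'.
Proof.
move=> U pqK xpq xpq'.
have gpq : good_domain X (oitv true p q).
  by apply: gd_itv => z /pqK/(gd_good gK).
by exists (oitv true p q); split=> //; exact: uniform_trivial.
Qed.

Lemma uniform_at x : K x -> exists p q, [/\ oitv true p q x, uniform X p q &
  forall z, oitv true p q z -> K z].
Proof.
move=> Kx; have [_ [p [q [xpq U]]]] := gd_good gK Kx.
have [p' [q' [xpq' H]]] := gd_open gK Kx.
have [p1 [q1 [xpq1 [? ?]]]] := itv_meet xpq xpq'.
exists p1, q1; split=> // [|z ?]; last by apply: H; ord.
by apply: uniform_sub U _ _; ord.
Qed.

Lemma linked_refl x : K x -> linked x x.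
Proof. by move=> /uniform_at[p [q [xpq U ?]]]; apply: (linked_in U). Qed.

(** The sets along which [K] may be cut. *)
Definition segment s (G : M -> Prop) : Prop :=
  forall x y, K x -> G y -> olt s x y -> G x.

Definition loc_const (G : M -> Prop) : Prop :=
  forall x, K x -> nbh x (fun z => G z <-> G x).

(** Such a set cannot be left within an interval that has windows at all
    points, hence it is a union of classes of linked points. *)
Definition uniform_closed (G : M -> Prop) : Prop :=
  forall p q, uniform X p q -> (forall z, oitv true p q z -> K z) ->
  forall z w, oitv true p q z -> oitv true p q w -> G z -> G w.

Lemma uniform_closed_loc G : uniform_closed G -> loc_const G.
Proof.
move=> CG x /uniform_at[p [q [xpq U pqK]]].
by exists p, q; split=> // z zpq; split; apply: (CG p q).
Qed.

Definition below_class s x z : Prop := exists w, ole s z w /\ linked x w.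

Lemma below_class_segment s x : segment s (below_class s x).
Proof. by move=> y z Ky [w [zw xw]] yz; exists w; split=> //; ord. Qed.

Lemma below_class_closed s x : uniform_closed (below_class s x).
Proof.
move=> p q U pqK z w zpq wpq [v [zv xv]].
have [wv|vw] := pselect (ole s w v); first by exists v.
exists w; split; first exact: ole_refl.
apply: (linked_trans xv); apply: (linked_in U) => //.
by have [E|E] : s = true \/ s = false by [case: (s); auto]; subst s; ord.
Qed.

Definition unsplit x x' : Prop := forall s G, segment s G -> uniform_closed G ->
  (G x <-> G x').

(** Among the cuts is the one just above the class of [x]. *)
Lemma unsplit_linked x x' : K x -> K x' -> unsplit x x' -> linked x x'.
Proof.
move=> Kx Kx' H.
wlog xx' : x x' Kx Kx' H / ole true x x'.
  move=> W; have [|xx'] := pselect (ole true x x'); first exact: W.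
  apply: linked_sym; apply: W => //; last by ord.
  by move=> s G sG cG; apply: iff_sym; exact: (H s).
have [w [x'w xw]] : below_class true x x'.
  apply/(H true (below_class true x)).
  - exact: below_class_segment.
  - exact: below_class_closed.
  by exists x; split; [exact: ole_refl|exact: linked_refl].
exact: (linked_between xw xx' x'w).
Qed.

Section End.
Context (s : bool).

Definition tail x z : Prop := K z /\ olt s x z.

Lemma tail_domain x : good_domain X (tail x). Proof. exact: gd_tail. Qed.

Lemma above_in x : K x -> exists y, K y /\ olt s x y.
Proof.
move=> /(gd_open gK)/(nbh_oitv s)[p [q [xpq H]]].
have [|y xy] := @olt_dense _ _ _ s x q; first by ord.
by exists y; split; [apply: H|]; ord.
Qed.

(** Type completeness at the end of [K], be it at a point or at an end of the
    line. *)
Lemma tail_dichotomy (S : M -> Prop) x0 : def1 S -> K x0 ->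
  exists x1, (K x1 /\ olt s x0 x1) /\
    ((forall x, tail x1 x -> S x) \/ (forall x, tail x1 x -> ~ S x)).
Proof.
move=> dS Kx0; have dK := gd_def gK.
have [x2 [Kx2 x02]] := above_in Kx0.
have [[b Kb]|unb] := pselect (exists b, forall x, K x -> ole s x b).
  have [||l [l1 l2]] := dctc_lub HM s dK; [by exists x0|by exists b|].
  have [e [el He]] := germ_left HM s dS l.
  have [m [mx me mE]] := omax s x2 e.
  have ml : olt s m l.
    case: mE => -> //; have [y [Ky xy]] := above_in Kx2.
    by have := l1 y Ky; ord.
  have [y [my Ky]] : exists y, olt s m y /\ K y.
    apply: contrapT => n; suff : ole s l m by ord.
    by apply: l2 => y Ky my; apply: n; exists y.
  have inl x : tail y x -> oitv s e l x.
    move=> [Kx yx]; have [z [Kz xz]] := above_in Kx.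
    by have := l1 z Kz; ord.
  exists y; split; first by split; [|ord].
  by case: He => He; [left|right] => x /inl; apply: He.
have unb' b : exists x, K x /\ olt s b x.
  apply: contrapT => n; apply: unb; exists b => x Kx bx.
  by apply: n; exists x.
have [b Hb] := dctc_end HM s dS.
have [m [mx mb mE]] := omax s x2 b; have [y [Ky my]] := unb' m.
exists y; split; first by split=> //; ord.
by case: Hb => Hb; [left|right] => x [_ ?]; apply: Hb; ord.
Qed.

(** Definability near the end passes from a branch to the next one, which is the
    least boundary value above it. The function [f] may also be a constant, as
    long as no branch crosses it. *)
Lemma next_branch t x1 (f : M -> M) y : defF f -> forall x2, tail x1 x2 ->
  (forall x, tail x1 x -> linked x x2) ->
  (forall U h x, good_domain X U -> (forall z, U z -> K z) -> U x2 -> U x ->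
    tail x1 x -> defF h -> sel X U h ->
    forall o, (olt o (f x2) (h x2) -> olt o (f x) (h x)) /\
              (h x2 = f x2 -> h x = f x)) ->
  Y x2 y -> olt t (f x2) y ->
  (forall w, oitv t (f x2) y w -> ~ Y x2 w) ->
  exists h, [/\ defF h, sel X (tail x1) h & h x2 = y].
Proof.
move=> df x2 x2t lnk cross Yy fy nxt.
have dY := def2_bd dX; have gt := tail_domain x1.
pose R x m := (Y x m /\ olt t (f x) m) /\
  forall w, Y x w -> olt t (f x) w -> ole t m w.
have dR : def2 R by rewrite /R; dfn.
have key U g x : good_domain X U -> (forall z, U z -> K z) ->
    trivial_over X U -> U x2 -> U x -> tail x1 x -> defF g -> sel X U g ->
    g x2 = y -> R x (g x) /\ forall m, R x m -> m = g x.
  move=> gU UK TU Ux2 Ux tx dg Sg gy.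
  have fg : olt t (f x) (g x).
    by apply: (cross U g x gU UK Ux2 Ux tx dg Sg t).1; rewrite gy.
  have Rg : R x (g x).
    split; first by split=> //; case: (Sg x Ux).
    move=> w Yw fw wg; have [h [dh Sh hw]] := TU x w Ux Yw.
    have hg : olt t (h x2) (g x2).
      by apply: (sel_lt HM gU dh dg Sh Sg Ux Ux2); rewrite hw.
    have [fh|E|hf] := olt_cases t (f x2) (h x2).
    - by apply: (nxt (h x2)); [ord|case: (Sh x2 Ux2)].
    - have := (cross U h x gU UK Ux2 Ux tx dh Sh t).2 (esym E).
      by rewrite hw => E'; subst w; ord.
    - have := (cross U h x gU UK Ux2 Ux tx dh Sh (~~ t)).1.
      by rewrite !olt_neg hw => /(_ hf); ord.
  split=> // m [[Ym fm] Hm].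
  have := Hm (g x) (Rg.1.1) fg; have := Rg.2 m Ym fm; ord.
have branch x : tail x1 x -> exists U g, [/\ good_domain X U,
    (forall z, U z -> K z), trivial_over X U & U x2] /\
    [/\ U x, defF g, sel X U g & g x2 = y].
  move=> /lnk[U [gU UK Ux Ux2 TU]]; have [g [dg Sg gy]] := TU x2 y Ux2 Yy.
  by exists U, g.
have [||h [dh hR]] := graph_fun (M := M) (K := tail x1) (R := R) _ dR.
- exact: gd_def gt.
- move=> x tx; have [U [g [[gU UK TU Ux2] [Ux dg Sg gy]]]] := branch x tx.
  by exists (g x); apply: (key U).
have hg x U g : tail x1 x -> good_domain X U -> (forall z, U z -> K z) ->
   trivial_over X U -> U x2 -> U x -> defF g -> sel X U g -> g x2 = y -> h x = g x.
  move=> tx gU UK TU Ux2 Ux dg Sg gy.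
  exact: (key U g x gU UK TU Ux2 Ux tx dg Sg gy).2 (hR x tx).
exists h; split=> //.
  move=> x tx; split; first by case: (hR x tx) => -[].
  have [U [g [[gU UK TU Ux2] [Ux dg Sg gy]]]] := branch x tx.
  have [_ cg] := Sg x Ux; apply: cont_ext cg _.
  apply: nbhS (nbhI (gd_open gU Ux) (gd_open gt tx)) _ => z [Uz tz].
  by apply: esym; apply: (hg z U).
have [U [g [[gU UK TU Ux2] [_ dg Sg gy]]]] := branch x2 x2t.
by rewrite (hg x2 U g).
Qed.

End End.
End Domain.

(** * Without gaps, branches are definable near the end *)

Section Gap.
Context (L : language) (d : Order.disp_t) (M : structure L d).
Hypothesis HM : dctc M.
Context (X : M -> M -> Prop).
Hypothesis dX : def2 X.
Local Notation Y := (bd X).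
Context (K : M -> Prop).
Hypothesis gK : good_domain X K.
Context (s : bool).

Lemma last_crossing t U (g : M -> M) x0 x2 y0 : good_domain X U -> defF g ->
  sel X U g -> U x0 -> U x2 -> olt s x0 x2 -> ole t (g x0) y0 ->
  olt t y0 (g x2) ->
  exists z, [/\ ole s x0 z, olt s z x2, g z = y0 &
    forall w, olt s z w -> ole s w x2 -> olt t y0 (g w)].
Proof.
move=> gU dg Sg Ux0 Ux2 x02 g0 g2.
pose A w := (ole s x0 w /\ ole s w x2) /\ ole t (g w) y0.
have dA : def1 A by rewrite /A; dfn.
have [||z [z1 z2]] := dctc_lub HM s dA.
- by exists x0; split=> //; split; [exact: ole_refl|ord].
- by exists x2 => w [[]].
have xz : ole s x0 z by apply: z1; split=> //; split; [exact: ole_refl|ord].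
have zx : ole s z x2 by apply: z2 => w [[]].
have Uz : U z := gd_convex gU Ux0 Ux2 xz zx.
have after w : olt s z w -> ole s w x2 -> olt t y0 (g w).
  move=> zw wx; apply: contrapT => n; have /z1 : A w by split; ord.
  by ord.
have [_ cz] := Sg z Uz.
have gz : g z = y0.
  have [lt|//|gt] := olt_cases t (g z) y0.
    have /(nbh_oitv s)[p [q [zpq H]]] := cont_nbh_lt cz lt.
    have zx' : olt s z x2.
      by have [//|E|] := olt_cases s z x2; [subst x2; ord|ord].
    have [m [mq mx mE]] := omin s q x2.
    have [w zw] : exists w, oitv s z m w by apply: olt_dense; case: mE => ->; ord.
    by have := after w ltac:(ord) ltac:(ord); have := H w ltac:(ord); ord.
  have /(nbh_oitv s)[p [q [zpq H]]] := cont_nbh_gt cz gt.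
  suff : ole s z p by ord.
  apply: z2 => w Aw pw; have wz := z1 w Aw.
  by have := H w ltac:(ord); case: Aw; ord.
exists z; split=> //; have [//|E|] := olt_cases s z x2; [subst x2|]; ord.
Qed.

Context (x0 : M).
Hypothesis Kx0 : K x0.
Hypothesis nogap : forall G, segment K s G -> loc_const K G -> G x0 ->
  forall t, K t -> G t.

Lemma nogap_linked t : K t -> ole s x0 t -> linked X K x0 t.
Proof.
move=> Kt xt; have [w [tw xw]] : below_class X K s x0 t.
  apply: nogap Kt.
  - exact: below_class_segment.
  - exact/uniform_closed_loc/below_class_closed.
  - by exists x0; split; [exact: ole_refl|exact: linked_refl].
exact: (linked_between xw xt tw).
Qed.

Lemma nogap_linked2 t t' : K t -> K t' -> ole s x0 t -> ole s x0 t' ->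
  linked X K t t'.
Proof.
move=> Kt Kt' xt xt'; apply: (linked_trans HM (y := x0)).
  exact/linked_sym/nogap_linked.
exact: nogap_linked.
Qed.

(** Otherwise the points below some member of the sequence form a gap. *)
Lemma nogap_lub (z : nat -> M) b : (forall n, K (z n)) ->
  (forall n, ole s x0 (z n)) -> (forall n, olt s (z n) (z n.+1)) ->
  K b -> (forall n, olt s (z n) b) ->
  exists w, [/\ K w, forall n, olt s (z n) w &
    forall c, olt s c w -> exists n, olt s c (z n)].
Proof.
move=> Kz xz inc Kb zb.
pose G t := exists n, ole s t (z n).
apply: contrapT => nolub.
suff [n bz] : G b by have := zb n; ord.
apply: nogap Kb.
- by move=> x y Kx [n yn] xy; exists n; ord.
- move=> w Kw; have [[n wn]|nG] := pselect (G w).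
    have H : nbh w (fun t => olt s t (z n.+1)).
      by apply: nbh_above; have := inc n; ord.
    apply: nbhS H _ => t tz; split=> _; first by exists n.
    by exists n.+1; ord.
  have [c [cw Hc]] : exists c, olt s c w /\ forall n, ole s (z n) c.
    apply: contrapT => nc; apply: nolub; exists w; split=> //.
      move=> n; apply: contrapT => wz; apply: nG; exists n; ord.
    move=> c cw; apply: contrapT => nz; apply: nc; exists c; split=> // n cz.
    by apply: nz; exists n.
  have H : nbh w (fun t => olt (~~ s) t c) by apply: nbh_above; ord.
  apply: nbhS H _ => t tc; split=> // -[n tn].
  by have := Hc n; ord.
- by exists 0%N; exact: xz.
Qed.

Lemma extend_to_end y z0 x1 x2 U h f : tail K s x1 x2 -> good_domain X U ->
  (forall z, U z -> K z) -> U x0 -> U z0 -> U x2 -> defF h -> sel X U h -> h z0 = y ->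
  defF f -> sel X (tail K s x1) f -> f x2 = h x2 ->
  exists g, [/\ defF g, sel X (tail K s x0) g & g z0 = y].
Proof.
move=> tx2 gU UK Ux0 Uz0 Ux2 dh Sh hz df Sf E.
have gt := tail_domain gK s x1.
have [|g [dg Sg gh gf]] := sel_glue HM gU gt dh df Sh Sf Ux2 tx2.
  by rewrite E.
exists g; split=> //; last by rewrite gh.
apply: sel_sub Sg _ => x [Kx x0x].
have [x1x|xx1] := pselect (olt s x1 x); first by right.
left; apply: (gd_convex gU (s := s) Ux0 Ux2); first by ord.
by case: tx2; ord.
Qed.

(** The branch through [(z0, y)] has the value [y0] at [x0]. If it were not
    definable near the end, there would be a descending sequence [ys] of values
    at [x2] of branches that are not definable either and that are between it
    and [y0]. The last crossings [z] of the height [y0] by these branches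
    increase to a good point [w], which is impossible. *)
Lemma nogap_trivial : trivial_over X (tail K s x0).
Proof.
have dY := def2_bd dX.
move=> z0 y z0t Yz0; have [Kz0 xz0] := z0t.
have [U0 [gU0 UK0 U0x0 U0z0 TU0]] := nogap_linked Kz0 (oltW xz0).
have [h0 [dh0 Sh0 h0z0]] := TU0 z0 y U0z0 Yz0.
pose y0 := h0 x0.
have dS : def1 (fun x => Y x y0) by dfn.
(* Beyond [x1], either the constant [y0] is a branch or no boundary point has
   the height [y0]. *)
have [x1 [[Kx1 x01] alt]] := tail_dichotomy HM gK s dS Kx0.
have [x2 [Kx2 x12]] := above_in gK s Kx1.
have tx2 : tail K s x1 x2 by [].
have gt := tail_domain gK s x1.
have [U [gU UK Ux0 Ux2 TU]] := nogap_linked Kx2 (oltW (olt_trans x01 x12)).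
wlog Uz0 : U gU UK Ux0 Ux2 TU / U z0.
  move=> W; apply: (W (fun x => U x \/ U0 x)); auto.
  - exact: (gdU gU gU0 Ux0 U0x0).
  - by move=> z [/UK|/UK0].
  - exact: (trivialU HM gU gU0 TU TU0 Ux0 U0x0).
have [h [dh Sh hz0]] := TU z0 y Uz0 Yz0.
have hx0 : h x0 = y0.
  apply: (sel_uniq HM (gdI gU gU0) dh dh0 (z := z0)) => //.
  - by apply: sel_sub Sh _ => ? [].
  - by apply: sel_sub Sh0 _ => ? [].
  - by rewrite hz0.
pose at_end y := exists f, [/\ defF f, sel X (tail K s x1) f & f x2 = y].
suff [f [df Sf fx2]] : at_end (h x2).
  exact: (extend_to_end (U := U) (h := h) (f := f) tx2).
apply: contrapT => nend.
have dcst c : defF (fun _ : M => c) by dfn.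
have ccst c x : cont_at (fun _ : M => c) x := @cont_cst _ _ _ c x.
(* If the constant [y0] is a branch, it is the only one to meet that height;
   otherwise no branch does. *)
have const_branch V f x : good_domain X V -> (forall z, V z -> K z) -> V x ->
    tail K s x1 x -> defF f -> sel X V f -> f x = y0 ->
    forall x', V x' -> tail K s x1 x' -> f x' = y0.
  move=> gV VK Vx tx df Sf fx x' Vx' tx'.
  case: alt => alt; last by case: (alt x tx); rewrite -fx; case: (Sf x Vx).
  apply: (sel_uniq HM (gdI gV gt) df (dcst y0) (z := x)) => //.
    by apply: sel_sub Sf _ => ? [].
  by move=> w [_ tw]; split; [apply: alt|apply: ccst].
have lnk x : tail K s x1 x -> linked X K x x2.
  by move=> [Kx x1x]; apply: nogap_linked2 => //; ord.
have cross0 V f x : good_domain X V -> (forall z, V z -> K z) -> V x2 -> V x ->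
    tail K s x1 x -> defF f -> sel X V f ->
    forall o, (olt o y0 (f x2) -> olt o y0 (f x)) /\ (f x2 = y0 -> f x = y0).
  move=> gV VK Vx2 Vx tx df Sf o; split; last first.
    by move=> E; apply: (const_branch V f x2).
  move=> lt; apply: (never_eq_lt HM (t := o) (gdI gV gt) (dcst y0) df (z := x2)) => //.
  - by move=> w [Vw _]; case: (Sf w Vw).
  - move=> w [Vw tw] E; have := const_branch V f w gV VK Vw tw df Sf (esym E) x2 Vx2 tx2.
    by move=> E'; ord.
have [t lt] : exists t, olt t y0 (h x2).
  have [lt|E|gt'] := olt_cases true y0 (h x2); [by exists true| |by exists false].
  case: nend; exists (fun=> y0); split=> // x tx.
  split; last exact: ccst.
  have [V [gV VK Vx Vx2 TV]] := lnk x tx.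
  have [f [df Sf fx2]] := TV x2 (h x2) Vx2 (Sh x2 Ux2).1.
  rewrite -(cross0 V f x gV VK Vx2 Vx tx df Sf true).2; last by rewrite fx2.
  by case: (Sf x Vx).
pose bad y := (Y x2 y /\ olt t y0 y) /\ (ole t y (h x2) /\ ~ at_end y).
have step y1 : bad y1 -> exists y2, bad y2 /\ olt t y2 y1.
  move=> [[Y1 y01] [y1h n1]].
  have [ex|no] := pselect (exists w, oitv t y0 y1 w /\ Y x2 w); last first.
    case: n1.
    apply: (next_branch HM dX gK (t := t) (f := fun=> y0)) => //.
    by move=> w wy Yw; apply: no; exists w.
  have [w0 [w0y Yw0]] := ex.
  have [|m [[Ym ym] Hm]] := bd_next HM dX (s := ~~ t) (x := x2) (y := y1).
    by exists w0; split=> //; ord.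
  have mw := Hm w0 Yw0 ltac:(ord).
  exists m; split; last by ord.
  split; first by split=> //; ord.
  split; first by ord.
  move=> [f [df Sf fx2]]; apply: n1.
  apply: (next_branch HM dX gK (t := t) (f := f)) => //.
  - move=> V g x gV VK Vx2 Vx tx dg Sg o.
    have Sf' : sel X (fun z => V z /\ tail K s x1 z) f by apply: sel_sub Sf _ => ? [].
    have Sg' : sel X (fun z => V z /\ tail K s x1 z) g by apply: sel_sub Sg _ => ? [].
    split; first exact: (sel_lt HM (gdI gV gt) df dg Sf' Sg').
    by move=> E; apply: (sel_uniq HM (gdI gV gt) dg df Sg' Sf' (z := x2)).
  - by rewrite fx2; ord.
  - rewrite fx2 => w [mw' wy] Yw.
    by have := Hm w Yw; rewrite olt_neg ole_neg => /(_ wy); ord.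
have [ys [ys0 ysP]] : exists ys : nat -> M, (forall n, bad (ys n)) /\
    forall n, olt t (ys n.+1) (ys n).
  have /choice[nx nxP] : forall y1, exists y2, bad y1 -> bad y2 /\ olt t y2 y1.
    move=> y1; have [b|nb] := pselect (bad y1); last by exists y1.
    by have [y2 ?] := step y1 b; exists y2.
  have b n : bad (iter n nx (h x2)).
    elim: n => [|n IH] /=; last by case: (nxP _ IH).
    by split; split=> //; [case: (Sh x2 Ux2)|exact: ole_refl].
  by exists (fun n => iter n nx (h x2)); split=> // n; case: (nxP _ (b n)).
have /choice[g gP] : forall n, exists f, [/\ defF f, sel X U f & f x2 = ys n].
  by move=> n; apply: TU => //; case: (ys0 n) => -[].
have x02 : olt s x0 x2 := olt_trans x01 x12.
have g0 n : ole t (g n x0) y0.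
  have [dg Sg gx2] := gP n; have [_ [yh _]] := ys0 n.
  rewrite -hx0 => gt'.
  have := sel_lt HM gU dh dg Sh Sg Ux0 Ux2 gt'; rewrite gx2; ord.
have /choice[z zP] : forall n, exists z, [/\ ole s x0 z, olt s z x2, g n z = y0 &
    forall w, olt s z w -> ole s w x2 -> olt t y0 (g n w)].
  move=> n; have [dg Sg gx2] := gP n; have [[_ yn] _] := ys0 n.
  by apply: (last_crossing gU dg Sg); rewrite ?gx2.
have Uz n : U (z n).
  by have [xz zx _ _] := zP n; apply: (gd_convex gU Ux0 Ux2 xz); ord.
have inc n : olt s (z n) (z n.+1).
  have [xz zx gz Hz] := zP n; have [xz' zx' gz' Hz'] := zP n.+1.
  have [dg Sg gx2] := gP n; have [dg' Sg' gx2'] := gP n.+1.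
  have lt' : olt t (g n.+1 (z n)) (g n (z n)).
    by apply: (sel_lt HM gU dg' dg Sg' Sg Ux2 (Uz n)); rewrite gx2 gx2'.
  have [//|E|zz] := olt_cases s (z n) (z n.+1); first by rewrite -E in gz'; ord.
  by have := Hz' (z n) zz (oltW zx); ord.
have Kz n : K (z n) by apply: UK.
have xz n : ole s x0 (z n) by case: (zP n).
have zx n : olt s (z n) x2 by case: (zP n).
have [w [Kw zw Hw]] := nogap_lub Kz xz inc Kx2 zx.
have xw : ole s x0 w by have := zw 0%N; have := xz 0%N; ord.
have wx : ole s w x2.
  by move=> /Hw[n]; have := zx n; ord.
have Uw : U w := gd_convex gU Ux0 Ux2 xw wx.
have late (P : M -> Prop) : nbh w P -> exists n, P (z n) /\ P (z n.+1).
  move=> /(nbh_oitv s)[p [q [wpq HP]]]; have [|n pn] := Hw p; first by ord.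
  by exists n; have := zw n; have := zw n.+1; have := inc n; split; apply: HP; ord.
have Yz n : Y (z n) y0.
  by have [_ _ <- _] := zP n; have [_ Sg _] := gP n; case: (Sg (z n) (Uz n)).
have [norm _] := gd_good gU Uw.
have [Yw|nYw] := pselect (Y w y0); last first.
  have [p [q [u [v [wpq [yuv H]]]]]] := (norm y0).1 nYw.
  have [|n [zpq _]] := late (oitv true p q); first by exists p, q.
  apply: (not_bd (x := z n) yuv) => //.
  by case: H => H; [left|right] => w' ?; apply: H.
have [f [df Sf fw]] := TU w y0 Uw Yw.
have [u0 u0y] := olt_below true y0; have [v0 v0y] := olt_above true y0.
have [|p [q [u [v [[wpq yuv] [_ [W _]]]]]]] := (norm y0).2 Yw u0 v0; first by ord.
have N1 : nbh w (fun x => oitv true u v (f x)).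
  by apply: cont_nbh; [case: (Sf w Uw)|rewrite fw].
have N2 : nbh w (oitv true p q) by exists p, q.
have [n [[fz zpq] [fz' zpq']]] := late _ (nbhI N1 N2).
have fy m : oitv true p q (z m) -> oitv true u v (f (z m)) -> f x2 = ys m.
  move=> pqm fm; have [dg Sg <-] := gP m.
  have [_ _ gz _] := zP m.
  apply: (sel_uniq HM gU df dg Sf Sg (Uz m)) => //; rewrite gz.
  have [y' [_ Un]] := W (z m) pqm.
  have -> : f (z m) = y' by apply: Un => //; case: (Sf (z m) (Uz m)).
  by apply: esym; apply: Un => //; exact: Yz.
have := ysP n; rewrite -(fy n) // -(fy n.+1) //; exact: olt_irr.
Qed.

End Gap.

(** * Pieces of an interval of good points *)

Section Pieces.
Context (L : language) (d : Order.disp_t) (M : structure L d).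
Hypothesis HM : dctc M.
Context (X : M -> M -> Prop).
Hypothesis dX : def2 X.
Local Notation Y := (bd X).
Context (K : M -> Prop).
Hypothesis gK : good_domain X K.

Definition trivial_end s : Prop := exists x, K x /\ trivial_over X (tail K s x).

Lemma gap_above s x : K x -> ~ trivial_end s -> exists G,
  [/\ segment K s G, loc_const K G, G x & exists t, K t /\ ~ G t].
Proof.
move=> Kx nt; apply: contrapT => nG; apply: nt; exists x; split=> //.
apply: (nogap_trivial HM dX gK Kx) => G sG lG Gx t Kt.
by apply: contrapT => nGt; apply: nG; exists G; split=> //; exists t.
Qed.

Definition adjacent x z : Prop := exists p q, [/\ uniform X p q,
  forall w, oitv true p q w -> K w, oitv true p q x & oitv true p q z].

(** The window used depends on how far the branch is followed, but the branch
    does not; so one formula describes it up to the end. *)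
Lemma adjacent_unbounded s x : K x ->
  (forall t, K t -> exists z, adjacent x z /\ olt s t z) ->
  trivial_over X (tail K s x).
Proof.
move=> Kx unb z0 y [Kz0 xz0] Yz0.
have dY := def2_bd dX; have dK := gd_def gK.
have gt := tail_domain gK s x.
pose R x' y' := exists p q u v, (forall w, oitv true p q w -> K w) /\ win X p q u v /\
  (oitv true p q z0 /\ oitv true u v y) /\
  (oitv true p q x' /\ oitv true u v y') /\ Y x' y'.
have dR : def2 R by rewrite /R /win; dfn.
have gd p q : (forall w, oitv true p q w -> K w) -> good_domain X (oitv true p q).
  by move=> H; apply: gd_itv => w /H/(gd_good gK).
have val x' y' : R x' y' -> exists p q h, [/\ good_domain X (oitv true p q),
    oitv true p q z0, oitv true p q x' & [/\ defF h, sel X (oitv true p q) h,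
    h z0 = y & h x' = y']].
  move=> [p [q [u [v [pqK [W [[zpq yuv] [[xpq yuv'] Yy']]]]]]]].
  have [h [dh Sh hu]] := win_sel dX (gd p q pqK) W.
  exists p, q, h; split=> //; first exact: gd.
  split=> //.
    have [y1 [_ U]] := W z0 zpq.
    have -> : h z0 = y1 by apply: U; [apply: hu|case: (Sh z0 zpq)].
    by apply: esym; apply: U.
  have [y1 [_ U]] := W x' xpq.
  have -> : h x' = y1 by apply: U; [apply: hu|case: (Sh x' xpq)].
  by apply: esym; apply: U.
have uniqR x' y1 y2 : R x' y1 -> R x' y2 -> y1 = y2.
  move=> /val[p [q [h [g1 z1 x1 [dh Sh hz <-]]]]] /val[p' [q' [h' [g2 z2 x2 [dh' Sh' hz' <-]]]]].
  apply: (sel_uniq HM (gdI g1 g2) dh dh' (z := z0)) => //.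
  - by apply: sel_sub Sh _ => ? [].
  - by apply: sel_sub Sh' _ => ? [].
  - by rewrite hz.
have chart x' : tail K s x x' -> exists p q h, [/\ good_domain X (oitv true p q),
    oitv true p q z0, oitv true p q x' & [/\ defF h, sel X (oitv true p q) h,
    h z0 = y & forall w, oitv true p q w -> R w (h w)]].
  move=> [Kx' xx']; have [t [tz tx tE]] := omax s z0 x'.
  have Kt : K t by case: tE => ->.
  have [z [[p [q [U pqK xpq zpq]]] tz']] := unb t Kt.
  have cv : convex (oitv true p q) := gd_convex (gd p q pqK).
  have z0pq : oitv true p q z0 by apply: (cv s x z0 z); ord.
  have xpq' : oitv true p q x' by apply: (cv s x x' z); ord.
  have [u [v [yuv W]]] := U z0 z0pq y Yz0.
  have [h [dh Sh hu]] := win_sel dX (gd p q pqK) W.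
  have Rh w : oitv true p q w -> R w (h w).
    move=> wpq; exists p, q, u, v; split=> //; split=> //; split=> //.
    by split; [split=> //; exact: hu|case: (Sh w wpq)].
  exists p, q, h; split=> //; [exact: gd|split=> //].
  apply: (uniqR z0); first exact: Rh.
  by exists p, q, u, v; do 4 (split=> //).
have [||h [dh hR]] := graph_fun (M := M) (K := tail K s x) (R := R) _ dR.
- exact: gd_def gt.
- move=> x' /chart[p [q [h [_ _ xpq [_ _ _ Rh]]]]]; exists (h x').
  by split=> [|y' Ry']; [exact: Rh|apply: (uniqR x') => //; exact: Rh].
exists h; split=> //; last first.
  have [p [q [h' [_ zpq _ [_ _ <- Rh]]]]] := chart z0 (conj Kz0 xz0).
  by apply: (uniqR z0); [apply: hR|apply: Rh].
move=> x' tx; have [p [q [h' [gpq zpq xpq [dh' Sh' hz Rh]]]]] := chart x' tx.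
have [_ _ _ [_ _ _ Yx']] : [/\ True, True, True & [/\ True, True, True & Y x' (h x')]].
  by have [? [? [? [? [_ [_ [_ [_ Yx']]]]]]]] := hR x' tx.
split=> //; have [_ ch] := Sh' x' xpq; apply: cont_ext ch _.
apply: nbhS (nbhI (gd_open gpq xpq) (gd_open gt tx)) _ => w [wpq tw].
by apply: (uniqR w); [apply: Rh|apply: hR].
Qed.

Lemma adjacent_bounded s x : K x -> ~ trivial_end s ->
  exists t, [/\ K t, olt s x t & forall z, adjacent x z -> ole s z t].
Proof.
move=> Kx nt; apply: contrapT => nb; apply: nt; exists x; split=> //.
apply: (adjacent_unbounded Kx) => t Kt; apply: contrapT => n; apply: nb.
have [x' [Kx' xx']] := above_in gK s Kx.
have [m [tm xm mE]] := omax s t x'.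
exists m; split; [by case: mE => ->|by ord|].
move=> z Az mz; apply: n; exists z; split=> //; ord.
Qed.

(** The point [f x] bounds the points adjacent to [x]. If the iterates of [f] at
    [x] do not reach the end, the points below some iterate are a union of
    classes of linked points, so the class of [x] does not reach the end either.
    If they do, the end has countable cofinality, and one gap above each iterate
    gives a family of cuts of which only finitely many are below any given
    point: this is what makes the pieces open. *)
Lemma end_cuts s : exists C : (M -> Prop) -> Prop,
  [/\ forall G, C G -> segment K s G,
      forall x, K x -> nbh x (fun z => forall G, C G -> (G z <-> G x)) &
      trivial_end s \/ forall x, K x -> exists x', [/\ K x', olt s x x' &
        exists G, (C G \/ (segment K s G /\ uniform_closed X K G)) /\
          G x /\ ~ G x']].
Proof.
have [te|nt] := pselect (trivial_end s).
  exists (fun=> False); split=> //; last by left.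
  by move=> x Kx; have [p [q [xpq _ _]]] := uniform_at gK Kx; exists p, q.
have /choice[f fP] : forall x, exists t, K x -> [/\ K t, olt s x t &
    forall z, adjacent x z -> ole s z t].
  move=> x; have [Kx|nK] := pselect (K x); last by exists x.
  by have [t ?] := adjacent_bounded Kx nt; exists t.
pose z x n := iter n f x.
have Kz x n : K x -> K (z x n).
  by move=> Kx; elim: n => //= n IH; case: (fP _ IH).
have incz x n : K x -> olt s (z x n) (z x n.+1).
  by move=> Kx; case: (fP _ (Kz x n Kx)).
pose G x t := exists n, ole s t (z x n).
have sG x : segment K s (G x).
  by move=> a b Ka [n bn] ab; exists n; ord.
have cG x : K x -> uniform_closed X K (G x).
  move=> Kx p q U pqK a b apq bpq [n an].
  have [bn|nb] := pselect (ole s b (z x n)); first by exists n.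
  have npq : oitv true p q (z x n).
    have cv : convex (oitv true p q).
      by apply: (gd_convex (X := X)); apply: gd_itv => w /pqK/(gd_good gK).
    by apply: (cv s a _ b) => //; ord.
  exists n.+1; have [_ _] := fP _ (Kz x n Kx); apply.
  by exists p, q; split.
have [[x [Kx cof]]|ncof] := pselect (exists x, K x /\ forall t, K t -> G x t);
    last first.
  exists (fun=> False); split=> //.
    by move=> x Kx; have [p [q [xpq _ _]]] := uniform_at gK Kx; exists p, q.
  right=> x Kx; have [t [Kt nGt]] : exists t, K t /\ ~ G x t.
    apply: contrapT => n; apply: ncof; exists x; split=> // t Kt.
    by apply: contrapT => nGt; apply: n; exists t.
  exists t; split=> //.
    by apply: contrapT => xt; apply: nGt; exists 0%N.
  exists (G x); split; first by right; split; [exact: sG|exact: cG].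
  by split=> //; exists 0%N; exact: ole_refl.
have /choice[H HP] : forall n, exists H, [/\ segment K s H, loc_const K H,
    H (z x n) & exists t, K t /\ ~ H t].
  by move=> n; apply: gap_above => //; exact: Kz.
exists (fun G => exists n, G = H n); split.
- by move=> _ [n ->]; case: (HP n).
- move=> a Ka; have [n an] := cof a Ka.
  have N1 m : nbh a (fun b => forall k, (k < m)%N -> (H k b <-> H k a)).
    elim: m => [|m IH].
      by have [p [q [xpq _ _]]] := uniform_at gK Ka; exists p, q.
    have [_ lH _ _] := HP m.
    apply: nbhS (nbhI IH (lH a Ka)) _ => b [H1 H2] k.
    by rewrite ltnS leq_eqVlt => /predU1P[->|/H1].
  have N2 : nbh a (fun b => olt s b (z x n.+1)).
    by apply: nbh_above; have := incz x n Kx; ord.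
  apply: nbhS (nbhI (N1 n.+1) (nbhI N2 (gd_open gK Ka))) _ => b [H1 [bz Kb]] _ [k ->].
  have [kn|nk] := leqP k n; first exact: H1.
  have zk : ole s (z x n.+1) (z x k).
    move: nk; elim: k => // k IH; rewrite ltnS leq_eqVlt => /predU1P[->|/IH H3].
      exact: ole_refl.
    by have := incz x k Kx; ord.
  have [sH _ Hz _] := HP k; have := incz x n Kx.
  by split=> _; apply: (sH _ _ _ Hz) => //; ord.
- right=> a Ka; have [n an] := cof a Ka.
  have [sH _ Hz [t [Kt nH]]] := HP n.
  have Ha : H n a.
    by have [lt|->//|] := olt_cases s a (z x n); [exact: (sH _ _ Ka Hz)|ord].
  exists t; split=> //.
    have [//|E|ta] := olt_cases s a t; first by subst t.
    by case: nH; apply: (sH _ _ Kt Ha).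
  by exists (H n); split=> //; left; exists n.
Qed.

(** [E] is the equivalence relation of lying in the same piece: on the same side
    of the cuts made for both ends and of all cuts between classes of linked
    points. *)
Lemma pieces : exists E : M -> M -> Prop,
  [/\ forall x y, E x y -> K x /\ K y,
      forall x, K x -> E x x,
      forall x y, E x y -> E y x &
      forall x y z, E x y -> E y z -> E x z] /\
  [/\ forall x, K x -> nbh x (E x),
      forall x, convex (E x),
      forall x y, E x y -> linked X K x y &
      forall s x, K x -> (forall x', K x' -> olt s x x' -> E x x') ->
        trivial_end s].
Proof.
have [Cr [sr lr er]] := end_cuts true; have [Cl [sl ll el]] := end_cuts false.
pose F G := (exists s, segment K s G /\ uniform_closed X K G) \/ (Cr G \/ Cl G).
have sF G : F G -> exists s, segment K s G.
  by move=> [[s [? _]]|[/sr|/sl]]; [exists s|exists true|exists false].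
pose E x y := (K x /\ K y) /\ forall G, F G -> (G x <-> G y).
exists E; split; split.
- by move=> x y [].
- by move=> x Kx.
- by move=> x y [[Kx Ky] H]; split=> // G FG; have := H G FG; tauto.
- move=> x y z [[Kx Ky] H] [[_ Kz] H']; split=> // G FG.
  by have := H G FG; have := H' G FG; tauto.
- move=> x Kx; have [p [q [xpq U pqK]]] := uniform_at gK Kx.
  have N : nbh x (oitv true p q) by exists p, q.
  apply: nbhS (nbhI N (nbhI (lr x Kx) (ll x Kx))) _ => w [wpq [Hr Hl]].
  split; first by split=> //; exact: pqK.
  move=> G [[s [_ cG]]|[CG|CG]]; first by split; apply: (cG p q).
    by have := Hr G CG; tauto.
  by have := Hl G CG; tauto.
- move=> x s a b c [[_ Ka] Ha] [[Kx Kc] Hc] ab bc.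
  have Kb : K b := gd_convex gK Ka Kc ab bc.
  split=> // G FG; have Ga := Ha G FG; have Gc := Hc G FG.
  have [s' sG] := sF G FG.
  have [?|?|?] := olt_cases s a b; try (by subst b); last by ord.
  have [?|?|?] := olt_cases s b c; try (by subst c); last by ord.
  have [E'|E'] : s' = s \/ s' = ~~ s by case: (s); case: (s'); auto.
    subst s'; have := sG b c Kb; have := sG a b Ka; tauto.
  subst s'; have := sG b a Kb; have := sG c b Kc; rewrite !olt_neg; tauto.
- move=> x y [[Kx Ky] H]; apply: (unsplit_linked HM dX gK) => // s G sG cG.
  by apply: H; left; exists s.
- move=> s x Kx H; have [//|cut] : trivial_end s \/
      forall x, K x -> exists x', [/\ K x', olt s x x' & exists G, F G /\ G x /\ ~ G x'].
    case: s H => H.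
      case: er => [|er]; [by left|right=> a /er[b [Kb ab [G [FG HG]]]]].
      exists b; split=> //; exists G; split=> //.
      by case: FG => [?|?]; [right; left|left; exists true].
    case: el => [|el]; [by left|right=> a /el[b [Kb ab [G [FG HG]]]]].
    exists b; split=> //; exists G; split=> //.
    by case: FG => [?|?]; [right; right|left; exists false].
  have [x' [Kx' xx' [G [FG [Gx nG]]]]] := cut x Kx.
  by case: nG; have [_ H'] := H x' Kx' xx'; apply/(H' G FG).
Qed.

End Pieces.

(** * Pieces of the set of good points *)

Section GlobalPieces.
Context (L : language) (d : Order.disp_t) (M : structure L d).
Hypothesis HM : dctc M.
Hypothesis HC : forall R, def2 (M := M) R -> gen_cont R.
Context (X : M -> M -> Prop).
Hypothesis dX : def2 X.
Local Notation Y := (bd X).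

(** An end of an interval inside a piece is bounded by a point of the piece, or
    it is an end of [K], and pieces reach an end of [K] only if the boundary is
    trivial there. *)
Lemma interval_half K (E : M -> M -> Prop) (I : set M) s x z0 :
  good_domain X K -> (forall y, K y -> nbh y (E y)) ->
  (forall x y, E x y -> E y x) -> (forall x y z, E x y -> E y z -> E x z) ->
  (forall x y, E x y -> K x /\ K y) -> (forall x, convex (E x)) ->
  (forall x y, E x y -> linked X K x y) ->
  (forall s x, K x -> (forall x', K x' -> olt s x x' -> E x x') ->
     trivial_end X K s) ->
  open_interval I -> (forall z, I z -> E x z) -> I z0 ->
  exists U, [/\ good_domain X U, U z0, trivial_over X U &
    forall z, I z -> ole s z0 z -> U z].
Proof.
move=> gK oE symE trE EK cE lE tE oI IE Iz0.
have dK := gd_def gK.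
have [_ Kz0] := EK _ _ (IE _ Iz0).
have zE z : I z -> E z0 z by move=> Iz; apply: (trE _ x); [apply/symE|]; apply: IE.
have [[t [Et It]]|unb] := pselect (exists t, E z0 t /\ forall z, I z -> ole s z t).
  have [U [gU UK Uz Ut TU]] := lE _ _ Et; exists U; split=> // z Iz zz.
  by apply: (gd_convex gU Uz Ut zz); apply: It.
have [l [u lu]] := open_interval_bounds s oI.
have tailE y : K y -> olt s z0 y -> E z0 y.
  move=> Ky zy; apply: contrapT => nE; apply: unb.
  have nI : ~ I y by move=> /zE.
  case: u lu => [e|] lu; last first.
    case: nI; apply/lu; split=> //; have [lz _] := (lu z0).1 Iz0.
    by case: l lz {lu} => // a lz; ord.
  have [lz ze] := (lu z0).1 Iz0.
  have ey : ole s e y.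
    move=> ye; apply: nI; apply/lu; split=> //.
    by case: l lz {lu} => // a lz; ord.
  have Ke : K e := gd_convex gK Kz0 Ky (oltW ze) ey.
  exists e; split; last by move=> z /lu[_]; ord.
  have /(nbh_oitv s)[p [q [epq H]]] := oE e Ke.
  have [m [mp mz mE]] := omax s p z0.
  have [w mw] : exists w, oitv s m e w by apply: olt_dense; case: mE => ->; ord.
  have Iw : I w.
    by apply/lu; split; [case: l lz {lu} => // a lz; ord|ord].
  by apply: (trE _ w); [exact: zE|apply/symE/H; ord].
have [x1 [Kx1 T1]] := tE s z0 Kz0 tailE.
have gt := tail_domain gK s x1.
have [x1z|zx1] := pselect (olt s x1 z0).
  exists (tail K s x1); split=> // z Iz zz.
  by split; [case: (EK _ _ (zE z Iz))|ord].
have [x2 [Kx2 x12]] := above_in gK s Kx1.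
have [U [gU UK Uz U2 TU]] := lE z0 x2 (tailE x2 Kx2 ltac:(ord)).
exists (fun z => U z \/ tail K s x1 z); split.
- exact: (gdU gU gt U2 (conj Kx2 x12)).
- by left.
- exact: (trivialU HM gU gt TU T1 U2 (conj Kx2 x12)).
- move=> z Iz zz; have [Kz|] := pselect (olt s x1 z).
    by right; split=> //; case: (EK _ _ (zE z Iz)).
  by move=> zx; left; apply: (gd_convex gU (s := s) Uz U2); ord.
Qed.

Definition component x x' : Prop := good X x /\ forall z,
  (ole true x z /\ ole true z x') \/ (ole true x' z /\ ole true z x) -> good X z.

Lemma component_refl x : good X x -> component x x.
Proof.
by move=> gx; split=> // z [[? ?]|[? ?]]; (have -> : z = x by ord).
Qed.

Lemma component_good x x' : component x x' -> good X x'.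
Proof.
move=> [_ H]; apply: H.
by have [?|?|?] := olt_cases true x x'; [left|left|right]; ord.
Qed.

Lemma component_sym x x' : component x x' -> component x' x.
Proof.
move=> C; split; first exact: component_good C.
by move=> z [H|H]; apply: C.2; [right|left].
Qed.

Lemma component_trans x y z : component x y -> component y z -> component x z.
Proof.
move=> [gx H] [gy H']; split=> // w [[xw wz]|[zw wx]].
  have [yw|wy] := pselect (ole true y w); first by apply: H'; left.
  by apply: H; left; ord.
have [yw|wy] := pselect (ole true w y); first by apply: H'; right.
by apply: H; right; ord.
Qed.

Lemma good_nbh x : good X x -> nbh x (good X).
Proof.
move=> gx; have [p [q [xpq H]]] := bad_isolated HM HC dX x.
exists p, q; split=> // z zpq; have [->//|zx] := pselect (z = x).
exact: H.
Qed.

Lemma component_domain x : good X x -> good_domain X (component x).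
Proof.
move=> gx; have dg := def1_good dX; split.
- by rewrite /component; move: (good X) dg => g dg; dfn.
- have cv y z w : component x y -> component x w -> ole true y z ->
      ole true z w -> component x z.
    move=> [_ Hy] [_ Hw] yz zw; split=> // v [[xv vz]|[zv vx]].
      by apply: Hw; left; ord.
    by apply: Hy; right; ord.
  move=> s y z w Cy Cw yz zw; case: s yz zw => yz zw; first exact: (cv y z w).
  by apply: (cv w z y) => //; ord.
- move=> y Cy; have [p [q [ypq H]]] := good_nbh (component_good Cy).
  exists p, q; split=> // z zpq; apply: (component_trans Cy).
  split; first exact: component_good Cy.
  by move=> w [[? ?]|[? ?]]; apply: H; ord.
- by move=> y; exact: component_good.
Qed.

Lemma global_pieces : exists E : M -> M -> Prop,
  [/\ forall x y, E x y -> good X x /\ good X y,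
      forall x, good X x -> E x x,
      forall x y, E x y -> E y x &
      forall x y z, E x y -> E y z -> E x z] /\
  [/\ forall x, good X x -> nbh x (E x),
      forall x, convex (E x),
      forall x y, E x y -> exists U,
        [/\ good_domain X U, U x, U y & trivial_over X U] &
      forall x (I : set M), open_interval I -> (forall z, I z -> E x z) ->
        trivial_over X I].
Proof.
have /choice[P PP] : forall K, exists E : M -> M -> Prop, good_domain X K ->
  [/\ forall x y, E x y -> K x /\ K y,
      forall x, K x -> E x x,
      forall x y, E x y -> E y x &
      forall x y z, E x y -> E y z -> E x z] /\
  [/\ forall x, K x -> nbh x (E x),
      forall x, convex (E x),
      forall x y, E x y -> linked X K x y &
      forall s x, K x -> (forall x', K x' -> olt s x x' -> E x x') ->
        trivial_end X K s].
  move=> K; have [gK|n] := pselect (good_domain X K).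
    by have [E ?] := pieces HM dX gK; exists E.
  by exists (fun _ _ => False).
pose E x y := good X x /\ P (component x) x y.
have PE x (gx : good X x) := PP (component x) (component_domain gx).
have EC x y : E x y -> component x y /\ component x = component y.
  move=> [gx Pxy]; have [[H _ _ _] _] := PE x gx.
  have [_ Cxy] := H _ _ Pxy; split=> //.
  apply: funext => z; apply: propext; split; apply: component_trans => //.
  exact: component_sym.
exists E; split; split.
- by move=> x y Exy; split; [case: Exy|have [/component_good] := EC x y Exy].
- move=> x gx; split=> //; have [[_ H _ _] _] := PE x gx.
  by apply: H; exact: component_refl.
- move=> x y Exy; have [Cxy Ceq] := EC x y Exy; split; first exact: component_good Cxy.
  by rewrite -Ceq; have [gx Pxy] := Exy; have [[_ _ H _] _] := PE x gx; apply: H.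
- move=> x y z Exy [gy Pyz]; have [Cxy Ceq] := EC x y Exy; have [gx Pxy] := Exy.
  split=> //; have [[_ _ _ H] _] := PE x gx.
  by apply: (H x y z) => //; rewrite Ceq.
- move=> x gx; have [_ [H _ _ _]] := PE x gx.
  by apply: nbhS (H x (component_refl gx)) _ => z.
- move=> x s a b c [gx Pa] [_ Pc] ab bc; split=> //; have [_ [_ H _ _]] := PE x gx.
  exact: (H x s a b c).
- move=> x y [gx Pxy]; have [_ [_ _ H _]] := PE x gx.
  by have [U [gU _ Ux Uy TU]] := H _ _ Pxy; exists U.
- move=> x I oI IE.
  have [[z0 Iz0] _] := oI.
  have [gx _] := IE z0 Iz0.
  have [[E1 E2 E3 E4] [E5 E6 E7 E8]] := PE x gx.
  have half s := interval_half s (component_domain gx) E5 E3 E4 E1 E6 E7 E8 oI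
    (fun z Iz => (IE z Iz).2) Iz0.
  have [U [gU Uz TU HU]] := half true; have [V [gV Vz TV HV]] := half false.
  apply: trivial_sub (trivialU HM gU gV TU TV Uz Vz) _ => z Iz.
  by have [?|?|?] := olt_cases true z0 z; [left; apply: HU => //; ord|subst z; left|right; apply: HV => //; ord].
Qed.

End GlobalPieces.

(** * Branches and bands *)

Section Branches.
Context (L : language) (d : Order.disp_t) (M : structure L d).
Hypothesis HM : dctc M.
Context (X : M -> M -> Prop).
Hypothesis dX : def2 X.
Local Notation Y := (bd X).

Definition inband (l u : option M) (t : M) : Prop :=
  (if l is Some a then olt true a t else True) /\
  (if u is Some b then olt true t b else True).

Lemma inband_convex l u : convex (inband l u).
Proof.
move=> s x y z [lx xu] [lz zu] xy yz; rewrite /inband.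
by case: s xy yz => xy yz; split;
  [case: l lx lz => // a lx lz|case: u xu zu => // a xu zu| |]; try ord;
  [case: l lx lz => // a lx lz|case: u xu zu => // a xu zu]; ord.
Qed.

Lemma inband_nonempty l u :
  (forall a b, l = Some a -> u = Some b -> olt true a b) ->
  exists t, inband l u t.
Proof.
case: l => [a|]; case: u => [b|] H.
- have [t ?] := olt_dense (H a b erefl erefl); by exists t.
- by have [t ?] := olt_above true a; exists t.
- by have [t ?] := olt_below true b; exists t.
- by have [t] := carrier_nonempty M; exists t.
Qed.

Lemma fibre_const x (I : M -> Prop) t t' : convex I -> (forall t, I t -> ~ Y x t) ->
  I t -> I t' -> (X x t <-> X x t').
Proof.
move=> cI nY It It'; have dXx : def1 (X x) by dfn.
have H s a b : I a -> I b -> ole s a b -> X x a -> X x b.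
  move=> Ia Ib ab; apply: (interval_connected HM (s := s) dXx ab) => z az zb.
  have /contrapT[p [q [zpq Hpq]]] := nY z (cI s a z b Ia Ib az zb).
  apply/(nbh_oitv s); exists p, q; split=> // w wpq.
  by case: Hpq => H; have := H z zpq; have := H w wpq; tauto.
have [tt'|tt'] := pselect (ole true t t').
  by split; [apply: (H true)|apply: (H false)].
by split; [apply: (H false) => //|apply: (H true) => //]; ord.
Qed.

(** The bounds are the boundary points next to [y]. Comparing with all boundary
    points of the fibre instead characterizes the same band. *)
Lemma band_bounds x y : ~ Y x y -> exists l u : option M,
  [/\ forall a, l = Some a -> Y x a, forall b, u = Some b -> Y x b,
      inband l u y &
      forall t, inband l u t <->
        (~ Y x t /\ forall w, Y x w -> (olt true w y <-> olt true w t))].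
Proof.
move=> nY.
have side s : exists e : option M, [/\ forall a, e = Some a -> Y x a,
    if e is Some a then olt s y a else True &
    forall w, Y x w -> olt s y w -> if e is Some a then ole s a w else False].
  have [H|n] := pselect (exists w, olt s y w /\ Y x w).
    have [m [[Ym ym] Hm]] := bd_next HM dX H.
    by exists (Some m); split=> [a [<-]||w Yw yw] //; apply: Hm.
  by exists None; split=> // w Yw yw; apply: n; exists w.
have [l [Yl yl Hl]] := side false; have [u [Yu yu Hu]] := side true.
have band_y : inband l u y.
  by split; [move: yl; case: (l)|move: yu; case: (u)].
exists l, u; split=> // t; split.
  move=> [lt tu].
  have out w : Y x w -> (olt true w y /\ olt true w t) \/ (olt true y w /\ olt true t w).
    move=> Yw; have [wy|E|yw] := olt_cases true w y.
    - left; split=> //; have := Hl w Yw ltac:(ord).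
      by case: (l) lt => // a lt ?; ord.
    - by subst w.
    - right; split=> //; have := Hu w Yw ltac:(ord).
      by case: (u) tu => // a tu ?; ord.
  split; first by move=> /out[|] [? ?]; ord.
  by move=> w /out[|] [? ?]; split; ord.
move=> [nYt Ht]; split.
  case: (l) Yl yl => // a Yl ya; have Ya := Yl a erefl.
  by apply/(Ht a Ya); ord.
case: (u) Yu yu => // a Yu ya; have Ya := Yu a erefl.
have [//|E|at_] := olt_cases true t a; first by subst t.
by have := (Ht a Ya).2 at_; ord.
Qed.

Definition branch x y x' y' : Prop := exists U h,
  [/\ good_domain X U, U x, U x' & defF h] /\ [/\ sel X U h, h x = y & h x' = y'].

Lemma branch_sym x y x' y' : branch x y x' y' -> branch x' y' x y.
Proof. by move=> [U [h [[? ? ? ?] [? ? ?]]]]; exists U, h. Qed.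

Lemma branch_trans x y x' y' x'' y'' : branch x y x' y' -> branch x' y' x'' y'' ->
  branch x y x'' y''.
Proof.
move=> [U [h [[gU Ux Ux' dh] [Sh hx hx']]]] [V [k [[gV Vx' Vx'' dk] [Sk kx' kx'']]]].
have [|g [dg Sg gh gk]] := sel_glue HM gU gV dh dk Sh Sk Ux' Vx'.
  by rewrite hx'.
exists (fun x => U x \/ V x), g; split; split; auto.
- exact: (gdU gU gV Ux' Vx').
- by rewrite gh.
- by rewrite gk.
Qed.

Lemma branch_lt t x y x' y' w w' : branch x y x' y' -> branch x w x' w' ->
  olt t y w -> olt t y' w'.
Proof.
move=> [U [h [[gU Ux Ux' dh] [Sh <- <-]]]] [V [k [[gV Vx Vx' dk] [Sk <- <-]]]].
apply: (sel_lt HM (gdI gU gV) dh dk) => //.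
  by apply: sel_sub Sh _ => ? [].
by apply: sel_sub Sk _ => ? [].
Qed.

Lemma branch_uniq x y x' y1 y2 : branch x y x' y1 -> branch x y x' y2 -> y1 = y2.
Proof.
move=> [U [h [[gU Ux Ux' dh] [Sh hx <-]]]] [V [k [[gV Vx Vx' dk] [Sk kx <-]]]].
apply: (sel_uniq HM (gdI gU gV) dh dk (z := x)) => //.
- by apply: sel_sub Sh _ => ? [].
- by apply: sel_sub Sk _ => ? [].
- by rewrite hx.
Qed.

Lemma branch_bd x y x' y' : branch x y x' y' -> Y x y /\ Y x' y'.
Proof.
by move=> [U [h [[_ Ux Ux' _] [Sh <- <-]]]]; split; [case: (Sh x)|case: (Sh x')].
Qed.

(** By normality, membership in [X] is locally constant along a branch. *)
Lemma branch_X x y x' y' : branch x y x' y' -> X x y -> X x' y'.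
Proof.
move=> [U [h [[gU Ux Ux' dh] [Sh <- <-]]]].
have dS : def1 (fun w => X w (h w)) by dfn.
apply: (gd_conn HM gU dS Ux Ux') => w Uw; have [Yw cw] := Sh w Uw.
have [u0 u0y] := olt_below true (h w); have [v0 v0y] := olt_above true (h w).
have [|p [q [u [v [[wpq huv] [_ [W HX]]]]]]] := ((gd_good gU Uw).1 (h w)).2 Yw u0 v0.
  by ord.
have N : nbh w (oitv true p q) by exists p, q.
apply: nbhS (nbhI N (nbhI (gd_open gU Uw) (cont_nbh cw huv))) _ => z [zpq [Uz hz]].
by apply: HX => //; case: (Sh z Uz).
Qed.

(** The band between consecutive branches contains no boundary point, so
    membership in [X] does not depend on the height, and by normality it is
    locally constant in [x]. *)
Lemma band_X U x x' l u y : good_domain X U -> trivial_over X U -> U x -> U x' ->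
  (forall a, l = Some a -> Y x a) -> (forall b, u = Some b -> Y x b) ->
  inband l u y -> (forall t, inband l u t -> ~ Y x t) -> X x y ->
  forall y', ~ Y x' y' ->
  (forall a a', l = Some a -> branch x a x' a' -> olt true a' y') ->
  (forall b b', u = Some b -> branch x b x' b' -> olt true y' b') -> X x' y'.
Proof.
move=> gU TU Ux Ux' Yl Yu yb nYb Xxy y' nY' l' u'.
have lift (e : option M) : (forall a, e = Some a -> Y x a) ->
    exists f : option (M -> M), omap (fun g => g x) f = e /\
      forall g, f = Some g -> defF g /\ sel X U g.
  case: e => [a|] Ye; last by exists None.
  have [g [dg Sg gx]] := TU x a Ux (Ye a erefl).
  by exists (Some g); rewrite /= gx; split=> // _ [<-].
have [lo [loE Slo]] := lift l Yl; have [hi [hiE Shi]] := lift u Yu.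
pose B w := inband (omap (fun g => g w) lo) (omap (fun g => g w) hi).
have Bx t : B x t <-> inband l u t by rewrite /B loE hiE.
have B' : B x' y'.
  rewrite /B; split.
    case: lo loE Slo {Bx B} => //= g gx /(_ g erefl)[dg Sg].
    by apply: (l' (g x)) => //; exists U, g.
  case: hi hiE Shi {Bx B} => //= g gx /(_ g erefl)[dg Sg].
  by apply: (u' (g x)) => //; exists U, g.
have nYB w t : U w -> B w t -> ~ Y w t.
  move=> Uw [lt tu] Yt; have [g [dg Sg gw]] := TU w t Uw Yt.
  apply: (nYb (g x)); last by case: (Sg x Ux).
  apply/Bx; split.
    case: lo Slo lt {loE Bx B' B} => //= f /(_ f erefl)[df Sf] lt.
    by apply: (sel_lt HM gU df dg Sf Sg Uw Ux); rewrite gw.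
  case: hi Shi tu {hiE Bx B' B} => //= f /(_ f erefl)[df Sf] tu.
  by apply: (sel_lt HM gU dg df Sg Sf Uw Ux); rewrite gw.
have neB w : U w -> exists t, B w t.
  move=> Uw; apply: inband_nonempty => a b.
  have := (Bx y).2 yb; rewrite {1}/B.
  case: lo Slo {loE Bx B' nYB B} => //= f /(_ f erefl)[df Sf].
  case: hi Shi {hiE} => //= g /(_ g erefl)[dg Sg] [/= fy yg] [<-] [<-].
  by apply: (sel_lt HM gU df dg Sf Sg Ux Uw); ord.
have cB w t t' : U w -> B w t -> B w t' -> (X w t <-> X w t').
  by move=> Uw; apply: (@fibre_const w (B w)) => [|v]; [exact: inband_convex|exact: nYB].
have dB : def1 (fun w => forall t, B w t -> X w t).
  rewrite /B /inband; case: lo Slo {loE Bx B' nYB neB cB B} => [f|] Sf;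
  case: hi Shi {hiE} => [g|] Sg /=.
  - by have [df _] := Sf f erefl; have [dg _] := Sg g erefl; dfn.
  - by have [df _] := Sf f erefl; dfn.
  - by have [dg _] := Sg g erefl; dfn.
  - by dfn.
suff : forall t, B x' t -> X x' t by apply.
apply: (gd_conn HM gU dB Ux Ux'); last first.
  by move=> t Bt; apply/(cB x t y) => //; apply/Bx.
move=> w Uw; have [t Bt] := neB w Uw.
have [p [q [c [e [wpq [tce H]]]]]] := ((gd_good gU Uw).1 t).1 (nYB w t Uw Bt).
have N1 : nbh w (oitv true p q) by exists p, q.
have N2 : nbh w (fun z => B z t).
  case: Bt => lt tu; apply: nbhI.
    case: lo Slo lt {loE Bx B' nYB neB cB dB B} => /= [f /(_ f erefl)[df Sf] lt|].
      by apply: cont_nbh_lt lt; case: (Sf w Uw).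
    by move=> _ _; exists p, q.
  case: hi Shi tu {hiE Bx B' nYB neB cB dB B} => /= [f /(_ f erefl)[df Sf] tu|].
    by apply: cont_nbh_gt tu; case: (Sf w Uw).
  by move=> _ _; exists p, q.
apply: nbhS (nbhI N1 (nbhI N2 (gd_open gU Uw))) _ => z [zpq [Bz Uz]].
have E : X z t <-> X w t.
  by case: H => H; have := H z t zpq tce; have := H w t wpq tce; tauto.
split=> HB t' Bt'.
  by apply/(cB w t' t) => //; apply/E; apply: HB.
by apply/(cB z t' t) => //; apply/E; apply: HB.
Qed.

End Branches.

(** * Order topology, dimension and definability of planar sets *)

Section Topology.
Context (L : language) (d : Order.disp_t) (M : structure L d).

Lemma oitv_set (p q : M) : [set` `]p, q[] = oitv true p q.
Proof.
apply/seteqP; split=> x /=; rewrite in_itv /=; first by move=> /andP.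
by move=> [? ?]; apply/andP.
Qed.

Lemma nbhs_nbh (x : M) (A : set M) : nbhs x A <-> nbh x A.
Proof.
split=> [|[p [q [xpq H]]]]; last first.
  rewrite itv_nbhsE; exists `]p, q[; last by rewrite oitv_set.
  by split=> //; have : oitv true p q x by []; rewrite -oitv_set.
rewrite itv_nbhsE => -[i [oi xi] iA].
have [|l [u lu]] := @open_interval_bounds _ _ M true [set` i].
  by split; [exists x|exists i].
have [lx xu] := (lu x).1 xi.
have [p [px pl]] : exists p, olt true p x /\ (if l is Some a then ole true a p else True).
  case: l lx {lu} => [a|] ax; first by exists a; split=> //; exact: ole_refl.
  by have [p ?] := olt_below true x; exists p.
have [q [xq qu]] : exists q, olt true x q /\ (if u is Some b then ole true q b else True).
  case: u xu {lu} => [b|] xb; first by exists b; split=> //; exact: ole_refl.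
  by have [q ?] := olt_above true x; exists q.
exists p, q; split=> // z zpq; apply: iA; apply/lu.
by split; [case: (l) pl => // a ?|case: (u) qu => // b ?]; ord.
Qed.

Lemma open_nbh (V : set M) : open V <-> forall x, V x -> nbh x V.
Proof.
rewrite openE; split=> H x Vx; first exact/nbhs_nbh/H.
exact/nbhs_nbh/H.
Qed.

Lemma continuous_cont_at (h : M -> M) x : cont_at h x -> {for x, continuous h}.
Proof.
move=> hx A /nbhs_nbh[u [v [huv HA]]].
by apply/nbhs_nbh; apply: nbhS (cont_nbh hx huv) _ => z /HA.
Qed.

Lemma nbhs_box (p : M * M) (A : set (M * M)) : nbhs p A <->
  exists a b u v, [/\ oitv true a b p.1, oitv true u v p.2 &
    forall x y, oitv true a b x -> oitv true u v y -> A (x, y)].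
Proof.
split=> [[[P Q] /= [/nbhs_nbh[a [b [pab HP]]] /nbhs_nbh[u [v [puv HQ]]]] H]|].
  by exists a, b, u, v; split=> // x y /HP ? /HQ ?; apply: H.
move=> [a [b [u [v [pab puv H]]]]].
exists (oitv true a b, oitv true u v) => /=; last by move=> [x y] [/= ? ?]; apply: H.
by split; apply/nbhs_nbh; [exists a, b|exists u, v].
Qed.

Lemma interior_box (A : set (M * M)) p : (A°)%classic p <->
  exists a b u v, [/\ oitv true a b p.1, oitv true u v p.2 &
    forall x y, oitv true a b x -> oitv true u v y -> A (x, y)].
Proof. exact: nbhs_box. Qed.

Lemma isolated_box (A : set (M * M)) p : isolated A p <-> A p /\
  exists a b u v, [/\ oitv true a b p.1, oitv true u v p.2 &
    forall x y, oitv true a b x -> oitv true u v y -> A (x, y) -> (x, y) = p].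
Proof.
split=> [[/set_mem Ap [V /nbhs_box[a [b [u [v [pab puv HV]]]]] VA]]|].
  split=> //; exists a, b, u, v; split=> // x y xab yuv Axy.
  have VAxy : (V `&` A) (x, y) by split; [exact: HV|].
  by move: VAxy; rewrite [X in X _]VA.
move=> [Ap [a [b [u [v [pab puv H]]]]]]; split; first exact/mem_set.
exists [set q | oitv true a b q.1 /\ oitv true u v q.2].
  by apply/nbhs_box; exists a, b, u, v.
apply/seteqP; split=> [[x y] [[/= ? ?] ?]|q ->]; first exact: H.
by split.
Qed.

Lemma set_dim2 (A : set (M * M)) : (A° !=set0)%classic -> set_dim A = Some 2.
Proof.
move=> [p ip]; rewrite /set_dim; case: asboolP => [A0|_].
  by have := interior_subset ip; rewrite A0.
by case: asboolP => // -[]; exists p.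
Qed.

Lemma set_dim1 (A : set (M * M)) : ~ (A° !=set0)%classic ->
  (exists2 p, A p & ~ isolated A p) -> set_dim A = Some 1.
Proof.
move=> nA [p Ap np]; rewrite /set_dim; case: asboolP => [A0|_].
  by have := Ap; rewrite A0.
case: asboolP => // _; case: asboolP => // H.
by case: np; exact: H.
Qed.

Lemma set_dim0 (A : set (M * M)) : ~ (A° !=set0)%classic -> A !=set0 ->
  A `<=` isolated A -> set_dim A = Some 0.
Proof.
move=> nA [p Ap] iA; rewrite /set_dim; case: asboolP => [A0|_].
  by have := Ap; rewrite A0.
by case: asboolP => // _; case: asboolP.
Qed.

Lemma inband_interval (I : set M) l u : (I = inband l u) -> I !=set0 -> open_interval I.
Proof.
move=> -> ne; split=> //.
exists (Interval (if l is Some a then BRight a else BInfty _ true)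
                 (if u is Some b then BLeft b else BInfty _ false)).
  by case: l {ne} => [a|]; case: u.
apply/seteqP; rewrite /inband.
case: l {ne} => [a|]; case: u => [b|]; split=> x /=; rewrite in_itv /=;
  rewrite ?andbT //; try by move=> [].
- by move=> [? ?]; apply/andP.
- by move=> /andP.
Qed.

Lemma definable2_def2 (A : set (M * M)) : definable2 A <-> def2 (fun x y => A (x, y)).
Proof.
split=> [[k [phi [c E]]]|dA].
  pose f (v : 'I_2 + 'I_k) : bool + M :=
    match v with inl i => inl (i == ord0) | inr j => inr (c j) end.
  exists (formula_map f phi) => -[] e; rewrite sat_map.
  pose v (i : 'I_2) := e (i == ord0).
  have -> : A (e true, e false) = [set v : 'I_2 -> M | A (v ord0, v ord_max)] v.
    by [].
  rewrite E /=; set e1 := _ \o f; set e2 := fun _ => _.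
  by have -> : e1 = e2 by apply: funext => -[i|j].
have dP : defP (fun e : 'I_2 -> M => A (e ord0, e ord_max)).
  exact (@defP_app2 _ _ M 'I_2 (fun x y => A (x, y)) (fun e => e ord0)
    (fun e => e ord_max) dA (defT_var _ _) (defT_var _ _)).
have [k [psi [c H]]] := defP_param dP.
by exists k, psi, c; apply/seteqP; split=> v /=; move/H.
Qed.

End Topology.

(** * The cells *)

Section Cells.
Context (L : language) (d : Order.disp_t) (M : structure L d).
Hypothesis HM : dctc M.
Hypothesis HC : forall R, def2 (M := M) R -> gen_cont R.
Context (X : M -> M -> Prop).
Hypothesis dX : def2 X.
Local Notation Y := (bd X).

Context (E : M -> M -> Prop).
Hypothesis Egood : forall x y, E x y -> good X x /\ good X y.
Hypothesis Erefl : forall x, good X x -> E x x.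
Hypothesis Esym : forall x y, E x y -> E y x.
Hypothesis Etrans : forall x y z, E x y -> E y z -> E x z.
Hypothesis Enbh : forall x, good X x -> nbh x (E x).
Hypothesis Econvex : forall x, convex (E x).
Hypothesis Elinked : forall x y, E x y -> exists U,
  [/\ good_domain X U, U x, U y & trivial_over X U].
Hypothesis Etrivial : forall x (I : set M), open_interval I ->
  (forall z, I z -> E x z) -> trivial_over X I.

(* Over a bad point, pieces and branches are reduced to points. *)
Definition same_base x x' : Prop := E x x' \/ (~ good X x /\ x = x').
Definition same_branch x y x' y' : Prop :=
  (E x x' /\ branch X x y x' y') \/ [/\ ~ good X x, x = x', y = y' & Y x y].

(** A point off the boundary is compared with all branches and not just with the
    two around it, which makes transitivity clear. *)
Definition same_cell (p q : M * M) : Prop := same_base p.1 q.1 /\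
  ((Y p.1 p.2 /\ same_branch p.1 p.2 q.1 q.2) \/
   [/\ ~ Y p.1 p.2, ~ Y q.1 q.2 & forall w w', same_branch p.1 w q.1 w' ->
     (olt true w p.2 <-> olt true w' q.2)]).

Lemma same_baseP x x' : same_base x x' ->
  (E x x' /\ (good X x /\ good X x')) \/ [/\ ~ good X x, ~ good X x' & x = x'].
Proof.
by move=> [/[dup]/Egood[? ?] ?|[n <-]]; [left|right].
Qed.

Lemma same_base_refl x : same_base x x.
Proof. by have [/Erefl|] := pselect (good X x); [left|right]. Qed.

Lemma same_base_sym x y : same_base x y -> same_base y x.
Proof. by move=> [/Esym|[n <-]]; [left|right]. Qed.

Lemma same_base_trans x y z : same_base x y -> same_base y z -> same_base x z.
Proof.
move=> [Exy|[n <-//]] [Eyz|[n <-]]; left => //; exact: Etrans Eyz.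
Qed.

Lemma same_branch_bd x y x' y' : same_branch x y x' y' -> Y x y /\ Y x' y'.
Proof. by move=> [[_ /branch_bd]|[_ <- <-]]. Qed.

Lemma same_branch_sym x y x' y' : same_branch x y x' y' -> same_branch x' y' x y.
Proof.
by move=> [[/Esym ? /branch_sym ?]|[? <- <- ?]]; [left|right].
Qed.

Lemma same_branch_trans x y x' y' x'' y'' : same_branch x y x' y' ->
  same_branch x' y' x'' y'' -> same_branch x y x'' y''.
Proof.
move=> [[Ex B]|[n <- <- _]] // [[Ex' B']|[n <- <- _]]; left => //.
by split; [exact: Etrans Ex'|exact: (branch_trans HM B B')].
Qed.

Lemma same_branch_ex x x' y : same_base x x' -> Y x y ->
  exists y', same_branch x y x' y'.
Proof.
move=> [Ex|[n <-]] Yy; last by exists y; right.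
have [U [gU Ux Ux' TU]] := Elinked Ex; have [h [dh Sh hx]] := TU x y Ux Yy.
by exists (h x'); left; split=> //; exists U, h.
Qed.

Lemma same_branch_uniq x y x' y1 y2 : same_branch x y x' y1 ->
  same_branch x y x' y2 -> y1 = y2.
Proof.
move=> [[Ex B]|[n <- <- _]] [[Ex' B']|[n' ? <- _]] //.
- exact: (branch_uniq HM B B').
- by case: n'; case: (Egood Ex).
- by case: n; case: (Egood Ex').
Qed.

Lemma same_branch_lt t x y x' y' w w' : same_branch x y x' y' ->
  same_branch x w x' w' -> olt t y w -> olt t y' w'.
Proof.
move=> [[Ex B]|[n <- <- _]] [[Ex' B']|[n' ? <- _]] //.
- exact: (branch_lt HM B B').
- by case: n'; case: (Egood Ex).
- by case: n; case: (Egood Ex').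
Qed.

Lemma same_branch_refl x y : Y x y -> same_branch x y x y.
Proof.
move=> Yy; have [y' B] := same_branch_ex (same_base_refl x) Yy.
have [[Ex [U [h [[gU Ux Ux' dh] [Sh hx hy']]]]]|[n _ Ey _]] := B; last by right.
by left; split=> //; exists U, h.
Qed.

Lemma same_cell_refl p : same_cell p p.
Proof.
split; first exact: same_base_refl.
have [Yp|nY] := pselect (Y p.1 p.2); [left|right]; first by split=> //; exact: same_branch_refl.
split=> // w w' B; have [Yw _] := same_branch_bd B.
by rewrite (same_branch_uniq B (same_branch_refl Yw)).
Qed.

Lemma same_cell_bd p q : same_cell p q -> (Y p.1 p.2 <-> Y q.1 q.2).
Proof. by move=> [_ [[Yp /same_branch_bd[]]|[]]]. Qed.

Lemma same_cell_sym p q : same_cell p q -> same_cell q p.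
Proof.
move=> [/same_base_sym Sb [[Yp B]|[np nq H]]]; split=> //; [left|right].
  by split; [case: (same_branch_bd B)|exact: same_branch_sym].
by split=> // w w' /same_branch_sym /H ?; apply: iff_sym.
Qed.

Lemma same_cell_trans p q r : same_cell p q -> same_cell q r -> same_cell p r.
Proof.
move=> C1 C2; have [S1 H1] := C1; have [S2 H2] := C2.
split; first exact: same_base_trans S2.
case: H1 => [[Yp B]|[np nq H]]; case: H2 => [[Yq B']|[nq' nr H']]; [left|..].
- by split=> //; exact: same_branch_trans B'.
- by case: nq'; case: (same_branch_bd B).
- by [].
right; split=> // w w' B; have [Yw _] := same_branch_bd B.
have [v Bv] := same_branch_ex S1 Yw.
have := H w v Bv.
have := H' v w' (same_branch_trans (same_branch_sym Bv) B); tauto.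
Qed.

(** As branches keep their order, the two around the point decide. *)
Lemma same_cell_band x y x' y' l u : same_base x x' -> ~ Y x y ->
  (forall a, l = Some a -> Y x a) -> (forall b, u = Some b -> Y x b) ->
  inband l u y ->
  (forall t, inband l u t -> ~ Y x t) ->
  same_cell (x, y) (x', y') <->
  (forall a a', l = Some a -> same_branch x a x' a' -> olt true a' y') /\
  (forall b b', u = Some b -> same_branch x b x' b' -> olt true y' b').
Proof.
move=> Sb nY Yl Yu [ly yu] nYb; split.
  move=> [_ [[/nY//]|[/= _ nY' H]]]; split=> [a a' El B|b b' Eu B].
    by apply/(H a a' B); rewrite El in ly.
  have [_ Yb'] := same_branch_bd B.
  have [lt|Eq|//] := olt_cases true b' y'; last by rewrite Eq in Yb'.
  by have := (H b b' B).2 lt; rewrite Eu in yu; ord.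
move=> [Hl Hu].
have out w w' : same_branch x w x' w' ->
    (olt true w y /\ olt true w' y') \/ (olt true y w /\ olt true y' w').
  move=> B; have [Yw Yw'] := same_branch_bd B.
  have [wl|lw] := pselect (exists a, l = Some a /\ ole true w a).
    have [a [El wa]] := wl; left.
    have [a' Ba] := same_branch_ex Sb (Yl a El).
    have a'y := Hl a a' El Ba; rewrite El in ly; split; first by ord.
    have [lt|Eq|] := olt_cases true w a; last by ord.
      by have := same_branch_lt B Ba lt; ord.
    by subst w; rewrite (same_branch_uniq B Ba).
  have [wu|uw] := pselect (exists b, u = Some b /\ ole true b w).
    have [b [Eu bw]] := wu; right.
    have [b' Bb] := same_branch_ex Sb (Yu b Eu).
    have yb' := Hu b b' Eu Bb; rewrite Eu in yu; split; first by ord.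
    have [lt|Eq|] := olt_cases true b w; last by ord.
      by have := same_branch_lt Bb B lt; ord.
    by subst w; rewrite (same_branch_uniq B Bb).
  case: (nYb w) => //; split.
    case: l lw {Yl ly nYb Hl} => // a lw.
    by apply: contrapT => n; apply: lw; exists a; split=> //; ord.
  case: u uw {Yu yu nYb Hu} => // b uw.
  by apply: contrapT => n; apply: uw; exists b; split=> //; ord.
split=> //; right; split=> //=.
  move=> Yy'; have [w B] := same_branch_ex (same_base_sym Sb) Yy'.
  by have [] := out w y' (same_branch_sym B); ord.
by move=> w w' /out[|] [? ?]; split; ord.
Qed.

Lemma same_cell_X p q : same_cell p q -> X p.1 p.2 -> X q.1 q.2.
Proof.
move: p q => [x y] [x' y'] C /= Xp; have [/= Sb H] := C.
case: H => [[Yp [[_ /branch_X]|[_ <- <- _]]]|[np nq H]] //; first by apply.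
have [l [u [Yl Yu yb bP]]] := band_bounds HM dX np.
have nYb t : inband l u t -> ~ Y x t by move=> /bP[].
have [Hl Hu] := (same_cell_band y' Sb np Yl Yu yb nYb).1 C.
case: (same_baseP Sb) => [[Ex _]|[nx _ Ex]].
  have [U [gU Ux Ux' TU]] := Elinked Ex.
  apply: (band_X HM dX gU TU Ux Ux' Yl Yu yb nYb Xp nq).
  - by move=> a a' El B; apply: (Hl a) => //; left.
  - by move=> b b' Eu B; apply: (Hu b) => //; left.
subst x'.
apply/(fibre_const HM dX (x := x) (I := inband l u) (inband_convex (l := l) (u := u)) nYb yb) => //.
split.
  case: l Yl Hl {nYb yb bP} => // a Yl Hl.
  by apply: (Hl a a erefl); apply: same_branch_refl; apply: Yl.
case: u Yu Hu {nYb yb bP} => // b Yu Hu.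
by apply: (Hu b b erefl); apply: same_branch_refl; apply: Yu.
Qed.

Lemma piece_base x : good X x -> quasi_base [set x' | E x x'].
Proof.
move=> gx; split.
- by exists x; exact: Erefl.
- apply/open_nbh => x' /= Ex; have [_ gx'] := Egood Ex.
  by apply: nbhS (Enbh gx') _ => z; exact: Etrans.
- move=> a b c Ea Ec /andP[ab bc].
  by apply: (Econvex (x := x) (s := true) Ea Ec); rewrite /ole /olt => ?;
    [move: ab|move: bc]; rewrite leNgt => /negP; apply.
Qed.

Lemma gd_inband l u : (forall t, inband l u t -> good X t) ->
  good_domain X (inband l u).
Proof.
move=> H; split=> //.
- by rewrite /inband; case: (l) => [a|]; case: (u) => [b|]; dfn.
- exact: inband_convex.
- move=> t [lt tu]; have N : nbh t (fun=> True).
    by have [p pt] := olt_below true t; have [q tq] := olt_above true t; exists p, q.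
  apply: nbhI.
    case: (l) lt => [a|] at_; last exact: nbhS N _.
    have at' : olt false t a by ord.
    by apply: nbhS (nbh_above at') _ => z ?; ord.
  case: (u) tu => [b|] tb; last exact: nbhS N _.
  exact: nbh_above.
Qed.

(** On an open interval inside a piece the boundary is trivial, and the branch
    coincides with the definable one that shares a value with it. *)
Lemma branch_quasi_map x y (f : M -> M) : good X x ->
  (forall x', E x x' -> branch X x y x' (f x')) -> quasi_map [set x' | E x x'] f.
Proof.
move=> gx Hf; have [_ oV _] := piece_base gx; split.
  rewrite (continuous_open_subspace f oV) => x' /set_mem /= Ex.
  apply: continuous_cont_at.
  have [U [h [[gU Ux Ux' dh] [Sh hx hf]]]] := Hf x' Ex.
  have [_ ch] := Sh x' Ux'; apply: cont_ext ch _.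
  have [_ gx'] := Egood Ex.
  apply: nbhS (nbhI (gd_open gU Ux') (Enbh gx')) _ => z [Uz Ez].
  have Bz : branch X x y z (h z) by exists U, h.
  exact: (branch_uniq HM Bz (Hf z (Etrans Ex Ez))).
move=> I oI IV; apply/definable2_def2.
have TI := Etrivial oI IV.
have [[z0 Iz0] _] := oI.
have [l [u lu]] := open_interval_bounds true oI.
have IE : I = inband l u.
  by apply: funext => z; apply: propext; exact: lu.
have gI : good_domain X I.
  by rewrite IE; apply: gd_inband => t /lu /IV/Egood[].
have Bz0 := Hf z0 (IV _ Iz0); have [_ Yz0] := branch_bd Bz0.
have [h [dh Sh hz0]] := TI z0 (f z0) Iz0 Yz0.
have fh z : I z -> f z = h z.
  move=> Iz; have Bz : branch X z0 (f z0) z (h z) by exists I, h.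
  exact: (branch_uniq HM (Hf z (IV z Iz)) (branch_trans HM Bz0 Bz)).
have dI := gd_def gI.
have : def2 (fun a b => I a /\ b = h a) by dfn.
apply: defP_ext => e; rewrite /graph_on /=.
by split=> -[Ie Ee]; split=> //; rewrite Ee fh.
Qed.

Definition cell_dim (p : M * M) : nat :=
  if `[< good X p.1 >] then (if `[< Y p.1 p.2 >] then 1 else 2)%N
  else (if `[< Y p.1 p.2 >] then 0 else 1)%N.

Lemma same_cell_dim p q : same_cell p q -> cell_dim p = cell_dim q.
Proof.
move=> C; rewrite /cell_dim.
have -> : `[< Y p.1 p.2 >] = `[< Y q.1 q.2 >].
  exact/asbool_equiv_eq/same_cell_bd.
suff -> : `[< good X p.1 >] = `[< good X q.1 >] by [].
by apply: asbool_equiv_eq; case: C => /same_baseP[[_ []]|[]].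
Qed.

Lemma cell_dimP p : [/\ cell_dim p = 0%N <-> ~ good X p.1 /\ Y p.1 p.2,
  cell_dim p = 1%N <-> (~ good X p.1 /\ ~ Y p.1 p.2) \/ (good X p.1 /\ Y p.1 p.2) &
  cell_dim p = 2%N <-> good X p.1 /\ ~ Y p.1 p.2].
Proof.
by rewrite /cell_dim; case: asboolP => ?; case: asboolP => ?; split; split=> //; tauto.
Qed.

(** A box has a good fibre, and the boundary of a fibre contains no interval. *)
Lemma thin_interior (A : set (M * M)) :
  (forall p, A p -> ~ good X p.1 \/ Y p.1 p.2) -> ~ (A° !=set0)%classic.
Proof.
move=> HA [p /interior_box[a [b [u [v [pab puv H]]]]]].
have [|x [xab gx]] := good_dense HM HC dX (a := a) (b := b); first by ord.
have [|y [yuv nY]] := bd_noint HM dX (s := true) x (a := u) (b := v); first by ord.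
by case: (HA _ (H x y xab yuv)).
Qed.

Lemma bad_boundary_isolated (A : set (M * M)) :
  (forall p, A p -> ~ good X p.1 /\ Y p.1 p.2) -> A `<=` isolated A.
Proof.
move=> HA p Ap; have [nx Yp] := HA p Ap.
have [a [b [pab Hx]]] := bad_isolated HM HC dX p.1.
have [u [v [puv Hy]]] := bd_isolated HM dX p.1 p.2.
apply/isolated_box; split=> //; exists a, b, u, v; split=> // x y xab yuv Axy.
have [/= ngx Yxy] := HA _ Axy.
have Ex : x = p.1 by apply: contrapT => /(Hx x xab).
subst x; rewrite (Hy y yuv Yxy); by case: p {Ap nx Yp pab puv Hx Hy xab Axy ngx Yxy HA}.
Qed.

Lemma nbh_other x (P : M -> Prop) : nbh x P -> exists2 z, P z & z <> x.
Proof.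
move=> [p [q [[px xq] H]]]; have [z xz] := olt_dense xq.
by exists z; [apply: H|]; ord.
Qed.

Lemma branch_fun x y : Y x y -> exists f : M -> M,
  forall x', E x x' -> same_branch x y x' (f x').
Proof.
move=> Yy; have /choice[f fP] : forall x', exists y', E x x' -> same_branch x y x' y'.
  move=> x'; have [Ex|n] := pselect (E x x'); last by exists y.
  by have [y' ?] := same_branch_ex (or_introl Ex) Yy; exists y'.
by exists f.
Qed.

Lemma same_branch_good x y x' y' : E x x' -> same_branch x y x' y' ->
  branch X x y x' y'.
Proof. by move=> /Egood[gx _] [[]|[]]. Qed.

Lemma point_cell x y : ~ good X x -> Y x y ->
  [set q | same_cell (x, y) q] = [set (x, y)].
Proof.
move=> nx Yy; apply/seteqP; split=> [[x' y'] [/= /same_baseP Sb H]|_ ->]; last first.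
  exact: same_cell_refl.
case: Sb => [[_ [gx _]]|[_ _ Ex]] //; subst x'.
case: H => [[_ [[Ex _]|[_ _ -> _]]]|[]] //.
by case: (Egood Ex).
Qed.

Lemma vertical_cell x y : ~ good X x -> ~ Y x y -> exists l u,
  inband l u y /\ [set q | same_cell (x, y) q] = [set x] `*` inband l u.
Proof.
move=> nx nY; have [l [u [Yl Yu yb bP]]] := band_bounds HM dX nY.
have nYb t : inband l u t -> ~ Y x t by move=> /bP[].
exists l, u; split=> //; apply/seteqP; split=> [[x' y'] C|[x' y'] [/= -> yb']].
  have [/= /[dup] Sb /same_baseP[[_ [gx _]]|[_ _ Ex]] _] := C; first by [].
  subst x'; split=> //=.
  have [Hl Hu] := (same_cell_band y' Sb nY Yl Yu yb nYb).1 C.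
  split.
    case: l Yl Hl {nYb yb bP} => // a Yl Hl.
    by apply: (Hl a a erefl); apply: same_branch_refl; apply: Yl.
  case: u Yu Hu {nYb yb bP} => // b Yu Hu.
  by apply: (Hu b b erefl); apply: same_branch_refl; apply: Yu.
apply/(same_cell_band y' (same_base_refl x) nY Yl Yu yb nYb).
have fix_branch a a' : same_branch x a x a' -> a' = a.
  move=> B; have [Ya _] := same_branch_bd B.
  exact: same_branch_uniq B (same_branch_refl Ya).
move: yb' => [ly yu]; split=> [a a' El /fix_branch ->|b b' Eu /fix_branch ->].
  by rewrite El in ly.
by rewrite Eu in yu.
Qed.

Lemma horizontal_cell x y : good X x -> Y x y -> exists f : M -> M,
  (forall x', E x x' -> same_branch x y x' (f x')) /\
  [set q | same_cell (x, y) q] = graph_on [set x' | E x x'] f.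
Proof.
move=> gx Yy; have [f fP] := branch_fun Yy; exists f; split=> //.
apply/seteqP; split=> [[x' y'] [/= /same_baseP Sb H]|[x' y'] [/= Ex ->]].
  case: Sb => [[Ex _]|[]] //; split=> //=.
  case: H => [[_ B]|[]] //; exact: same_branch_uniq B (fP x' Ex).
by split; [left|left; split=> //; exact: fP].
Qed.

Lemma band_cell x y : good X x -> ~ Y x y -> exists l u (F : M -> M -> M),
  [/\ inband l u y, forall a, l = Some a -> Y x a, forall b, u = Some b -> Y x b,
      forall a x', Y x a -> E x x' -> same_branch x a x' (F a x') &
      [set q | same_cell (x, y) q] = [set q | E x q.1 /\
        inband (omap (fun a => F a q.1) l) (omap (fun b => F b q.1) u) q.2]].
Proof.
move=> gx nY; have [l [u [Yl Yu yb bP]]] := band_bounds HM dX nY.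
have nYb t : inband l u t -> ~ Y x t by move=> /bP[].
have /choice[F FP] : forall a, exists f : M -> M, forall x', Y x a -> E x x' ->
    same_branch x a x' (f x').
  move=> a; have [Ya|n] := pselect (Y x a); last by exists id.
  by have [f fP] := branch_fun Ya; exists f => x' _; apply: fP.
exists l, u, F; split=> //.
apply/seteqP; split=> [[x' y'] C|[x' y'] [/= Ex [lo hi]]].
  have [/= /[dup] Sb /same_baseP[[Ex _]|[n _ _]] _] := C; last by [].
  split=> //=; have [Hl Hu] := (same_cell_band y' Sb nY Yl Yu yb nYb).1 C.
  split.
    case: l Yl Hl {nYb yb bP C} => //= a Yl Hl.
    by apply: (Hl a _ erefl); apply: FP => //; apply: Yl.
  case: u Yu Hu {nYb yb bP C} => //= b Yu Hu.
  by apply: (Hu b _ erefl); apply: FP => //; apply: Yu.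
have Sb : same_base x x' by left.
apply/(same_cell_band y' Sb nY Yl Yu yb nYb); split=> [a a' El B|b b' Eu B].
  rewrite El /= in lo; rewrite (same_branch_uniq B (FP a x' (Yl a El) Ex)).
  by [].
rewrite Eu /= in hi; rewrite (same_branch_uniq B (FP b x' (Yu b Eu) Ex)).
by [].
Qed.

Lemma cell_thin p : (cell_dim p < 2)%N -> forall q, same_cell p q ->
  ~ good X q.1 \/ Y q.1 q.2.
Proof.
move=> dp q /same_cell_dim E'; move: dp; rewrite E' /cell_dim.
by case: asboolP => ?; case: asboolP => ? //; [right|left|left].
Qed.

Lemma cell_shape p : quasi_cell [set q | same_cell p q] /\
  set_dim [set q | same_cell p q] = Some (cell_dim p).
Proof.
have pp := same_cell_refl p.
have thin := @thin_interior [set q | same_cell p q].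
have := cell_thin (p := p); rewrite /cell_dim.
move: p pp thin => [x y] pp thin /=.
case: asboolP => [gx|ngx]; case: asboolP => [Yy|nY] /= Hthin.
- have [f [fP BE]] := horizontal_cell gx Yy.
  have fP' x' : E x x' -> branch X x y x' (f x').
    by move=> Ex; apply: same_branch_good => //; exact: fP.
  split.
    constructor 3; exists [set x' | E x x'], f; split=> //; first exact: piece_base.
    exact: branch_quasi_map fP'.
  apply: set_dim1; first exact: thin (Hthin erefl).
  exists (x, y) => // /isolated_box[_ [a [b [u [v [/= xab yuv H]]]]]].
  have [U [h [[gU Ux _ dh] [Sh hx _]]]] := fP' x (Erefl gx).
  have [_ ch] := Sh x Ux.
  have N1 : nbh x (fun z => oitv true u v (h z)) by apply: cont_nbh; rewrite ?hx.
  have N2 : nbh x (oitv true a b) by exists a, b.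
  have [z [[hz zab] [Uz Ez]] zx] :=
    nbh_other (nbhI (nbhI N1 N2) (nbhI (gd_open gU Ux) (Enbh gx))).
  have Bz : same_cell (x, y) (z, h z).
    by split; [left|left; split=> //; left; split=> //; exists U, h].
  by have [Ezx _] := H z (h z) zab hz Bz.
- have [l [u [F [yb Yl Yu FP BE]]]] := band_cell gx nY.
  have FP' a x' : Y x a -> E x x' -> branch X x a x' (F a x').
    by move=> Ya Ex; apply: same_branch_good => //; exact: FP.
  split.
    constructor 4; exists [set x' | E x x'], (omap F l), (omap F u); split.
    + exact: piece_base.
    + move=> f; case: l Yl {yb BE} => //= a Yl [<-].
      by apply: (branch_quasi_map gx) => x'; apply: FP'; exact: Yl.
    + move=> g; case: u Yu {yb BE} => //= b Yu [<-].
      by apply: (branch_quasi_map gx) => x'; apply: FP'; exact: Yu.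
    + case: l Yl yb {BE} => //= a Yl yb f g [<-]; case: u Yu yb => //= b Yu yb [<-].
      move=> x' Ex; have Ya := Yl a erefl; have Yb := Yu b erefl.
      have : olt true (F a x') (F b x').
        by apply: (branch_lt HM (FP' a x' Ya Ex) (FP' b x' Yb Ex)); case: yb; ord.
      by [].
    + rewrite BE; apply/seteqP; split=> -[x' y'] /=.
        by case: (l) => [a|]; case: (u) => [b|] /= [? [? ?]]; split.
      by case: (l) => [a|]; case: (u) => [b|] /= [? ? ?]; split.
  apply: set_dim2; exists (x, y); rewrite BE; apply/interior_box.
  have nbh_fun a : Y x a -> exists h, [/\ h x = a, cont_at h x &
      nbh x (fun z => E x z /\ F a z = h z)].
    move=> Ya; have [U [h [[gU Ux _ dh] [Sh hx _]]]] := FP' a x Ya (Erefl gx).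
    exists h; split=> //; first by case: (Sh x Ux).
    apply: nbhS (nbhI (gd_open gU Ux) (Enbh gx)) _ => z [Uz Ez]; split=> //.
    have Bz : branch X x a z (h z) by exists U, h.
    exact: (branch_uniq HM (FP' a z Ya Ez) Bz).
  have [c [cy Nc]] : exists c, olt true c y /\ nbh x (fun z => E x z /\
      forall t, olt true c t -> if omap (fun a => F a z) l is Some a
        then olt true a t else True).
    case: l Yl yb {BE} => [a|] Yl [/= ly _]; last first.
      have [c ?] := olt_below true y; exists c; split=> //.
      by apply: nbhS (Enbh gx) _ => z.
    have [h [hx ch N]] := nbh_fun a (Yl a erefl).
    have [c ayc] := olt_dense ly; exists c; split; first by ord.
    have ac : olt true (h x) c by rewrite hx; ord.
    by apply: nbhS (nbhI N (cont_nbh_lt ch ac)) _ => z [[? ->] ?]; split=> // t ?; ord.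
  have [e [ye Ne]] : exists e, olt true y e /\ nbh x (fun z =>
      forall t, olt true t e -> if omap (fun a => F a z) u is Some a
        then olt true t a else True).
    case: u Yu yb {BE} => [a|] Yu [/= _ yu]; last first.
      have [e ?] := olt_above true y; exists e; split=> //.
      by apply: nbhS (Enbh gx) _ => z.
    have [h [hx ch N]] := nbh_fun a (Yu a erefl).
    have [e yea] := olt_dense yu; exists e; split; first by ord.
    have ae : olt true e (h x) by rewrite hx; ord.
    by apply: nbhS (nbhI N (cont_nbh_gt ch ae)) _ => z [[_ ->] ?] t ?; ord.
  have [p [q [xpq H]]] := nbhI Nc Ne.
  exists p, q, c, e; split=> //= z t zpq [ct te].
  have [[Ez Hc] He] := H z zpq.
  by split=> //; split; [exact: Hc|exact: He].
- have BE := point_cell ngx Yy.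
  split; first by constructor 1; exists (x, y).
  apply: set_dim0; first exact: thin (Hthin erefl).
    by exists (x, y).
  by apply: bad_boundary_isolated => q; rewrite BE => ->.
- have [l [u [yb BE]]] := vertical_cell ngx nY.
  split.
    constructor 2; exists x, (inband l u); split=> //.
    by apply: inband_interval => //; exists y.
  apply: set_dim1; first exact: thin (Hthin erefl).
  exists (x, y) => // /isolated_box[_ [a [b [v [w [/= xab yuv H]]]]]].
  have [m [ym mw mu]] : exists m, [/\ olt true y m, ole true m w &
      if u is Some c then ole true m c else True].
    case: u yb {BE} => [c|] [_ yc]; last first.
      by exists w; split=> //; [ord|exact: ole_refl].
    have [m [? ? mE]] := omin true w c; exists m; split=> //.
    by case: mE => ->; ord.
  have [t yt] := olt_dense ym.
  have Bt : [set q | same_cell (x, y) q] (x, t).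
    rewrite BE; split=> //=; case: yb => ly yu; split.
      by case: (l) ly => // c ?; ord.
    by case: (u) yu mu => // c ? ?; ord.
  by have [Et] := H x t xab ltac:(ord) Bt; subst t; ord.
Qed.

End Cells.

(** A stratum of dimension 0 or 1 contains only points of the boundary or over
    bad points; such a set has empty interior, and the points that are both are
    isolated from each other. *)
Lemma dctc_quasi_cell_decomposition L d (M : structure L d) (A : set (M * M)) :
  dctc M -> (forall R, def2 (M := M) R -> gen_cont R) -> definable2 A ->
  exists P : set (set (M * M)), quasi_cell_decomposition A P.
Proof.
move=> HM HC /definable2_def2 dX; pose X x y := A (x, y).
have [E [[E1 E2 E3 E4] [E5 E6 E7 E8]]] := global_pieces HM HC dX.
pose cell p := [set q | same_cell X E p q].
have crefl p : same_cell X E p p by exact: same_cell_refl.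
have csym p q : same_cell X E p q -> same_cell X E q p.
  exact: same_cell_sym.
have ctrans p q r : same_cell X E p q -> same_cell X E q r -> same_cell X E p r.
  exact: same_cell_trans.
have cellE p q : same_cell X E p q -> cell p = cell q.
  by move=> C; apply/seteqP; split=> r; apply: ctrans => //; exact: csym.
have cellA p q : A p -> same_cell X E p q -> A q.
  move: p q => [x y] [x' y'] Ap C.
  suff H : X x y -> X x' y' by exact: H.
  exact: (same_cell_X HM dX E1 E2 E3 E7 C).
have shape p : quasi_cell (cell p) /\ set_dim (cell p) = Some (cell_dim X p).
  exact: cell_shape.
pose P := [set B | exists2 p, A p & B = cell p].
have stratumE e : stratum P e = [set p | A p /\ cell_dim X p = e].
  apply/seteqP; split=> [q [_ [[p Ap ->] dp] /= C]|p [Ap dp]].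
    split; first exact: cellA C.
    have [_ dp'] := shape p; move: dp; rewrite dp' => -[<-].
    exact/esym/(same_cell_dim E1).
  exists (cell p); last exact: crefl.
  by split; [exists p|rewrite -dp; case: (shape p)].
exists P; split.
- split.
  + apply/seteqP; split=> [q [_ [p Ap ->] C]|p Ap]; first exact: cellA C.
    by exists (cell p); [exists p|exact: crefl].
  + move=> _ _ [p Ap ->] [q Aq ->] [r [/= Cp Cq]].
    by rewrite (cellE _ _ Cp) (cellE _ _ Cq).
  + by move=> _ [p Ap ->]; exists p; exact: crefl.
- by move=> _ [p Ap ->]; case: (shape p).
- move=> e e2; rewrite stratumE; split.
    apply/definable2_def2.
    have dY := def2_bd dX; move: (def1_good dX) (cell_dimP X).
    move: (good X) (bd X) dY => g Y dY dg dimP.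
    have : def2 (fun x y => X x y /\
        match e with
        | 0 => ~ g x /\ Y x y
        | 1 => (~ g x /\ ~ Y x y) \/ (g x /\ Y x y)
        | _ => g x /\ ~ Y x y
        end) by case: e e2 {stratumE} => [|[|[|//]]] _; dfn.
    apply: defP_ext => v; have := dimP (v true, v false).
    by case: e e2 {stratumE} => [|[|[|//]]] _ /= [? ? ?]; tauto.
  have thin n : (n < 2)%N -> ~ ([set p | A p /\ cell_dim X p = n]° !=set0)%classic.
    move=> n2; apply: (thin_interior HM HC dX) => p [_ dp].
    have [d0 d1 _] := cell_dimP X p.
    by case: n n2 dp => [|[|//]] _; [move=> /d0|move=> /d1]; tauto.
  rewrite /dim_at_most /set_dim; case: asboolP => // _.
  case: asboolP => [|_]; first by case: e e2 {stratumE} thin => [|[|[|//]]] // _ H /H; case.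
  case: asboolP => // nis; case: e e2 {stratumE} thin nis => // _ _; case.
  apply: (bad_boundary_isolated HM HC dX) => p [_ dp].
  by have [d0 _ _] := cell_dimP X p; apply/d0.
Qed.

Theorem theorem9p3 (L : language) (d : Order.disp_t) (M : structure L d)
    (hM : o_minimalistic M) (X : set (M * M)%type) (hX : definable2 X) :
  exists P : set (set (M * M)%type), quasi_cell_decomposition X P.
Proof.
apply: dctc_quasi_cell_decomposition hX; first exact: o_minimalistic_dctc.
exact: o_minimalistic_gen_cont.
Qed.
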